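(* Let $H$ be a fixed graph with $H\notin\{K_4,\,C_3+P_1\}$ (up to isomorphism) such that at least one of the following holds: (a) $H$ is an induced subgraph of $P_3+tP_1$ for some integer $t\ge 0$; (b) $H=K_{1,t}$ for some integer $t\ge 1$; (c) $|V(H)|\le 4$. Then there is a certifying algorithm that solves $H$-Pivot-Minor in polynomial time.
   Context: Graphs are finite, without loops or multiple edges. $P_n$, $C_n$, $K_n$, $K_{1,n}$ denote the path, cycle and complete graph on $n$ vertices and the star with $n$ leaves; $G_1+G_2$ is the disjoint union and $tP_1$ is the graph with $t$ vertices and no edges. For a vertex $u$ of a graph $G$, the local complementation $G*u$ is obtained from $G$ by complementing the adjacency between every pair of distinct neighbours of $u$. For an edge $uv$ of $G$, the edge pivot is $G\wedge uv=((G*u)*v)*u$. A graph $G$ contains $H$ as a pivot-minor if $H$ can be obtained from $G$ by a sequence of vertex deletions and edge pivots. For a fixed graph $H$, the problem $H$-Pivot-Minor takes as input a graph $G$ and asks whether $G$ contains a pivot-minor isomorphic to $H$. A certifying algorithm for it decides this and, whenever the answer is yes, also outputs a certificate in the form of a sequence of vertex deletions and edge pivots that modifies $G$ into a graph isomorphic to $H$. *)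

(* Defs.v *)
From HB Require Import structures.
From mathcomp Require Import all_boot.

Set Implicit Arguments.
Unset Strict Implicit.
Unset Printing Implicit Defensive.

(* The vertex set is a subset of an ambient finite type, so that vertices keep
   their names when other vertices are deleted. *)
Record graph (T : finType) := Graph {
  vset : {set T};
  adj : rel T;
  adj_sym : symmetric adj;
  adj_irrefl : irreflexive adj;
  adj_vset : forall x y, adj x y -> x \in vset }.

(* The bijection is between the vertex sets, not between the ambient types. *)
Definition iso (T U : finType) (G : graph T) (H : graph U) : Prop :=
  exists2 f : {x : T | x \in vset G} -> {y : U | y \in vset H},
    bijective f &
    forall x y, adj H (val (f x)) (val (f y)) = adj G (val x) (val y).

Section Operations.
Variable T : finType.
Implicit Types (G : graph T) (S : {set T}) (u v x y : T).

Definition induced_adj G S : rel T :=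
  fun x y => [&& x \in S, y \in S & adj G x y].

Fact induced_sym G S : symmetric (induced_adj G S).
Proof. by move=> x y; rewrite /induced_adj adj_sym andbCA. Qed.

Fact induced_irrefl G S : irreflexive (induced_adj G S).
Proof. by move=> x; rewrite /induced_adj adj_irrefl !andbF. Qed.

Fact induced_vset G S x y : induced_adj G S x y -> x \in vset G :&: S.
Proof. by case/and3P=> xS _ /adj_vset xG; rewrite inE xG. Qed.

Definition induced G S : graph T :=
  Graph (induced_sym G S) (induced_irrefl G S) (@induced_vset G S).

Definition delete G v : graph T := induced G (~: [set v]).

Definition local_compl_adj G u : rel T :=
  fun x y => adj G x y (+) [&& x != y, adj G u x & adj G u y].

Fact local_compl_sym G u : symmetric (local_compl_adj G u).
Proof.
by move=> x y; rewrite /local_compl_adj adj_sym eq_sym [adj G u x && _]andbC.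
Qed.

Fact local_compl_irrefl G u : irreflexive (local_compl_adj G u).
Proof. by move=> x; rewrite /local_compl_adj adj_irrefl eqxx. Qed.

Fact local_compl_vset G u x y : local_compl_adj G u x y -> x \in vset G.
Proof.
rewrite /local_compl_adj; case: (boolP (adj G x y)) => [/adj_vset //|_ /=].
by case/and3P=> _; rewrite adj_sym => /adj_vset.
Qed.

Definition local_compl G u : graph T :=
  Graph (local_compl_sym G u) (local_compl_irrefl G u) (@local_compl_vset G u).

Definition pivot G u v : graph T :=
  local_compl (local_compl (local_compl G u) v) u.

End Operations.

Definition induced_subgraph (T U : finType) (H : graph T) (G : graph U) : Prop :=
  exists2 S : {set U}, S \subset vset G & iso H (induced G S).

Inductive op (T : Type) := Del of T | Piv of T & T.

(* [None] if the operation is illegal, i.e. if the vertex to be deleted or the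
   edge to be pivoted is not present. *)
Definition apply_op (T : finType) (G : graph T) (o : op T) : option (graph T) :=
  match o with
  | Del v => if v \in vset G then Some (delete G v) else None
  | Piv u v => if adj G u v then Some (pivot G u v) else None
  end.

Fixpoint apply_ops (T : finType) (G : graph T) (s : seq (op T)) :
    option (graph T) :=
  if s is o :: s' then
    if apply_op G o is Some G' then apply_ops G' s' else None
  else Some G.

Definition certifies (T U : finType) (G : graph T) (H : graph U)
    (s : seq (op T)) : Prop :=
  exists2 G', apply_ops G s = Some G' & iso G' H.

Definition contains_pivot_minor (T U : finType) (G : graph T) (H : graph U) :
    Prop :=
  exists s, certifies G H s.

Section GraphOfRel.
Variables (T : finType) (e : rel T).

Definition rel_adj : rel T := fun x y => (x != y) && (e x y || e y x).

Fact rel_adj_sym : symmetric rel_adj.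
Proof. by move=> x y; rewrite /rel_adj eq_sym orbC. Qed.

Fact rel_adj_irrefl : irreflexive rel_adj.
Proof. by move=> x; rewrite /rel_adj eqxx. Qed.

Fact rel_adj_vset x y : rel_adj x y -> x \in [set: T].
Proof. by rewrite inE. Qed.

Definition graph_of_rel : graph T :=
  Graph rel_adj_sym rel_adj_irrefl rel_adj_vset.

End GraphOfRel.

Definition path_graph n : graph 'I_n :=
  graph_of_rel (fun i j : 'I_n => j == i.+1 :> nat).

(* Only meaningful for 3 <= n. *)
Definition cycle_graph n : graph 'I_n :=
  graph_of_rel (fun i j : 'I_n => j == i.+1 %% n :> nat).

Definition complete_graph n : graph 'I_n :=
  graph_of_rel (fun _ _ : 'I_n => true).

(* K_{1,n}; the centre is vertex 0. *)
Definition star_graph n : graph 'I_n.+1 :=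
  graph_of_rel (fun i _ : 'I_n.+1 => i == ord0).

Definition edgeless_graph n : graph 'I_n :=
  graph_of_rel (fun _ _ : 'I_n => false).

Section DisjointUnion.
Variables (T U : finType) (G : graph T) (H : graph U).

Definition dunion_adj : rel (T + U) := fun x y =>
  match x, y with
  | inl a, inl b => adj G a b
  | inr a, inr b => adj H a b
  | _, _ => false
  end.

Definition dunion_set : {set T + U} :=
  [set x | match x with inl a => a \in vset G | inr b => b \in vset H end].

Fact dunion_sym : symmetric dunion_adj.
Proof. by case=> a [] b //=; apply: adj_sym. Qed.

Fact dunion_irrefl : irreflexive dunion_adj.
Proof. by case=> a; apply: adj_irrefl. Qed.

Fact dunion_vset x y : dunion_adj x y -> x \in dunion_set.
Proof. by case: x y => a [] b //= /adj_vset; rewrite inE. Qed.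

Definition dunion : graph (T + U)%type :=
  Graph dunion_sym dunion_irrefl dunion_vset.

End DisjointUnion.

(* Model of computation: the language WHILE of N. D. Jones, "Computability and
   Complexity" (MIT Press, 1997), whose data are binary trees.  Instead of
   Jones' unit costs, evaluating an expression is charged the sizes of the
   values of all its subexpressions.  Running time therefore bounds the size of
   all data produced, and is polynomially related to that of a deterministic
   Turing machine. *)
Inductive tree := Nil | Cons of tree & tree.

Fixpoint tree_eq (a b : tree) : bool :=
  match a, b with
  | Nil, Nil => true
  | Cons a1 a2, Cons b1 b2 => tree_eq a1 b1 && tree_eq a2 b2
  | _, _ => false
  end.

Fact tree_eqP : Equality.axiom tree_eq.
Proof.
elim=> [|a1 IH1 a2 IH2] [|b1 b2] /=; try by constructor.
by apply: (iffP andP) => [[/IH1-> /IH2->]|[/IH1 ? /IH2 ?]].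
Qed.

HB.instance Definition _ := hasDecEq.Build tree tree_eqP.

Fixpoint tsize (t : tree) : nat :=
  if t is Cons a b then (tsize a + tsize b).+1 else 1.

Definition thd (t : tree) : tree := if t is Cons a _ then a else Nil.
Definition ttl (t : tree) : tree := if t is Cons _ b then b else Nil.
Definition of_bool (b : bool) : tree := if b then Cons Nil Nil else Nil.

Inductive expr :=
  | EVar of nat
  | ENil
  | ECons of expr & expr
  | EHd of expr
  | ETl of expr
  | EEq of expr & expr.

Inductive cmd :=
  | Skip
  | Assign of nat & expr
  | Seq of cmd & cmd
  | If of expr & cmd & cmd
  | While of expr & cmd.

Definition store := nat -> tree.

Definition update (s : store) (x : nat) (t : tree) : store :=
  fun y => if y == x then t else s y.

Fixpoint eval (s : store) (e : expr) : tree :=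
  match e with
  | EVar x => s x
  | ENil => Nil
  | ECons e1 e2 => Cons (eval s e1) (eval s e2)
  | EHd e1 => thd (eval s e1)
  | ETl e1 => ttl (eval s e1)
  | EEq e1 e2 => of_bool (eval s e1 == eval s e2)
  end.

Fixpoint ecost (s : store) (e : expr) : nat :=
  tsize (eval s e) +
  match e with
  | EVar _ | ENil => 0
  | ECons e1 e2 | EEq e1 e2 => ecost s e1 + ecost s e2
  | EHd e1 | ETl e1 => ecost s e1
  end.

(* [exec c s s' t]: started in store [s], the command [c] terminates in store
   [s'] at cost [t].  In tests, [Nil] is false and all other trees are true. *)
Inductive exec : cmd -> store -> store -> nat -> Prop :=
  | ExecSkip s : exec Skip s s 1
  | ExecAssign s x e :
      exec (Assign x e) s (update s x (eval s e)) (ecost s e).+1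
  | ExecSeq c1 c2 s s1 s2 t1 t2 :
      exec c1 s s1 t1 -> exec c2 s1 s2 t2 ->
      exec (Seq c1 c2) s s2 (t1 + t2).+1
  | ExecIf e c1 c2 s s' t :
      exec (if eval s e == Nil then c2 else c1) s s' t ->
      exec (If e c1 c2) s s' (ecost s e + t).+1
  | ExecWhileDone e c s :
      eval s e = Nil -> exec (While e c) s s (ecost s e).+1
  | ExecWhileStep e c s s1 s2 t1 t2 :
      eval s e <> Nil -> exec c s s1 t1 -> exec (While e c) s1 s2 t2 ->
      exec (While e c) s s2 (ecost s e + t1 + t2).+1.

(* Variable 0 holds the input initially and the output finally. *)
Definition computes (p : cmd) (input output : tree) (t : nat) : Prop :=
  exists2 s', exec p (update (fun _ => Nil) 0 input) s' t & s' 0 = output.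

Definition enc_seq (s : seq tree) : tree := foldr Cons Nil s.

(* Unary; vertex names are smaller than the number of vertices. *)
Definition enc_nat (n : nat) : tree := iter n (Cons Nil) Nil.

Definition enc_graph (n : nat) (G : graph 'I_n) : tree :=
  enc_seq [seq enc_seq [seq of_bool (adj G i j) | j <- enum 'I_n]
          | i <- enum 'I_n].

Definition enc_op (n : nat) (o : op 'I_n) : tree :=
  match o with
  | Del v => Cons (of_bool false) (enc_nat v)
  | Piv u v => Cons (of_bool true) (Cons (enc_nat u) (enc_nat v))
  end.

Definition enc_answer (n : nat) (a : option (seq (op 'I_n))) : tree :=
  if a is Some s then Cons Nil (enc_seq [seq enc_op o | o <- s]) else Nil.

Definition polytime_certifying_pivot_minor (U : finType) (H : graph U) : Prop :=
  exists (p : cmd) (c k : nat),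
  forall (n : nat) (G : graph 'I_n), vset G = [set: 'I_n] ->
  exists (a : option (seq (op 'I_n))) (t : nat),
    [/\ computes p (enc_graph G) (enc_answer a) t,
        t <= c * tsize (enc_graph G) ^ k + c &
        if a is Some s then certifies G H s
        else ~ contains_pivot_minor G H].

(* Main.v *)
Require Import Defs.
From HB Require Import structures.
From mathcomp Require Import all_boot.
From mathcomp Require Import zify.
From Stdlib Require Import Classical.
(* MathComp's abbreviations [Nil] and [Cons] hide the constructors of [tree]. *)
Import Defs.

(* If H is a pivot-minor of a half graph, then every graph G containing H contains
   it in an induced subgraph of bounded size.  Indeed, let H be the subgraph on S of
   a graph K obtained from G by pivoting on B, that is, K is the principal pivot
   transform of G.  If some vertex v is neither in S nor in B, it can be deleted from
   G; so let V - S be contained in B.  Split V - S according to the neighbourhoods in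
   S.  An edge inside a class can be pivoted without changing the graph on S, and
   likewise two edges that form an induced 2P_2 between two classes; either pivot
   removes a vertex outside S from B.  Otherwise the classes are independent and the
   graph between any two of them is a chain graph.  No two vertices of B are twins,
   so if V is large, there is a large half graph in V - S.  Pivoting a pendant edge of
   it removes one vertex from B and keeps a slightly smaller half graph, which still
   contains H.  The graphs P_3 + tP_1, K_{1,t}, P_4, C_4 and 2P_2 are pivot-minors of
   half graphs.

   The other graphs H are C_3, the paw and the diamond.  A shortest odd closed walk of
   length at least 5 is shortened by 2 when one of its edges is pivoted, so G contains
   C_3 if and only if it has an odd closed walk.  The paw and the diamond are pivot
   equivalent, and G contains them if and only if some component of G is neither
   bipartite nor complete.

   In each case, containment of H is decided in polynomial time.  If G contains H and
   is larger than H, then for some vertex v and some neighbour w of v, H is contained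
   in G - v or in the graph obtained by pivoting vw and deleting v.  Hence decisions
   find a certificate. *)

Set Implicit Arguments.
Unset Strict Implicit.
Unset Printing Implicit Defensive.


(** * Pivoting and principal pivot transforms *)

(** A transform depends only on the set [B]: any edge inside [B] may be pivoted first, and the rest
    is a transform on [B] without its two ends. Hence no pivot has to touch a vertex outside [B],
    and deleting such a vertex commutes with all of them. Twins in [B] would put a vector supported
    on [B] into the kernel of [K], and the transform back to [G] would send zero to a nonzero
    vector. A pivot changes the graph on [S] by a matrix that depends only on the neighbourhoods of
    the two ends in [S]; over GF(2) this explains both the invisible pivots and the cancelling
    pairs. The half graph comes from counting: there are boundedly many classes, so a large class
    has many different traces on some class, and these traces form a chain. C_3, the paw and the
    diamond need another route because half graphs are bipartite and pivots create no odd closed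
    walk in a bipartite graph. For each [H] only the existence of a program is claimed. Its answers
    on graphs of bounded size can thus be a finite table, filled in by classical existence; what has
    to be programmed is the search around the table. *)

Section PivotAdjacency.
Variables (T : finType) (G : graph T) (u v : T).
Hypothesis uv : adj G u v.

Let uDv : u != v.
Proof. by apply: contraTneq uv => ->; rewrite adj_irrefl. Qed.

Let simp_edge := (eqxx, negPf uDv, eq_sym v u, uv, adj_sym G v u, adj_irrefl G).

(** The Schur complement of the block of [u] and [v] over GF(2). This block is a transposition and
    its own inverse, which is why the rows of [u] and [v] trade places in the next lemmas. A pair is
    toggled exactly if it joins two different classes among the neighbours of [u] only, of [v] only
    and of both. *)
Lemma pivot_adjE x y : x != u -> x != v -> y != u -> y != v ->
  adj (pivot G u v) x y =
  adj G x y (+) (adj G x u && adj G y v) (+) (adj G x v && adj G y u).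
Proof.
move=> /negPf xu /negPf xv /negPf yu /negPf yv.
rewrite /= /local_compl_adj /= /local_compl_adj /= /local_compl_adj.
rewrite !(simp_edge, xu, xv, yu, yv, eq_sym u x, eq_sym v x, eq_sym u y, eq_sym v y).
rewrite !(adj_sym G u x, adj_sym G v x, adj_sym G u y, adj_sym G v y) /=.
case: (eqVneq x y) => [->|xy]; rewrite ?adj_irrefl /=.
  by case: (adj G y u); case: (adj G y v).
by case: (adj G x u); case: (adj G x v); case: (adj G y u); case: (adj G y v);
  case: (adj G x y).
Qed.

Lemma pivot_adj_edge : adj (pivot G u v) u v.
Proof.
rewrite /= /local_compl_adj /= /local_compl_adj /= /local_compl_adj.
by rewrite !simp_edge.
Qed.

Lemma pivot_adjl y : y != u -> y != v -> adj (pivot G u v) u y = adj G v y.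
Proof.
move=> /negPf yu /negPf yv.
rewrite /= /local_compl_adj /= /local_compl_adj /= /local_compl_adj.
rewrite !(simp_edge, yu, yv, eq_sym u y, eq_sym v y) /=.
by case: (adj G u y); case: (adj G v y).
Qed.

Lemma pivot_adjr y : y != u -> y != v -> adj (pivot G u v) v y = adj G u y.
Proof.
move=> /negPf yu /negPf yv.
rewrite /= /local_compl_adj /= /local_compl_adj /= /local_compl_adj.
rewrite !(simp_edge, yu, yv, eq_sym u y, eq_sym v y) /=.
by case: (adj G u y); case: (adj G v y).
Qed.

End PivotAdjacency.

Lemma adj_neq (T : finType) (G : graph T) x y : adj G x y -> x != y.
Proof. by move=> xy; apply: contraTneq xy => ->; rewrite adj_irrefl. Qed.

Lemma adj_vsetr (T : finType) (G : graph T) x y : adj G x y -> y \in vset G.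
Proof. by rewrite adj_sym; apply: adj_vset. Qed.

Lemma adj_notin (T : finType) (G : graph T) x y :
  (x \notin vset G) || (y \notin vset G) -> adj G x y = false.
Proof.
by move=> xyG; apply: contraTF xyG => xy; rewrite (adj_vset xy) (adj_vsetr xy).
Qed.

(** Stated pointwise, as is done throughout: graphs with the same adjacency need not be equal
    records. *)
Lemma adj_pivotK (T : finType) (G : graph T) u v x y : adj G u v ->
  adj (pivot (pivot G u v) u v) x y = adj G x y.
Proof.
move=> uv; have uDv := adj_neq uv; have puv := pivot_adj_edge uv.
have vu : adj G v u by rewrite adj_sym.
have pvu : adj (pivot (pivot G u v) u v) v u by rewrite adj_sym pivot_adj_edge.
case: (eqVneq x u) => [->|xu].
  case: (eqVneq y u) => [->|yu]; first by rewrite !adj_irrefl.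
  case: (eqVneq y v) => [->|yv]; first by rewrite uv pivot_adj_edge.
  by rewrite pivot_adjl // pivot_adjr.
case: (eqVneq x v) => [->|xv].
  case: (eqVneq y u) => [->|yu]; first by rewrite pvu vu.
  case: (eqVneq y v) => [->|yv]; first by rewrite !adj_irrefl.
  by rewrite pivot_adjr // pivot_adjl.
case: (eqVneq y u) => [->|yu].
  by rewrite adj_sym pivot_adjl // pivot_adjr // adj_sym.
case: (eqVneq y v) => [->|yv].
  by rewrite adj_sym pivot_adjr // pivot_adjl // adj_sym.
rewrite pivot_adjE // pivot_adjE //.
rewrite ![adj (pivot G u v) _ u]adj_sym ![adj (pivot G u v) _ v]adj_sym.
rewrite !pivot_adjl // !pivot_adjr // ![adj G u _]adj_sym ![adj G v _]adj_sym.
by case: (adj G x u); case: (adj G x v); case: (adj G y u); case: (adj G y v);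
  case: (adj G x y).
Qed.

(** An isomorphism of vertex sets given by a map of the whole ambient types. Unlike [iso], it can
    rename the vertices in a sequence of operations, see [map_op]. *)
Definition embeds (T U : finType) (f : T -> U) (G : graph T) (K : graph U) :=
  [/\ {in vset G &, injective f}, vset K = f @: vset G
    & {in vset G &, forall x y, adj K (f x) (f y) = adj G x y}].

Definition map_op (T U : Type) (f : T -> U) (o : op T) : op U :=
  match o with Del v => Del (f v) | Piv u v => Piv (f u) (f v) end.

Section Embeddings.
Variables (T U : finType) (f : T -> U).
Implicit Types (G : graph T) (K : graph U).

Lemma embeds_in G K x : embeds f G K -> x \in vset G -> f x \in vset K.
Proof. by case=> _ -> _ xG; apply: imset_f. Qed.

Lemma embeds_delete G K v : v \in vset G -> embeds f G K ->
  embeds f (delete G v) (delete K (f v)).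
Proof.
move=> vG [f_inj vK f_adj]; split=> /=.
- by move=> x y /setIP[xG _] /setIP[yG _]; apply: f_inj.
- apply/setP=> y; rewrite vK !inE; apply/andP/imsetP.
    case=> /imsetP[x xG ->] fxv; exists x => //.
    by rewrite !inE xG; apply: contraNneq fxv => ->.
  case=> x /setIP[xG]; rewrite !inE => xv ->; split; first exact: imset_f.
  by apply: contraNneq xv => /f_inj->.
- move=> x y /setIP[xG xv] /setIP[yG yv]; rewrite /induced_adj f_adj //.
  rewrite xv yv !inE /=; move: xv yv; rewrite !inE => xv yv.
  have ->: f x != f v by apply: contraNneq xv => /f_inj->.
  by have ->: f y != f v by apply: contraNneq yv => /f_inj->.
Qed.

Lemma embeds_local_compl G K u : u \in vset G -> embeds f G K ->
  embeds f (local_compl G u) (local_compl K (f u)).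
Proof.
move=> uG [f_inj vK f_adj]; split=> //= x y xG yG.
by rewrite /local_compl_adj !f_adj // (inj_in_eq f_inj).
Qed.

Lemma embeds_pivot G K u v : u \in vset G -> v \in vset G -> embeds f G K ->
  embeds f (pivot G u v) (pivot K (f u) (f v)).
Proof. by move=> uG vG e; do 3!apply: embeds_local_compl => //. Qed.

Lemma embeds_apply_op G K o G' : embeds f G K -> apply_op G o = Some G' ->
  exists2 K', apply_op K (map_op f o) = Some K' & embeds f G' K'.
Proof.
move=> e; case: o => [v|u v] /=; case: ifP => // okG [<-].
  exists (delete K (f v)); last exact: embeds_delete.
  by rewrite (embeds_in e).
have uG := adj_vset okG; have vG := adj_vsetr okG.
exists (pivot K (f u) (f v)); last exact: embeds_pivot.
by case: e => _ _ ->; rewrite ?okG.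
Qed.

Lemma embeds_apply_ops s G K G' : embeds f G K -> apply_ops G s = Some G' ->
  exists2 K', apply_ops K (map (map_op f) s) = Some K' & embeds f G' K'.
Proof.
elim: s G K => [|o s IHs] G K e /=; first by case=> <-; exists K.
case oG: (apply_op G o) => [G1|] //; have [K1 -> e1] := embeds_apply_op e oG.
exact: IHs.
Qed.

Lemma embeds_iso G K : embeds f G K -> iso G K.
Proof.
move=> e; have [f_inj vK f_adj] := e.
pose F (x : {x | x \in vset G}) : {y | y \in vset K} :=
  exist _ (f (val x)) (embeds_in e (valP x)).
exists F; last by move=> x y; apply: f_adj; apply: valP.
apply: inj_card_bij => [x y /(congr1 val) /= /f_inj|].
  by move=> xy; apply: val_inj; apply: xy; apply: valP.
by rewrite !card_sig -[leqRHS](card_in_imset f_inj) -vK.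
Qed.

End Embeddings.

Lemma iso_sym (T U : finType) (G : graph T) (K : graph U) : iso G K -> iso K G.
Proof.
case=> f [g fK gK] f_adj; exists g; first by exists f.
by move=> x y; rewrite -f_adj !gK.
Qed.

Lemma iso_trans (T U W : finType) (G : graph T) (K : graph U) (L : graph W) :
  iso G K -> iso K L -> iso G L.
Proof.
case=> f bf f_adj [g bg g_adj]; exists (g \o f); first exact: bij_comp.
by move=> x y; rewrite g_adj f_adj.
Qed.

Lemma iso_card (T U : finType) (G : graph T) (K : graph U) :
  iso G K -> #|vset G| = #|vset K|.
Proof.
by case=> f /bij_eq_card; rewrite !card_sig => e _.
Qed.

Section EmbedsId.
Variable T : finType.
Implicit Types G K : graph T.

Lemma embeds_idP G K : vset G = vset K -> (forall x y, adj G x y = adj K x y) ->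
  embeds id G K.
Proof.
by move=> vGK aGK; split=> //; rewrite imset_id.
Qed.

Lemma iso_refl G : iso G G.
Proof. exact/embeds_iso/embeds_idP. Qed.

End EmbedsId.

(** * Transport of containment between graphs *)

Section Containment.
Variables (W : finType) (H : graph W).

Lemma certifies_embeds (T U : finType) (f : T -> U) (G : graph T) (K : graph U)
  s : embeds f G K -> certifies G H s -> certifies K H (map (map_op f) s).
Proof.
move=> e [G' sG' isoG']; have [K' sK' eK'] := embeds_apply_ops e sG'.
by exists K' => //; apply: iso_trans isoG'; apply/iso_sym/(embeds_iso eK').
Qed.

Lemma contains_embeds (T U : finType) (f : T -> U) (G : graph T) (K : graph U) :
  embeds f G K -> contains_pivot_minor G H -> contains_pivot_minor K H.
Proof. by move=> e [s /(certifies_embeds e) cK]; exists (map (map_op f) s). Qed.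

Lemma contains_iso (T U : finType) (G : graph T) (K : graph U) :
  iso G K -> contains_pivot_minor G H -> contains_pivot_minor K H.
Proof.
move=> isoGK cG; have [F bF F_adj] := isoGK.
(* When the vertex set is empty, no default value for [f] is available, but no operation is legal
   either. *)
have [vG0|[x0 x0G]] := set_0Vmem (vset G).
  case: cG => -[|[v|u v] s]; first last.
  - by case=> G' /=; case: ifP => // /adj_vset; rewrite vG0 inE.
  - by case=> G' /=; rewrite vG0 inE.
  by case=> _ [<-] isoGH; exists [::], K => //; apply: iso_trans isoGH; apply: iso_sym.
pose y0 := val (F (exist _ x0 x0G)).
pose f x := if insub x is Some x' then val (F x') else y0.
have fE x (xG : x \in vset G) : f x = val (F (exist _ x xG)).
  by rewrite /f insubT.
apply: (@contains_embeds _ _ f) cG; split.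
- move=> x y xG yG; rewrite !fE => /val_inj /(bij_inj bF).
  by move/(congr1 val).
- apply/setP=> y; apply/idP/imsetP => [yK|[x xG ->]]; last by rewrite fE; apply: valP.
  have [F' FK F'K] := bF; have xP := valP (F' (exist _ y yK)).
  exists (val (F' (exist _ y yK))) => //.
  rewrite fE (_ : exist _ _ _ = F' (exist _ y yK)) ?F'K //.
  exact: val_inj.
- by move=> x y xG yG; rewrite !fE F_adj.
Qed.

Lemma contains_apply_ops (T : finType) (G G' : graph T) s :
  apply_ops G s = Some G' -> contains_pivot_minor G' H -> contains_pivot_minor G H.
Proof.
move=> sG' [s' [G2 s'G2 isoG2]]; exists (s ++ s'), G2 => //.
elim: s G sG' => [|o s IHs] G /=; first by case=> ->.
by case: (apply_op G o) => // G1; apply: IHs.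
Qed.

Lemma contains_of_iso (T : finType) (G : graph T) :
  iso G H -> contains_pivot_minor G H.
Proof. by move=> isoGH; exists [::], G. Qed.

Lemma contains_pivot (T : finType) (G : graph T) u v : adj G u v ->
  contains_pivot_minor (pivot G u v) H -> contains_pivot_minor G H.
Proof. by move=> uv; apply: (@contains_apply_ops _ _ _ [:: Piv u v]); rewrite /= uv. Qed.

Lemma contains_delete (T : finType) (G : graph T) v : v \in vset G ->
  contains_pivot_minor (delete G v) H -> contains_pivot_minor G H.
Proof. by move=> vG; apply: (@contains_apply_ops _ _ _ [:: Del v]); rewrite /= vG. Qed.

Lemma contains_eq (T : finType) (G K : graph T) :
  vset G = vset K -> (forall x y, adj G x y = adj K x y) ->
  contains_pivot_minor G H -> contains_pivot_minor K H.
Proof. by move=> vGK aGK; apply/contains_embeds/embeds_idP. Qed.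

Lemma contains_induced (T : finType) (G : graph T) S :
  contains_pivot_minor (induced G S) H -> contains_pivot_minor G H.
Proof.
have [n] := ubnP #|vset G :\: S|; elim: n G => // n IHn G ltn cS.
have [G_S|[v /setDP[vG vS]]] := set_0Vmem (vset G :\: S).
  apply: contains_eq cS => /=; first by apply/setIidPl; rewrite -setD_eq0 G_S.
  have inS x y : adj G x y -> x \in S.
    move/adj_vset => xG; apply: contraT => xS.
    by have := in_set0 x; rewrite -G_S inE xS xG.
  move=> x y; rewrite /induced_adj; case xy: (adj G x y); rewrite ?andbF //.
  by rewrite (inS _ _ xy) (inS y x) // adj_sym.
apply: (contains_delete vG); apply: IHn.
  rewrite -ltnS; apply: leq_trans ltn; rewrite ltnS; apply: proper_card; apply/properP; split.
    by apply/subsetP=> x; rewrite !inE => /and3P[-> ->].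
  by exists v; rewrite !inE ?vS // eqxx andbF.
apply: contains_eq cS => /= [|x y].
  apply/setP=> x; rewrite !inE; case: (eqVneq x v) => [->|]; rewrite ?andbT //.
  by rewrite (negPf vS) !andbF.
rewrite /induced_adj /= /induced_adj !inE.
case: (eqVneq x v) => [->|_]; first by rewrite (negPf vS).
by case: (eqVneq y v) => [->|_]; first by rewrite (negPf vS) andbF.
Qed.

Lemma contains_sub (T U : finType) (f : T -> U) (G : graph T) (L : graph U) :
  {in vset G &, injective f} -> {in vset G, forall x, f x \in vset L} ->
  {in vset G &, forall x y, adj L (f x) (f y) = adj G x y} ->
  contains_pivot_minor G H -> contains_pivot_minor L H.
Proof.
move=> f_inj f_in f_adj cG; apply: (@contains_induced _ _ (f @: vset G)).
apply: (contains_embeds (f := f)) cG; split=> //=.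
  by apply/setIidPr/subsetP=> _ /imsetP[x xG ->]; apply: f_in.
by move=> x y xG yG; rewrite /induced_adj f_adj // !imset_f.
Qed.

Lemma card_apply_ops (T : finType) (G G' : graph T) s :
  apply_ops G s = Some G' -> #|vset G'| <= #|vset G|.
Proof.
elim: s G => [|o s IHs] G /=; first by case=> ->.
case oG: (apply_op G o) => [G1|] // /IHs le1; apply: leq_trans le1 _.
case: o oG => [v|u v] /=; case: ifP => // _ [<-] //=.
by apply/subset_leq_card/subsetIl.
Qed.

Lemma contains_card (T : finType) (G : graph T) :
  contains_pivot_minor G H -> #|vset H| <= #|vset G|.
Proof. by case=> s [G' /card_apply_ops le1 /iso_card <-]. Qed.

End Containment.

Lemma contains_target_iso (T U W : finType) (G : graph T) (H : graph U) (K : graph W) :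
  iso H K -> contains_pivot_minor G H -> contains_pivot_minor G K.
Proof. by move=> HK [s [G' sG' /iso_trans/(_ HK) iG']]; exists s, G'. Qed.

Lemma contains_trans (T U W : finType) (G : graph T) (H : graph U) (K : graph W) :
  contains_pivot_minor G H -> contains_pivot_minor H K -> contains_pivot_minor G K.
Proof.
case=> s [G' sG' /iso_sym iG'] /(contains_iso iG'); exact: contains_apply_ops sG'.
Qed.

(** * Principal pivot transforms over GF(2) *)

Section PrincipalPivot.
Variable T : finType.
Implicit Types (G : graph T) (B S : {set T}).

(** The product of the adjacency matrix of [G] with the vector [x] over GF(2). *)
Definition nbsum G (x : T -> bool) (v : T) := \big[addb/false]_w (x w && adj G v w).

Definition swap_on B (x y : T -> bool) (v : T) := if v \in B then y v else x v.

(* [G'] is the principal pivot transform [G * B] over GF(2): exchanging the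
   coordinates in [B] maps the graph [{(x, A x)}] of the adjacency matrix [A] of
   [G] to that of [G'].  This determines [B]-transforms without inverting any
   matrix. *)
Definition ppt G B G' := forall (x : T -> bool) v,
  nbsum G' (swap_on B x (nbsum G x)) v = swap_on B (nbsum G x) x v.

Lemma eq_nbsum G G' x y v : (forall w, adj G v w = adj G' v w) -> x =1 y ->
  nbsum G x v = nbsum G' y v.
Proof. by move=> e exy; apply: eq_bigr => w _; rewrite e exy. Qed.

Lemma nbsum1 G u v : nbsum G (pred1 u) v = adj G v u.
Proof.
rewrite /nbsum (bigD1 u) //= eqxx /= big1 ?addbF // => w /negPf wu.
by rewrite wu.
Qed.

Lemma eq_ppt G1 G2 B K1 K2 : (forall x y, adj G1 x y = adj G2 x y) ->
  (forall x y, adj K1 x y = adj K2 x y) -> ppt G1 B K1 -> ppt G2 B K2.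
Proof.
move=> eG eK p x v.
have e w : nbsum G2 x w = nbsum G1 x w by apply: eq_nbsum.
have -> : swap_on B (nbsum G2 x) x v = swap_on B (nbsum G1 x) x v.
  by rewrite /swap_on e.
rewrite -p; apply: eq_nbsum => // w; rewrite /swap_on; case: ifP => //.
Qed.

(** Exchanging a coordinate twice restores it, so the sets combine by symmetric difference. *)
Lemma ppt_trans G1 G2 G3 B C : ppt G1 B G2 -> ppt G2 C G3 ->
  ppt G1 ((B :\: C) :|: (C :\: B)) G3.
Proof.
move=> p1 p2 x v.
set x1 := swap_on B x (nbsum G1 x).
have e w : swap_on C (nbsum G2 x1) x1 w =
    swap_on ((B :\: C) :|: (C :\: B)) (nbsum G1 x) x w.
  rewrite /swap_on p1 /x1 /swap_on !inE.
  by case: (w \in B); case: (w \in C).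
rewrite -e -p2; apply: eq_nbsum => // w.
by rewrite /swap_on p1 /x1 /swap_on !inE; case: (w \in B); case: (w \in C).
Qed.

(** Row [u] reads [y u = x v (+) R u] and can be solved for [x v], row [v] likewise for [x u];
    substituting in the other rows gives the matrix of the pivoted graph. *)
Lemma ppt_pivot G u v : adj G u v -> ppt G [set u; v] (pivot G u v).
Proof.
move=> uv x z; have uDv := adj_neq uv; have vDu : v != u by rewrite eq_sym.
have vu : adj G v u by rewrite adj_sym.
pose P := pivot G u v; set y := nbsum G x.
have split2 (F : T -> bool) : \big[addb/false]_w F w =
    F u (+) (F v (+) \big[addb/false]_(w | (w != u) && (w != v)) F w).
  by rewrite (bigD1 u) //= (bigD1 v).
have su : swap_on [set u; v] x y u = y u by rewrite /swap_on !inE eqxx.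
have sv : swap_on [set u; v] x y v = y v by rewrite /swap_on !inE eqxx orbT.
have sE w : (w != u) && (w != v) -> swap_on [set u; v] x y w = x w.
  by rewrite /swap_on !inE -negb_or => /negPf->.
pose R w := \big[addb/false]_(p | (p != u) && (p != v)) (x p && adj G w p).
have yE w : y w = (x u && adj G w u) (+) ((x v && adj G w v) (+) R w).
  by rewrite /y /nbsum split2.
have yu : y u = x v (+) R u by rewrite yE adj_irrefl andbF uv andbT.
have yv : y v = x u (+) R v by rewrite yE adj_irrefl andbF vu andbT.
rewrite {1}/nbsum split2 su sv.
under eq_bigr => w wuv do rewrite sE //.
case: (eqVneq z u) => [->|zu].
  under eq_bigr => w /andP[wu wv] do rewrite pivot_adjl //.
  rewrite adj_irrefl andbF pivot_adj_edge // andbT /swap_on !inE eqxx /=.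
  by rewrite yv -/(R v) -addbA addbb addbF.
case: (eqVneq z v) => [->|zv].
  under eq_bigr => w /andP[wu wv] do rewrite pivot_adjr //.
  rewrite adj_irrefl andbF (adj_sym P) pivot_adj_edge // andbT.
  rewrite /swap_on !inE eqxx orbT /= yu.
  by rewrite -/(R u) -addbA addbb addbF.
rewrite (adj_sym P) pivot_adjl // (adj_sym P z v) pivot_adjr //.
under eq_bigr => w /andP[wu wv] do rewrite pivot_adjE // !andb_addr.
rewrite !big_split /= -/(R z) /swap_on !inE (negPf zu) (negPf zv) /= (yE z).
have -> : \big[addb/false]_(w | (w != u) && (w != v))
     (x w && (adj G z u && adj G w v)) = adj G z u && R v.
  rewrite /R big_distrr /=; apply: eq_bigr => w _.
  by rewrite andbCA [adj G w v]adj_sym.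
have -> : \big[addb/false]_(w | (w != u) && (w != v))
     (x w && (adj G z v && adj G w u)) = adj G z v && R u.
  rewrite /R big_distrr /=; apply: eq_bigr => w _.
  by rewrite andbCA [adj G w u]adj_sym.
rewrite yu yv [adj G v z]adj_sym [adj G u z]adj_sym.
by case: (adj G z u); case: (adj G z v); case: (x u); case: (x v);
   case: (R u); case: (R v); case: (R z).
Qed.

Lemma ppt_pivot_sym G u v : adj G u v -> ppt (pivot G u v) [set u; v] G.
Proof.
move=> uv; apply: eq_ppt (ppt_pivot (pivot_adj_edge uv)) => // x y.
exact: adj_pivotK.
Qed.

(** Otherwise the image of the unit vector at [b] vanishes on [B], so the exchange yields the zero
    vector, which [G'] would map to a vector with entry 1 at [b]. *)
Lemma ppt_adj_in G B G' b : ppt G B G' -> b \in B ->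
  exists2 a, a \in B & adj G b a.
Proof.
move=> p bB; apply/exists_inP; apply: contraT; rewrite negb_exists_in.
move/forall_inP=> noB; have := p (pred1 b) b.
rewrite [RHS]/swap_on bB /= eqxx {1}/nbsum big1 // => w _.
rewrite /swap_on; case: ifPn => [wB|wB].
  by rewrite nbsum1 adj_sym (negPf (noB w wB)).
by rewrite /= (_ : w == b = false) //; apply: contraNF wB => /eqP->.
Qed.

Lemma ppt_pivot_step G B G' u v : adj G u v -> u \in B -> v \in B ->
  ppt G B G' -> ppt (pivot G u v) (B :\ u :\ v) G'.
Proof.
move=> uv uB vB p; have := ppt_trans (ppt_pivot_sym uv) p.
have -> // : ([set u; v] :\: B) :|: (B :\: [set u; v]) = B :\ u :\ v.
apply/setP=> x; rewrite !inE.
case: (eqVneq x u) => [->|_]; first by rewrite uB /= andbF.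
by case: (eqVneq x v) => [->|_]; rewrite ?vB /= ?andbF.
Qed.

(** A transform on [B] is a sequence of pivots on edges with both ends in what is left of [B]:
    [ppt_adj_in] supplies such an edge as long as the set is nonempty. *)
Lemma ppt_ind G' (P : graph T -> {set T} -> Prop) :
  (forall G, (forall x y, adj G x y = adj G' x y) -> P G set0) ->
  (forall G B u v, adj G u v -> u \in B -> v \in B -> ppt G B G' ->
     P (pivot G u v) (B :\ u :\ v) -> P G B) ->
  forall G B, ppt G B G' -> P G B.
Proof.
move=> P0 PS G B; have [n] := ubnP #|B|; elim: n G B => // n IHn G B ltn p.
have [B0|[b bB]] := set_0Vmem B.
  move: p; rewrite B0 => p; apply: P0 => x y; have := p (pred1 y) x.
  rewrite [RHS]/swap_on inE nbsum1 => <-; rewrite -[RHS]nbsum1.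
  by apply: eq_nbsum => // w; rewrite /swap_on inE.
have [a aB ba] := ppt_adj_in p bB; apply: (PS _ _ _ _ ba bB aB p).
apply: IHn (ppt_pivot_step ba bB aB p).
rewrite -ltnS; apply: leq_trans ltn; rewrite ltnS.
rewrite (cardsD1 b B) bB ltnS.
exact/subset_leq_card/subD1set.
Qed.

(** The definition only says that the exchange maps the pairs of [G] into those of [G'], not that it
    is onto; so the pivots are undone one at a time. *)
Lemma ppt_sym G B G' : ppt G B G' -> ppt G' B G.
Proof.
elim/ppt_ind: B / => [{}G e|{}G B u v uv uB vB p IH].
  move=> x w; rewrite /swap_on inE; apply: eq_nbsum => // z.
  by rewrite inE.
have := ppt_trans IH (ppt_pivot_sym uv).
have -> // : ((B :\ u :\ v) :\: [set u; v]) :|: ([set u; v] :\: (B :\ u :\ v)) = B.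
apply/setP=> x; rewrite !inE.
case: (eqVneq x u) => [->|_] /=; first by rewrite uB; case: (u == v).
by case: (eqVneq x v) => [->|_] /=; rewrite ?vB /= ?andbF ?orbF ?andbT.
Qed.

(** For twins, the sum of their unit vectors lies in the kernel of [G'], and the exchange back to
    [G] would give the zero vector an image that is nonzero at [u]. *)
Lemma ppt_no_twins G B G' u v : ppt G B G' -> u \in B -> v \in B -> u != v ->
  exists w, adj G' u w != adj G' v w.
Proof.
move=> /ppt_sym p uB vB uv; apply/existsP; apply: contraT.
rewrite negb_exists => /forallP tw.
pose x w := (w == u) || (w == v).
have y0 w : nbsum G' x w = false.
  rewrite /nbsum (bigD1 u) //= (bigD1 v) /= 1?eq_sym // big1.
    rewrite /x !eqxx orbT /= addbF ![adj G' w _]adj_sym.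
    by have := tw w; rewrite negbK => /eqP->; rewrite addbb.
  by move=> z /andP[/negPf zu /negPf zv]; rewrite /x zu zv.
have := p x u; rewrite [RHS]/swap_on uB /x eqxx {1}/nbsum big1 // => z _.
rewrite /swap_on -/(nbsum _ _ _); case: ifPn => [_|zB].
  by rewrite y0.
rewrite (_ : z == u = false) 1?(_ : z == v = false) //.
  by apply: contraNF zB => /eqP->.
by apply: contraNF zB => /eqP->.
Qed.

Lemma adj_delete G v x y :
  adj (delete G v) x y = [&& x != v, y != v & adj G x y].
Proof. by rewrite /= /induced_adj !inE. Qed.

Lemma adj_pivot_delete G u v z x y : adj G u v -> u != z -> v != z ->
  adj (pivot (delete G z) u v) x y = adj (delete (pivot G u v) z) x y.
Proof.
move=> uv uz vz; have uv' : adj (delete G z) u v by rewrite adj_delete uz vz.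
have eP := @adj_delete (pivot G u v) z.
case: (eqVneq x z) => [->|xz].
  rewrite eP eqxx; apply: contraTF isT => /adj_vset /=.
  by rewrite !inE eqxx andbF.
case: (eqVneq y z) => [->|yz].
  rewrite eP eqxx andbF adj_sym; apply: contraTF isT => /adj_vset /=.
  by rewrite !inE eqxx andbF.
rewrite eP xz yz; have uDv := adj_neq uv.
have E a b : a != z -> b != z -> adj (delete G z) a b = adj G a b.
  by move=> az bz; rewrite adj_delete az bz.
have vu (K : graph T) : adj K u v -> adj (pivot K u v) v u.
  by move=> ?; rewrite adj_sym pivot_adj_edge.
case: (eqVneq x u) => [->|xu].
  case: (eqVneq y u) => [->|yu]; first by rewrite !adj_irrefl.
  case: (eqVneq y v) => [->|yv]; first by rewrite !pivot_adj_edge.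
  by rewrite !pivot_adjl ?E.
case: (eqVneq x v) => [->|xv].
  case: (eqVneq y u) => [->|yu]; first by rewrite !vu.
  case: (eqVneq y v) => [->|yv]; first by rewrite !adj_irrefl.
  by rewrite !pivot_adjr ?E.
case: (eqVneq y u) => [->|yu].
  by rewrite ![adj _ x u]adj_sym !pivot_adjl ?E.
case: (eqVneq y v) => [->|yv].
  by rewrite ![adj _ x v]adj_sym !pivot_adjr ?E.
by rewrite !pivot_adjE ?E.
Qed.

Lemma adj_pivot_induced G S u v x y : adj G u v -> u \in S -> v \in S ->
  adj (pivot (induced G S) u v) x y = adj (induced (pivot G u v) S) x y.
Proof.
move=> uv uS vS; have uv' : adj (induced G S) u v by rewrite /= /induced_adj uS vS.
have eP a b : adj (induced (pivot G u v) S) a b =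
  [&& a \in S, b \in S & adj (pivot G u v) a b] by [].
have [xS|xS] := boolP (x \in S); last first.
  rewrite eP (negPf xS); apply: contraTF isT => /adj_vset /=.
  by rewrite !inE (negPf xS) andbF.
have [yS|yS] := boolP (y \in S); last first.
  rewrite eP (negPf yS) andbF adj_sym; apply: contraTF isT => /adj_vset /=.
  by rewrite !inE (negPf yS) andbF.
rewrite eP xS yS; have uDv := adj_neq uv.
have E a b : a \in S -> b \in S -> adj (induced G S) a b = adj G a b.
  by move=> aS bS; rewrite /= /induced_adj aS bS.
have vu (K : graph T) : adj K u v -> adj (pivot K u v) v u.
  by move=> ?; rewrite adj_sym pivot_adj_edge.
case: (eqVneq x u) => [->|xu].
  case: (eqVneq y u) => [->|yu]; first by rewrite !adj_irrefl.
  case: (eqVneq y v) => [->|yv]; first by rewrite !pivot_adj_edge.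
  by rewrite !pivot_adjl ?E.
case: (eqVneq x v) => [->|xv].
  case: (eqVneq y u) => [->|yu]; first by rewrite !vu.
  case: (eqVneq y v) => [->|yv]; first by rewrite !adj_irrefl.
  by rewrite !pivot_adjr ?E.
case: (eqVneq y u) => [->|yu].
  by rewrite ![adj _ x u]adj_sym !pivot_adjl ?E.
case: (eqVneq y v) => [->|yv].
  by rewrite ![adj _ x v]adj_sym !pivot_adjr ?E.
by rewrite !pivot_adjE ?E.
Qed.

(** Deletions are postponed: a pivot commutes with the restriction to the remaining vertices, so all
    pivots act on the full graph, and the final vertex set is cut out at the end. *)
Lemma apply_ops_ppt G s G' : apply_ops G s = Some G' ->
  exists B, exists2 K, ppt G B K & [/\ vset K = vset G,
    vset G' \subset vset G & forall x y, adj G' x y = adj (induced K (vset G')) x y].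
Proof.
pose I Gc := exists B, exists2 K, ppt G B K & [/\ vset K = vset G,
    vset Gc \subset vset G & forall x y, adj Gc x y = adj (induced K (vset Gc)) x y].
have: I G.
  exists set0, G; last first.
    split=> // x y; rewrite /= /induced_adj; case xy: (adj G x y); rewrite ?andbF //.
    by rewrite (adj_vset xy) (adj_vsetr xy).
  by move=> x v; rewrite /swap_on inE; apply: eq_nbsum => // w; rewrite inE.
suff gen r Gc : I Gc -> apply_ops Gc r = Some G' -> I G' by apply: gen.
elim: r Gc => [|o r IHr] Gc IGc /=; first by case=> <-.
case oGc: (apply_op Gc o) => [G1|] //; apply: IHr.
case: IGc => B [K p [vK sub aGc]].
case: o oGc => [v|u v] /=; case: ifP => // ok [<-].
  exists B, K => //; split=> // [|x y].
    by apply: subset_trans sub => /=; apply: subsetIl.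
  rewrite adj_delete aGc /= /induced_adj !inE.
  by case: (x != v); case: (y != v); rewrite ?andbF ?andbT.
have := ok; rewrite aGc => /and3P[uGc vGc uvK].
exists ((B :\: [set u; v]) :|: ([set u; v] :\: B)), (pivot K u v).
  exact: ppt_trans p (ppt_pivot uvK).
split=> // x y; rewrite -adj_pivot_induced //.
have eK : embeds id Gc (induced K (vset Gc)).
  by apply: embeds_idP => //=; rewrite vK (setIidPr sub).
have [_ _ e] := embeds_pivot uGc vGc eK.
have [xG|xG] := boolP (x \in vset Gc); last first.
  by rewrite !adj_notin //= ?inE (negPf xG) ?andbF.
have [yG|yG] := boolP (y \in vset Gc); last first.
  by rewrite !adj_notin //= ?inE (negPf yG) ?andbF orbT.
by rewrite -e.
Qed.

Lemma contains_ppt (W : finType) (H : graph W) G : contains_pivot_minor G H ->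
  exists B K S, [/\ ppt G B K, vset K = vset G, S \subset vset G
    & iso (induced K S) H].
Proof.
case=> s [G' /apply_ops_ppt [B [K p [vK sub aG']]] isoH].
exists B, K, (vset G'); split=> //; apply: iso_trans isoH.
by apply/embeds_iso/embeds_idP => [|x y]; rewrite ?aG' //= vK (setIidPr sub).
Qed.

(** By [ppt_ind] all pivots can be taken on edges inside [B]; none involves [v], so each commutes
    with the deletion of [v]. *)
Lemma ppt_delete (W : finType) (H : graph W) G B K v :
  ppt G B K -> vset K = vset G -> v \notin B ->
  contains_pivot_minor (delete K v) H -> contains_pivot_minor (delete G v) H.
Proof.
move=> p vK vB cK; move: vK vB; elim/ppt_ind: B / p => [{}G e vK _|{}G B a b ab aB bB p IH].
  apply: contains_eq cK; first by rewrite /= vK.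
  by move=> x y; rewrite !adj_delete e.
move=> vK vB.
have av : a != v by apply: contraNneq vB => <-.
have bv : b != v by apply: contraNneq vB => <-.
have cP : contains_pivot_minor (delete (pivot G a b) v) H.
  by apply: IH => //; rewrite !inE (negPf vB) !andbF.
apply: (@contains_pivot _ _ _ _ a b); first by rewrite adj_delete av bv.
by apply: contains_eq cP => // x y; rewrite adj_pivot_delete.
Qed.

Lemma contains_delete_induced (W : finType) (H : graph W) K S v :
  v \notin S -> contains_pivot_minor (induced K S) H ->
  contains_pivot_minor (delete K v) H.
Proof.
move=> vS cS; apply: (@contains_induced _ _ _ _ S).
apply: contains_eq cS => [|x y] /=.
  apply/setP=> x; rewrite !inE; case: (eqVneq x v) => [->|]; rewrite ?andbT //.
  by rewrite (negPf vS) !andbF.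
rewrite /induced_adj /= /induced_adj !inE.
case: (eqVneq x v) => [->|_]; first by rewrite (negPf vS).
by case: (eqVneq y v) => [->|_]; first by rewrite (negPf vS) andbF.
Qed.

(** Take [v] outside the copy of [H]. If [v] is in [B], one pivot with a neighbour in [B] takes it
    out of the set, and then the remaining pivots commute with its deletion. *)
Theorem contains_self_reduction (W : finType) (H : graph W) G :
  contains_pivot_minor G H -> #|vset H| < #|vset G| ->
  exists2 v, v \in vset G & contains_pivot_minor (delete G v) H \/
    exists2 w, adj G v w & contains_pivot_minor (delete (pivot G v w) v) H.
Proof.
move=> /contains_ppt [B [K [S [p vK SG isoS]]]] ltHG.
have [v vG vS] : exists2 v, v \in vset G & v \notin S.
  apply/subsetPn; apply: contraL ltHG => sub; rewrite -leqNgt -(iso_card isoS) /=.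
  by rewrite vK (setIidPr SG) subset_leq_card.
have cK : contains_pivot_minor (delete K v) H.
  by apply: contains_delete_induced vS _; apply: contains_of_iso.
exists v => //; have [vB|vB] := boolP (v \in B); last first.
  by left; apply: ppt_delete p vK vB cK.
have [w wB vw] := ppt_adj_in p vB; right; exists w => //.
apply: ppt_delete (ppt_pivot_step vw vB wB p) _ _ cK => //.
by rewrite !inE eqxx andbF.
Qed.

End PrincipalPivot.

(** * Pivot-minors of half graphs have bounded obstructions *)

(** Distinct comparable sets increase strictly when sorted by cardinality. *)
Lemma chain_select (T : finType) (F : {set {set T}}) n :
  {in F &, forall A B : {set T}, A \subset B \/ B \subset A} -> n < #|F| ->
  exists2 c : nat -> {set T}, (forall i, i <= n -> c i \in F)
    & forall i j, i < j -> j <= n -> c i \proper c j.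
Proof.
move=> chF ltnF; pose r (A B : {set T}) := #|A| <= #|B|.
pose s := sort r (enum F).
have szs : size s = #|F| by rewrite size_sort -cardE.
have sF A : (A \in s) = (A \in F) by rewrite mem_sort mem_enum.
have ltis i : i <= n -> i < size s by move=> lein; rewrite szs; lia.
have us : uniq s by rewrite sort_uniq enum_uniq.
exists (nth set0 s) => [i lein|i j ltij lejn]; first by rewrite -sF mem_nth ?ltis.
have lti : i < size s by apply: ltis; lia.
have ltj := ltis _ lejn.
have lercard : r (nth set0 s i) (nth set0 s j).
  apply: (sorted_ltn_nth (leT := r)) => //.
    by move=> A B C; apply: leq_trans.
  by apply: sort_sorted => A B; apply: leq_total.
have ne : nth set0 s i != nth set0 s j by rewrite nth_uniq // neq_ltn ltij.
have := chF _ _ (etrans (esym (sF _)) (mem_nth set0 lti))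
                (etrans (esym (sF _)) (mem_nth set0 ltj)).
case=> sub; first by rewrite properEneq ne.
by case/eqP: ne; apply/esym/eqP; rewrite eqEcard sub.
Qed.

(** The tuples [F u] lie in a product in which only the coordinates in [J] vary, each over at most
    [q] values. *)
Lemma card_joint_injective (T I X : finType) (U : {set T}) (J : {set I})
    (f : I -> T -> X) q :
  {in U &, forall u v, (forall i, f i u = f i v) -> u = v} ->
  (forall i, i \notin J -> {in U &, forall u v, f i u = f i v}) ->
  (forall i, i \in J -> #|f i @: U| <= q) -> #|U| <= q ^ #|J|.
Proof.
move=> f_inj f_const leq.
pose F u : {ffun I -> X} := [ffun i => f i u].
have F_inj : {in U &, injective F}.
  by move=> u v uU vU /ffunP e; apply: f_inj => // i; have := e i; rewrite !ffunE.
rewrite -(card_in_imset F_inj).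
apply: (@leq_trans #|family (fun i => mem (f i @: U))|).
  apply/subset_leq_card/subsetP => h /imsetP[u uU ->].
  by apply/familyP=> i; rewrite ffunE; apply: imset_f.
rewrite card_family foldrE big_map big_enum /= -prod_nat_const.
rewrite [leqRHS]big_mkcond /=; apply: leq_prod => i _.
case: ifPn => [/leq //|iJ]; rewrite leqNgt; apply/negP => /card_gt1P.
case=> x [y [/imsetP[u uU ->] /imsetP[v vU ->] /eqP[]]].
exact: f_const.
Qed.

Definition half_rel m (x y : 'I_m + 'I_m) :=
  if (x, y) is (inl i, inr j) then j <= i else false.

Definition half_graph m : graph ('I_m + 'I_m)%type := graph_of_rel (@half_rel m).

Section BoundedObstructions.
Variables (W : finType) (H : graph W) (m : nat).
Hypothesis half_H : contains_pivot_minor (half_graph m) H.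

Lemma contains_half (T : finType) (K : graph T) (u w : nat -> T) :
  (forall i, i < m -> u i \in vset K) -> (forall i, i < m -> w i \in vset K) ->
  (forall i j, i < m -> j < m -> ~~ adj K (u i) (u j)) ->
  (forall i j, i < m -> j < m -> ~~ adj K (w i) (w j)) ->
  (forall i j, i < m -> j < m -> adj K (u i) (w j) = (j <= i)) ->
  contains_pivot_minor K H.
Proof.
move=> uK wK uu ww uw.
pose f (x : 'I_m + 'I_m) := match x with inl i => u i | inr j => w j end.
apply: (contains_sub (f := f)) half_H.
(* Equal vertices have equal neighbours, so the diagonal entries of the pattern force both
   inequalities between the indices. *)
- have inj_le (i j : 'I_m) : u i = u j -> i <= j.
    by move=> eu; rewrite -(uw j i) // -eu uw.
  have inj_le' (i j : 'I_m) : w i = w j -> i <= j.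
    by move=> eu; rewrite -(uw j i) // eu uw.
  have uDw (i j : 'I_m) : u i != w j.
    have m0 : 0 < m by apply: leq_ltn_trans (ltn_ord i).
    apply/eqP=> e; have := uw i 0 (ltn_ord i) m0.
    by rewrite e (negPf (ww j 0 _ m0)).
  move=> [i|i] [j|j] _ _ /= e.
  + by congr inl; apply/val_inj/eqP; rewrite eqn_leq !inj_le.
  + by move: (uDw i j); rewrite e eqxx.
  + by move: (uDw j i); rewrite e eqxx.
  + by congr inr; apply/val_inj/eqP; rewrite eqn_leq !inj_le'.
- by move=> [i|j] _ /=; [apply: uK | apply: wK].
- move=> [i|i] [j|j] _ _ /=; rewrite /rel_adj /= ?orbF ?andbT ?andbF.
  + exact/negbTE/uu.
  + exact: uw.
  + by rewrite adj_sym uw.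
  + exact/negbTE/ww.
Qed.

Let k := #|vset H|.
(** The summand [k] is for the copy of [H]. The other vertices fall into at most [2 ^ k] classes by
    their neighbourhood in the copy. A vertex of a given class is determined by its traces on the
    classes, and if each class sees at most [m.+1] traces, then at most [m.+1 ^ (2 ^ k)] vertices
    are possible. *)
Definition obstruction_bound := k + 2 ^ k * m.+1 ^ (2 ^ k).

Lemma large_not_minimal (T : finType) (G : graph T) :
  contains_pivot_minor G H -> obstruction_bound < #|vset G| ->
  exists2 v, v \in vset G & contains_pivot_minor (delete G v) H.
Proof.
move=> cG ltG; have [B [K [S [p vK SG isoS]]]] := contains_ppt cG.
have cardS : #|S| = k by rewrite /k -(iso_card isoS) /= vK (setIidPr SG).
apply: NNPP => minG.
have noGo B' K' v : ppt G B' K' -> vset K' = vset G -> v \in vset G ->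
    v \notin B' -> contains_pivot_minor (delete K' v) H -> False.
  by move=> p' vK' vG vB' cK'; apply: minG; exists v => //; apply: ppt_delete p' vK' vB' cK'.
have noS B' K' v : ppt G B' K' -> vset K' = vset G -> v \in vset G ->
    v \notin S -> v \notin B' -> {in S &, forall x y, adj K' x y = adj K x y} -> False.
  move=> p' vK' vG vS vB' eS; apply: (noGo _ _ _ p' vK' vG vB').
  apply: contains_delete_induced vS _; apply: contains_of_iso; apply: iso_trans isoS.
  apply/embeds_iso/embeds_idP => /= [|x y]; first by rewrite vK vK'.
  rewrite /induced_adj; have [xS|//] := boolP (x \in S).
  by have [yS|//] := boolP (y \in S); rewrite eS.
pose Z := vset G :\: S.
have ZG z : z \in Z -> z \in vset G by case/setDP.
have ZS z : z \in Z -> z \notin S by case/setDP.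
have ZB z : z \in Z -> z \in B.
  move=> zZ; apply: contraT => zB.
  by case: (noS _ _ _ p vK (ZG _ zZ) (ZS _ zZ) zB).
pose tp z := [set s in S | adj K z s].
have tpE z z' s : tp z = tp z' -> s \in S -> adj K z s = adj K z' s.
  by move=> /setP/(_ s) + sS; rewrite !inE sS.
have SZ s z : s \in S -> z \in Z -> s != z.
  by move=> sS zZ; apply: contraTneq sS => ->; apply: ZS.
have pivotS u v : u \in Z -> v \in Z -> adj K u v ->
    {in S &, forall x y, adj (pivot K u v) x y =
       adj K x y (+) (adj K u x && adj K v y) (+) (adj K v x && adj K u y)}.
  move=> uZ vZ uv x y xS yS; rewrite pivot_adjE // ?SZ //.
  by rewrite ![adj K u _]adj_sym ![adj K v _]adj_sym.
(* Pivoting an edge between vertices with the same neighbours in [S] leaves the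
   graph on [S] unchanged. *)
have same_tp u v : u \in Z -> v \in Z -> tp u = tp v -> ~~ adj K u v.
  move=> uZ vZ tuv; apply/negP => uv.
  apply: (noS _ _ u (ppt_trans p (ppt_pivot uv)) _ (ZG _ uZ) (ZS _ uZ)) => //.
    by rewrite !inE eqxx ZB.
  move=> x y xS yS; rewrite pivotS // !(tpE _ _ _ tuv) //.
  by rewrite -addbA addbb addbF.
(* The changes that two such pivots make to the graph on [S] cancel. *)
have no2K2 u1 u2 w1 w2 : [/\ u1 \in Z, u2 \in Z, w1 \in Z & w2 \in Z] ->
    tp u1 = tp u2 -> tp w1 = tp w2 -> adj K u1 w1 -> adj K u2 w2 ->
    ~~ adj K u1 w2 -> ~~ adj K u2 w1 -> False.
  case=> u1Z u2Z w1Z w2Z tu tw uw1 uw2 nuw1 nuw2.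
  have nuu := same_tp _ _ u1Z u2Z tu; have nww := same_tp _ _ w1Z w2Z tw.
  have u12 : u2 != u1 by apply: contraNneq nuw2 => ->.
  have w12 : w2 != w1 by apply: contraNneq nuw1 => ->.
  have w2u1 : w2 != u1 by apply: contraTneq uw2 => ->; rewrite adj_sym.
  have u2w1 : u2 != w1 by apply: contraTneq uw2 => ->.
  (* All pairs of the four vertices except the two edges are nonadjacent; hence the first pivot
     changes neither the edge [u2 w2] nor the adjacencies of its ends to [S]. *)
  have K1uw : adj (pivot K u1 w1) u2 w2.
    by rewrite pivot_adjE // uw2 (negPf nuw2) adj_sym (negPf nuu).
  have K1u x : x \in S -> adj (pivot K u1 w1) x u2 = adj K x u2.
    move=> xS; rewrite pivot_adjE // ?SZ // (negPf nuw2) [adj K u2 u1]adj_sym.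
    by rewrite (negPf nuu) !andbF !addbF.
  have K1w x : x \in S -> adj (pivot K u1 w1) x w2 = adj K x w2.
    move=> xS; rewrite pivot_adjE // ?SZ // ![adj K w2 _]adj_sym (negPf nww).
    by rewrite (negPf nuw1) !andbF !addbF.
  have p2 := ppt_trans (ppt_trans p (ppt_pivot uw1)) (ppt_pivot K1uw).
  apply: (noS _ _ u1 p2 _ (ZG _ u1Z) (ZS _ u1Z)) => //.
    rewrite !inE eqxx ZB // ![u1 == _]eq_sym (negPf u12) (negPf w2u1).
    done.
  move=> x y xS yS; rewrite pivot_adjE // ?SZ // pivotS // !K1u // !K1w //.
  rewrite ![adj K _ u2]adj_sym ![adj K _ w2]adj_sym.
  rewrite -!(tpE _ _ _ tu) // -!(tpE _ _ _ tw) //.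
  by case: (adj K x y); case: (adj K u1 x); case: (adj K u1 y);
     case: (adj K w1 x); case: (adj K w1 y).
have twins u v : u \in Z -> v \in Z -> u != v ->
    exists x, adj K u x != adj K v x.
  by move=> uZ vZ; apply: ppt_no_twins p _ _; apply: ZB.
pose cls t := [set z in Z | tp z == t].
pose tr (t : {set T}) u := [set z in cls t | adj K u z].
have trE t u z : (z \in tr t u) = [&& z \in Z, tp z == t & adj K u z].
  by rewrite in_set in_set -andbA.
have clsZ t z : z \in cls t -> z \in Z by rewrite in_set => /andP[].
have clsE t z : z \in cls t -> tp z = t by rewrite in_set => /andP[_ /eqP].
(* Pigeonhole over the classes of the vertices outside [S]. *)
have [tu ltU] : exists tu, m.+1 ^ (2 ^ k) < #|cls tu|.
  apply: NNPP => small; move: ltG; rewrite ltnNge => /negP[].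
  rewrite -(cardsID S (vset G)) (setIidPr SG) cardS leq_add2l.
  rewrite -cardS -card_powerset -/Z -sum1_card.
  rewrite (partition_big tp (mem (powerset S))) /=; last first.
    by move=> z _; rewrite powersetE; apply/subsetP=> s; rewrite inE => /andP[].
  rewrite -sum_nat_const; apply: leq_sum => t _.
  rewrite sum1dep_card leqNgt card_powerset cardS; apply/negP => ltc; apply: small; exists t.
  by apply: leq_trans ltc _; rewrite subset_leq_card.
(* Two vertices of one class agree on [S]. As they are not twins, some vertex of [Z] tells them
   apart, and so do their traces on its class. *)
have [tw ltF] : exists tw, m.+1 < #|tr tw @: cls tu|.
  apply: NNPP => small; move: ltU; rewrite ltnNge -cardS -card_powerset => /negP[].
  apply: (@card_joint_injective _ _ _ _ (powerset S) tr).
  - move=> u v uU vU e; apply/eqP; apply: contraT => uv.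
    have [x] := twins _ _ (clsZ _ _ uU) (clsZ _ _ vU) uv.
    have tuv : tp u = tp v by rewrite (clsE _ _ uU) (clsE _ _ vU).
    have [xS|xS] := boolP (x \in S); first by rewrite (tpE _ _ _ tuv) ?eqxx.
    have [xG|xG] := boolP (x \in vset G); last first.
      by rewrite !adj_notin ?vK ?xG ?orbT.
    have xZ : x \in Z by rewrite inE xS.
    by move/setP: (e (tp x)) => /(_ x); rewrite !trE xZ eqxx /= => ->; rewrite eqxx.
  - move=> t tS u v _ _; apply/setP=> z; rewrite !trE.
    case: (z \in Z) => //=; case: eqP => //= tz; case/negP: tS; rewrite -tz powersetE.
    by apply/subsetP=> s; rewrite inE => /andP[].
  - by move=> t _; rewrite leqNgt; apply/negP => ltt; apply: small; exists t.
(* Incomparable traces would give an induced 2P_2 between the two classes. *)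
have ch : {in tr tw @: cls tu &, forall A B : {set T}, A \subset B \/ B \subset A}.
  move=> _ _ /imsetP[u1 u1U ->] /imsetP[u2 u2U ->].
  apply: NNPP => /not_or_and[/negP/subsetPn[w1 + w1u] /negP/subsetPn[w2 + w2u]].
  rewrite !trE => /and3P[w1Z /eqP tw1 uw1] /and3P[w2Z /eqP tw2 uw2].
  move: w1u w2u; rewrite !trE w1Z w2Z tw1 tw2 eqxx /= => w1u w2u.
  have tu12 : tp u1 = tp u2 by rewrite (clsE _ _ u1U) (clsE _ _ u2U).
  have tw12 : tp w1 = tp w2 by rewrite tw1 tw2.
  apply: no2K2 tu12 tw12 uw1 uw2 _ _ => //.
  by split=> //; apply: clsZ; eassumption.
have [c cF cP] := chain_select ch ltF.
(* The guard makes the chosen functions total on the natural numbers; their values beyond the range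
   are arbitrary. *)
have u_ex i : exists u, (i <= m.+1) ==> (u \in cls tu) && (c i == tr tw u).
  have [lei|_] := boolP (i <= m.+1).
    by have /imsetP[u uU ->] := cF _ lei; exists u; rewrite uU eqxx.
  by have /imsetP[u _ _] := cF 0 isT; exists u.
pose u i := xchoose (u_ex i).
have uP i : i <= m.+1 -> u i \in cls tu /\ c i = tr tw (u i).
  by move=> lei; have /implyP/(_ lei)/andP[? /eqP] := xchooseP (u_ex i).
(* An element of the difference of two consecutive traces: [w j] enters the chain with the trace of
   [u j.+1], so it is adjacent to [u i] exactly when [j < i]. *)
have w_ex i : exists w, (i <= m) ==> (w \in c i.+1) && (w \notin c i).
  have [lei|_] := boolP (i <= m).
    by have /properP[_ [w w1 w2]] := cP i i.+1 (ltnSn i) lei; exists w; rewrite w1.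
  by have /imsetP[u0 _ _] := cF 0 isT; exists u0.
pose w i := xchoose (w_ex i).
have wP i : i <= m -> w i \in c i.+1 /\ w i \notin c i.
  by move=> lei; have /implyP/(_ lei)/andP := xchooseP (w_ex i).
have uZ i : i <= m.+1 -> u i \in Z by move=> /uP[/clsZ].
have wcls i : i <= m -> w i \in cls tw.
  by move=> lei; have [wi _] := wP _ lei; have [_ e] := uP i.+1 lei; move: wi; rewrite e in_set => /andP[].
have wZ i : i <= m -> w i \in Z by move/wcls/clsZ.
have uu i j : i <= m.+1 -> j <= m.+1 -> ~~ adj K (u i) (u j).
  by move=> /uP[ui _] /uP[uj _]; apply: same_tp; rewrite ?(clsZ tu) // (clsE _ _ ui) (clsE _ _ uj).
have ww i j : i <= m -> j <= m -> ~~ adj K (w i) (w j).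
  by move=> /wcls wi /wcls wj; apply: same_tp; rewrite ?(clsZ tw) // (clsE _ _ wi) (clsE _ _ wj).
have uw i j : i <= m.+1 -> j <= m -> adj K (u i) (w j) = (j < i).
  move=> lei lej; have [_ ci] := uP _ lei; have [wj1 wj0] := wP _ lej.
  transitivity (w j \in c i); first by rewrite ci in_set wcls.
  case: (ltngtP j i) => [ltji|ltij|<-]; last exact: negbTE.
    have [<-//|ne] := eqVneq j.+1 i.
    by apply: (subsetP (proper_sub (cP j.+1 i _ lei))) => //; lia.
  by apply: contraNF wj0; apply/subsetP/proper_sub/cP => //; lia.
(* [w 0] is the only neighbour of [u 1] in the half graph, so that pivoting this
   edge does not affect the rest of the half graph, but it removes [u 1] from [B]. *)
have e10 : adj K (u 1) (w 0) by rewrite uw.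
apply: (noGo _ _ (u 1) (ppt_trans p (ppt_pivot e10)) vK (ZG _ (uZ 1 isT))).
  by rewrite !inE eqxx ZB // uZ.
(* Each toggled pair contains a neighbour of [u 1], so the pivot changes nothing between good
   vertices. *)
pose good x := [&& x \in vset G, x != u 1, x != w 0 & ~~ adj K x (u 1)].
have goodu i : i < m -> good (u i.+2).
  move=> ltim; have lei : i.+2 <= m.+1 by lia.
  rewrite /good ZG ?uZ // uu //= andbT.
  apply/andP; split; apply/eqP => e.
    by have := uw i.+2 1 lei ltac:(lia); rewrite e uw //; lia.
  by have := uw i.+2 0 lei isT; rewrite e (negPf (ww _ _ _ _)).
have goodw i : i < m -> good (w i.+1).
  move=> ltim; rewrite /good ZG ?wZ // [adj K _ (u 1)]adj_sym uw //=.
  rewrite andbT; apply/andP; split; apply/eqP => e.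
    by have := uw 1 0 isT isT; rewrite -e (negPf (ww _ _ _ _)).
  by have := uw 1 i.+1 isT ltim; rewrite e uw.
have goodE x y : good x -> good y -> adj (delete (pivot K (u 1) (w 0)) (u 1)) x y = adj K x y.
  move=> /and4P[_ xu xw xa] /and4P[_ yu yw ya].
  by rewrite adj_delete xu yu pivot_adjE // (negPf xa) (negPf ya) andbF !addbF.
have goodG x : good x -> x \in vset (delete (pivot K (u 1) (w 0)) (u 1)).
  by case/and4P=> xG xu _ _; rewrite !inE vK xG xu.
(* The shifts by 2 and 1 turn the strict pattern [j.+1 < i.+2] into [j <= i]. They also skip [u 0],
   [u 1] and [w 0]; this is why [m.+2] traces are collected. *)
apply: (contains_half (u := fun i => u i.+2) (w := fun i => w i.+1)).
- by move=> i lti; apply/goodG/goodu.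
- by move=> i lti; apply/goodG/goodw.
- by move=> i j lti ltj; rewrite goodE ?goodu ?uu.
- by move=> i j lti ltj; rewrite goodE ?goodw ?ww.
- by move=> i j lti ltj; rewrite goodE ?goodu ?goodw ?uw.
Qed.

Theorem bounded_obstruction (T : finType) (G : graph T) :
  contains_pivot_minor G H ->
  exists2 S : {set T}, S \subset vset G /\ #|S| <= obstruction_bound
    & contains_pivot_minor (induced G S) H.
Proof.
have [n] := ubnP #|vset G|; elim: n G => // n IHn G ltn cG.
have [leG|ltG] := leqP #|vset G| obstruction_bound.
  exists (vset G) => //; apply: contains_eq cG => [|x y] /=; first by rewrite setIid.
  rewrite /induced_adj; case xy: (adj G x y); rewrite ?andbF //.
  by rewrite (adj_vset xy) (adj_vsetr xy).
have [v vG cv] := large_not_minimal cG ltG.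
have [|S [SG leS] cS] := IHn _ _ cv.
  rewrite -ltnS; apply: leq_trans ltn; rewrite ltnS; apply: proper_card.
  by apply/properP; split; [apply: subsetIl | exists v; rewrite // !inE eqxx andbF].
have sub : S \subset vset G by apply: subset_trans SG _; apply: subsetIl.
have vS : v \notin S by apply: contraTN SG => vS; apply/subsetPn; exists v; rewrite // !inE eqxx andbF.
exists S => //; apply: contains_eq cS => [|x y] /=.
  by apply/setP=> x; rewrite !inE; case: eqP => [->|]; rewrite ?(negPf vS) ?andbF ?andbT.
rewrite /induced_adj /= /induced_adj !inE.
case: (eqVneq x v) => [->|_]; first by rewrite (negPf vS).
by case: (eqVneq y v) => [->|_]; first by rewrite (negPf vS) andbF.
Qed.

End BoundedObstructions.

(** * Odd closed walks *)

Section Walks.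
Variable T : finType.
Implicit Types G : graph T.

Fixpoint walk G n x y :=
  if n is n'.+1 then [exists z, adj G x z && walk G n' z y] else x == y.

Lemma walk0 G x : walk G 0 x x.
Proof. exact: eqxx. Qed.

Lemma walkS G n x z y : adj G x z -> walk G n z y -> walk G n.+1 x y.
Proof. by move=> xz zy; apply/existsP; exists z; rewrite xz. Qed.

Lemma walkSP G n x y : walk G n.+1 x y -> exists2 z, adj G x z & walk G n z y.
Proof. by case/existsP=> z /andP[]; exists z. Qed.

Lemma walk_cat G m n x y z : walk G m x y -> walk G n y z -> walk G (m + n) x z.
Proof.
elim: m x => [|m IHm] x; first by move/eqP->.
by case/walkSP=> w xw wy yz; rewrite addSn; apply: walkS xw (IHm _ wy yz).
Qed.

Lemma walk1 G x y : adj G x y -> walk G 1 x y.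
Proof. by move=> xy; apply: walkS xy (walk0 G y). Qed.

Lemma walk_rev G n x y : walk G n x y -> walk G n y x.
Proof.
elim: n x => [|n IHn] x; first by rewrite /= eq_sym.
case/walkSP=> z xz /IHn yz; rewrite -addn1; apply: walk_cat yz (walk1 _).
by rewrite adj_sym.
Qed.

Lemma eq_walk G G' n x y : (forall a b, adj G a b = adj G' a b) ->
  walk G n x y = walk G' n x y.
Proof.
move=> e; elim: n x => //= n IHn x; apply: eq_existsb => z.
by rewrite e IHn.
Qed.

Lemma walk_mono G G' n x y : (forall a b, adj G a b -> adj G' a b) ->
  walk G n x y -> walk G' n x y.
Proof.
move=> e; elim: n x => // n IHn x /walkSP[z xz zy].
exact: walkS (e _ _ xz) (IHn _ zy).
Qed.

Definition odd_closed G y := exists2 n, odd n & walk G n y y.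

Lemma odd_closed_conn G k y z : walk G k y z -> odd_closed G y -> odd_closed G z.
Proof.
move=> yz [n on yy]; exists (k + (n + k)); first by rewrite !oddD addbC -addbA addbb addbF.
exact: walk_cat (walk_rev yz) (walk_cat yy yz).
Qed.

Lemma min_odd_closed G y n : odd n -> walk G n y y ->
  exists L x k, [/\ L <= n, odd L, walk G k y x, walk G L x x
    & forall k' z L', walk G k' y z -> odd L' -> walk G L' z z -> L <= L'].
Proof.
elim/ltn_ind: n y => n IHn y on wn.
have [[k' [z [L' [ltL yz oL' zz]]]]|min] :=
    classic (exists k z L', [/\ L' < n, walk G k y z, odd L' & walk G L' z z]).
  have [L [x [k [leL oL zx xx minL]]]] := IHn _ ltL z oL' zz.
  exists L, x, (k' + k); split=> //; first by rewrite (leq_trans leL) // ltnW.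
    exact: walk_cat yz zx.
  by move=> k2 z2 L2 yz2; apply: minL; apply: walk_cat (walk_rev yz) yz2.
exists n, y, 0; split=> // [|k' z L' yz oL' zz]; first exact: walk0.
by rewrite leqNgt; apply/negP => ltL; apply: min; exists k', z, L'.
Qed.

(** If the walk starts with [w0 w1 w2 w3], pivoting [w1 w2] makes [w0 w3] an edge. By minimality,
    [w1] and [w2] have no neighbours on the remaining walk from [w3] to [w0] except at its end and
    at its beginning, respectively. So this walk survives, and the new edge closes it. The last
    clauses make [w1 w3 w0] an induced path of the new graph, as needed for the paw. *)
Lemma shorten_odd_closed G x L : odd L -> 5 <= L -> walk G L x x ->
  (forall k z L', walk G k x z -> odd L' -> walk G L' z z -> L <= L') ->
  exists w0 w1 w2 w3, [/\ adj G w1 w2, walk (pivot G w1 w2) (L - 2) w3 w3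
    & [/\ adj (pivot G w1 w2) w3 w1, adj (pivot G w1 w2) w3 w0,
          ~~ adj (pivot G w1 w2) w1 w0 & w1 != w0]].
Proof.
move=> oL leL + minL; have [M eL] : exists M, L = M.+3 by exists (L - 3); lia.
have eM : ~~ odd M by move: oL; rewrite eL /= negbK.
subst L; move=> /walkSP[w1 w01 /walkSP[w2 w12 /walkSP[w3 w23 w30]]].
move: w01 w30; set w0 := x => w01 w30.
have x1 := walk1 w01; have x2 := walk_cat x1 (walk1 w12).
have x3 := walk_cat x2 (walk1 w23).
have sym a b : adj G a b -> adj G b a by rewrite adj_sym.
have n02 : ~~ adj G w0 w2.
  apply/negP => w02; have := minL 0 w0 3 (walk0 G w0) isT.
  move/(_ (walkS w01 (walkS w12 (walk1 (sym _ _ w02))))); clear -leL; lia.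
have n13 : ~~ adj G w1 w3.
  apply/negP => w13; have := minL _ w1 3 x1 isT.
  move/(_ (walkS w12 (walkS w23 (walk1 (sym _ _ w13))))); clear -leL; lia.
have n03 : ~~ adj G w0 w3.
  apply/negP => w03; have := minL 0 w0 M.+1 (walk0 G w0) eM (walkS w03 w30); lia.
have d01 := adj_neq w01; have d12 := adj_neq w12; have d23 := adj_neq w23.
have d02 : w0 != w2 by apply: contraNneq n03 => ->.
have d13 : w1 != w3 by apply: contraNneq n03 => <-.
exists w0, w1, w2, w3.
have p03 : adj (pivot G w1 w2) w0 w3.
  rewrite pivot_adjE // 1?eq_sym // (negPf n03) w01 (negPf n02) addbF.
  by rewrite adj_sym w23.
(* The vertex [p] cuts the remaining walk into two parts. According to the parity of [j], one of
   them closes to an odd walk, which is shorter than the minimum unless [p] is at the stated end. *)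
have onW j p : j <= M -> walk G j w3 p -> walk G (M - j) p w0 ->
   [/\ p != w1, p != w2, adj G p w1 -> j = M & adj G p w2 -> j = 0].
  move=> lej w3p pw0; have x_p := walk_cat x3 w3p.
  have oMj : odd (M - j) = odd j by rewrite oddB // (negPf eM).
  split.
  - apply/eqP => e; subst p; have [oj|oj] := boolP (odd j).
      have := minL _ w1 j.+2 x1; rewrite /= negbK oj => /(_ isT).
      by move/(_ (walkS w12 (walkS w23 w3p))); clear -lej; lia.
    have := minL _ w1 (M - j + 1) x1; rewrite oddD oMj (negPf oj) => /(_ isT).
    by move/(_ (walk_cat pw0 (walk1 w01))); clear -lej; lia.
  - apply/eqP => e; subst p; have [oj|oj] := boolP (odd j).
      have := minL _ w2 (M - j + 2) x2; rewrite oddD oMj oj => /(_ isT).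
      by move/(_ (walk_cat pw0 (walkS w01 (walk1 w12)))); clear -lej; lia.
    have := minL _ w2 j.+1 x2; rewrite /= oj => /(_ isT).
    by move/(_ (walkS w23 w3p)); clear -lej; lia.
  - move=> pw1; have [oj|oj] := boolP (odd j).
      have := minL _ p (M - j + 2) x_p; rewrite oddD oMj oj => /(_ isT).
      by move/(_ (walk_cat pw0 (walkS w01 (walk1 (sym _ _ pw1))))); clear -lej; lia.
    have := minL _ p (3 + j) x_p; rewrite oddD (negPf oj) => /(_ isT).
    by move/(_ (walkS pw1 (walkS w12 (walkS w23 w3p)))); clear -lej; lia.
  - move=> pw2; have [oj|oj] := boolP (odd j).
      have := minL _ p (2 + j) x_p; rewrite oddD oj => /(_ isT).
      by move/(_ (walkS pw2 (walkS w23 w3p))); clear -lej; lia.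
    have := minL _ p (M - j + 3) x_p; rewrite oddD oMj (negPf oj) => /(_ isT).
    move/(_ (walk_cat pw0 (walkS w01 (walkS w12 (walk1 (sym _ _ pw2)))))); clear -lej; lia.
have tr n j p : j + n = M -> walk G j w3 p -> walk G n p w0 -> walk (pivot G w1 w2) n p w0.
  elim: n j p => // n IHn j p ejn w3p /walkSP[q pq qw0].
  have w3q : walk G j.+1 w3 q by rewrite -addn1; apply: walk_cat w3p (walk1 pq).
  have [|||p1 p2 ap1 ap2] := onW j p; [clear -ejn; lia | by [] | |].
    by rewrite (_ : M - j = n.+1); [apply: walkS pq qw0 | clear -ejn; lia].
  have [|||q1 q2 aq1 aq2] := onW j.+1 q; [clear -ejn; lia | by [] | |].
    by rewrite (_ : M - j.+1 = n); [| clear -ejn; lia].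
  apply: walkS (IHn j.+1 q _ w3q qw0); last by clear -ejn; lia.
  rewrite pivot_adjE // pq.
  have -> : adj G p w1 && adj G q w2 = false.
    by apply/negP => /andP[/ap1 ? /aq2].
  (* Here [p] would be the first and [q] the last vertex, so [M] would be 1; but [M] is even. *)
  have -> // : adj G p w2 && adj G q w1 = false.
  by apply/negP => /andP[/ap2 j0 /aq1 e1]; move: eM; rewrite -e1 j0.
split=> //.
  rewrite (_ : M.+3 - 2 = M + 1); last by rewrite addn1.
  by apply: walk_cat (tr M 0 w3 _ _ w30) (walk1 p03) => //; apply: walk0.
split.
- by rewrite adj_sym pivot_adjl // eq_sym.
- by rewrite adj_sym.
- by rewrite pivot_adjl // adj_sym.
- by rewrite eq_sym.
Qed.

End Walks.

(** * The paw and the diamond *)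

Definition paw_graph : graph 'I_4 :=
  graph_of_rel (fun i j : 'I_4 => (i < 3) && (j < 3) || (i == 2 :> nat) && (j == 3 :> nat)).

Definition diamond_graph : graph 'I_4 := graph_of_rel (fun i _ : 'I_4 => i < 2).

Lemma pivot_paw (i j : 'I_4) :
  adj (pivot paw_graph (inord 2) (inord 1)) i j = adj diamond_graph i j.
Proof.
have -> : inord 2 = Ordinal (isT : 2 < 4) by apply: val_inj; rewrite /= inordK.
have -> : inord 1 = Ordinal (isT : 1 < 4) by apply: val_inj; rewrite /= inordK.
by case: i => [[|[|[|[|i]]]] Hi] //; case: j => [[|[|[|[|j]]]] Hj] //.
Qed.

Lemma paw_contains_diamond : contains_pivot_minor paw_graph diamond_graph.
Proof.
apply: (@contains_pivot _ _ _ _ (inord 2) (inord 1)).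
  by rewrite /= /rel_adj -val_eqE /= !inordK.
apply: contains_of_iso; apply: (embeds_iso (f := id)); apply: embeds_idP => //.
exact: pivot_paw.
Qed.

(** A component is not complete if and only if it has an induced path [x y z], and it is not
    bipartite if and only if one of its vertices, hence each of them, lies on an odd closed walk. *)
Definition pawlike (T : finType) (G : graph T) := exists x y z,
  [/\ adj G y x, adj G y z, x != z, ~~ adj G x z & odd_closed G y].

(** * Odd closed walks under pivots, deletions and isomorphisms *)

Section Invariance.
Variable T : finType.
Implicit Types G : graph T.

Section PivotWalk.
Variables (G : graph T) (u v : T).
Hypothesis uv : adj G u v.

Let sw x := if x == u then v else if x == v then u else x.

(** As the pivot exchanges the neighbourhoods of [u] and [v], walks are followed with these names
    exchanged. An edge that the pivot creates joins a neighbour of [u] to one of [v]; a walk of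
    length 3 through [uv] replaces it with the same parity. *)
Let odd_step x z : adj (pivot G u v) x z -> exists2 m, odd m & walk G m (sw x) (sw z).
Proof.
have uDv := adj_neq uv; have vDu : v == u = false by rewrite eq_sym; apply/negbTE.
have vu : adj G v u by rewrite adj_sym.
rewrite /sw; case: (eqVneq x u) => [->|xu].
  case: (eqVneq z u) => [->|zu]; first by rewrite adj_irrefl.
  case: (eqVneq z v) => [->|zv] a; exists 1 => //; apply: walk1 => //.
  by rewrite -(pivot_adjl uv).
case: (eqVneq x v) => [->|xv].
  case: (eqVneq z u) => [->|zu]; first by exists 1 => //; apply: walk1.
  case: (eqVneq z v) => [->|zv] a; first by rewrite adj_irrefl in a.
  by exists 1 => //; apply: walk1; rewrite -(pivot_adjr uv).
case: (eqVneq z u) => [->|zu].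
  by rewrite adj_sym pivot_adjl // adj_sym => a; exists 1 => //; apply: walk1.
case: (eqVneq z v) => [->|zv].
  by rewrite adj_sym pivot_adjr // adj_sym => a; exists 1 => //; apply: walk1.
rewrite pivot_adjE //; case xz: (adj G x z); first by exists 1 => //; apply: walk1.
case xuzv: (adj G x u && adj G z v).
  move=> _; case/andP: xuzv => xu' zv'; exists 3 => //.
  by apply: walkS xu' (walkS uv (walk1 _)); rewrite adj_sym.
case/andP=> xv' zu'; exists 3 => //.
by apply: walkS xv' (walkS vu (walk1 _)); rewrite adj_sym.
Qed.

Let pivot_walk n x y : walk (pivot G u v) n x y ->
  exists2 m, odd m = odd n & walk G m (sw x) (sw y).
Proof.
elim: n x => [|n IHn] x; first by move/eqP->; exists 0 => //; apply: walk0.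
case/walkSP=> z /odd_step[m om xz] /IHn[m' om' zy].
by exists (m + m'); [rewrite oddD om om' | apply: walk_cat xz zy].
Qed.

Let odd_closed_sw y : odd_closed (pivot G u v) y -> odd_closed G (sw y).
Proof. by case=> n on /pivot_walk[m om yy]; exists m; rewrite ?om. Qed.

Lemma odd_closed_pivot : (exists y, odd_closed (pivot G u v) y) ->
  exists y, odd_closed G y.
Proof. by case=> y /odd_closed_sw oy; exists (sw y). Qed.

(** If [G] is not pawlike, all neighbourhoods in the component of [y'] are cliques. If this
    component contains [uv], then [u] and [v] have the same other neighbours, and the pivot changes
    nothing. Otherwise the pivot does not affect the adjacencies among [x], [y] and [z]. *)
Lemma pawlike_pivot : pawlike (pivot G u v) -> pawlike G.
Proof.
case=> x [y [z [yx yz xz nxz oy]]]; apply: NNPP => noG.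
have vu : adj G v u by rewrite adj_sym.
have osy := odd_closed_sw oy; set y' := sw y in osy.
have clique n p a b : walk G n y' p -> adj G p a -> adj G p b -> a != b -> adj G a b.
  move=> y'p pa pb ab; apply: contraT => nab; case: noG.
  by exists a, p, b; split=> //; apply: odd_closed_conn y'p osy.
have [[n y'u]|nu] := classic (exists n, walk G n y' u).
  have y'v : walk G (n + 1) y' v := walk_cat y'u (walk1 uv).
  have tw q : q != u -> q != v -> adj G q u = adj G q v.
    move=> qu qv; apply/idP/idP => [a|a].
      by apply: clique y'u _ uv qv; rewrite adj_sym.
    by apply: clique y'v _ vu qu; rewrite adj_sym.
  have eG p q : adj (pivot G u v) p q = adj G p q.
    case: (eqVneq p u) => [->|pu].
      case: (eqVneq q u) => [->|qu]; first by rewrite !adj_irrefl.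
      case: (eqVneq q v) => [->|qv]; first by rewrite pivot_adj_edge.
      by rewrite pivot_adjl // adj_sym -tw // adj_sym.
    case: (eqVneq p v) => [->|pv].
      case: (eqVneq q u) => [->|qu]; first by rewrite adj_sym pivot_adj_edge.
      case: (eqVneq q v) => [->|qv]; first by rewrite !adj_irrefl.
      by rewrite pivot_adjr // adj_sym tw // adj_sym.
    case: (eqVneq q u) => [->|qu].
      by rewrite adj_sym pivot_adjl // tw // adj_sym.
    case: (eqVneq q v) => [->|qv].
      by rewrite adj_sym pivot_adjr // -tw // adj_sym.
    by rewrite pivot_adjE // (tw p) // (tw q) // -addbA addbb addbF.
  case: noG; exists x, y, z; rewrite -!eG; split=> //.
  by case: oy => m om yy; exists m => //; rewrite -(eq_walk m y y eG).
have nv n : ~~ walk G n y' v.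
  by apply/negP => y'v; apply: nu; exists (n + 1); apply: walk_cat y'v (walk1 vu).
have yu : y != u.
  by apply/eqP => e; move: (nv 0); rewrite /y' /sw e eqxx walk0.
have yv : y != v.
  apply/eqP => e; apply: nu; exists 0; rewrite /y' /sw e eqxx.
  by rewrite eq_sym (negPf (adj_neq uv)) walk0.
have ey : y' = y by rewrite /y' /sw (negPf yu) (negPf yv).
have far p : adj (pivot G u v) y p -> [/\ p != u, p != v, adj G y p, ~~ adj G p u & ~~ adj G p v].
  have nyu : ~~ adj G y u by apply/negP => /walk1; rewrite -ey => ?; apply: nu; exists 1.
  have nyv : ~~ adj G y v by apply/negP => /walk1; rewrite -ey; apply/negP.
  move=> yp.
  have pu : p != u.
    by apply: contraNneq nyv => e; rewrite e adj_sym pivot_adjl // adj_sym in yp.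
  have pv : p != v.
    by apply: contraNneq nyu => e; rewrite e adj_sym pivot_adjr // adj_sym in yp.
  move: yp; rewrite pivot_adjE // (negPf nyu) (negPf nyv) !addbF => yp.
  split=> //; apply/negP => a.
    by apply: nu; exists 2; rewrite ey; apply: walkS yp (walk1 a).
  by move/negP: (nv 2); apply; rewrite ey; apply: walkS yp (walk1 a).
have [xu xv xy' nxu nxv] := far _ yx; have [zu zv zy' nzu nzv] := far _ yz.
case: noG; exists x, y, z; split=> //; last by rewrite -ey.
by move: nxz; rewrite pivot_adjE // (negPf nxu) (negPf nxv) !addbF.
Qed.

End PivotWalk.

Lemma pawlike_delete G v : pawlike (delete G v) -> pawlike G.
Proof.
have sub a b : adj (delete G v) a b -> adj G a b.
  by rewrite adj_delete => /and3P[].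
case=> x [y [z [yx yz xz nxz [n on yy]]]]; exists x, y, z; split=> //; try exact: sub.
  move: yx yz nxz; rewrite !adj_delete => /and3P[_ -> _] /and3P[_ -> _].
  by [].
by exists n => //; apply: walk_mono yy.
Qed.

End Invariance.

Section InvarianceIso.
Variables (T U : finType) (G : graph T) (K : graph U).
Hypothesis isoGK : iso G K.

(** A relation between the ambient types, in place of a function, requires no values outside the
    vertex set. *)
Lemma iso_walk_witness : exists f : T -> U -> Prop,
  [/\ forall x, x \in vset G -> exists y, f x y,
      forall x1 x2 y1 y2, f x1 y1 -> f x2 y2 -> adj K y1 y2 = adj G x1 x2
    & forall x1 x2 y1 y2, f x1 y1 -> f x2 y2 -> (x1 == x2) = (y1 == y2)].
Proof.
case: isoGK => F /bij_inj F_inj F_adj.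
exists (fun x y => exists xG, y = val (F (exist _ x xG))); split.
- by move=> x xG; exists (val (F (exist _ x xG))), xG.
- by move=> x1 x2 _ _ [x1G ->] [x2G ->]; rewrite F_adj.
- move=> x1 x2 _ _ [x1G ->] [x2G ->]; rewrite val_eqE (inj_eq F_inj).
  by rewrite -val_eqE.
Qed.

Lemma odd_closed_iso x : x \in vset G -> odd_closed G x ->
  forall f : T -> U -> Prop,
  (forall x, x \in vset G -> exists y, f x y) ->
  (forall x1 x2 y1 y2, f x1 y1 -> f x2 y2 -> adj K y1 y2 = adj G x1 x2) ->
  (forall x1 x2 y1 y2, f x1 y1 -> f x2 y2 -> (x1 == x2) = (y1 == y2)) ->
  forall y, f x y -> odd_closed K y.
Proof.
move=> xG [n on xx] f f_ex f_adj f_eq y fxy; exists n => //.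
suff tr m a b c d : f a c -> f b d -> walk G m a b -> walk K m c d by exact: (tr _ _ _ _ _ fxy fxy xx).
move=> fac fbd; elim: m a c fac => [|m IHm] a c fac /=; first by rewrite (f_eq _ _ _ _ fac fbd).
case/existsP=> z /andP[az zb]; have [w fzw] := f_ex _ (adj_vsetr az).
by apply/existsP; exists w; rewrite (f_adj _ _ _ _ fac fzw) az (IHm _ _ fzw).
Qed.

Lemma odd_vset n x : odd n -> walk G n x x -> x \in vset G.
Proof. by case: n => // n _ /walkSP[z /adj_vset]. Qed.

Lemma pawlike_iso : pawlike G -> pawlike K.
Proof.
have [f [f_ex f_adj f_eq]] := iso_walk_witness.
case=> x [y [z [yx yz xz nxz oy]]].
have [x' fx] := f_ex _ (adj_vsetr yx); have [z' fz] := f_ex _ (adj_vsetr yz).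
have yG := adj_vset yx; have [y' fy] := f_ex _ yG.
exists x', y', z'; rewrite !(f_adj _ _ _ _ fy fx, f_adj _ _ _ _ fy fz, f_adj _ _ _ _ fx fz).
rewrite -(f_eq _ _ _ _ fx fz); split=> //.
exact: odd_closed_iso oy _ f_ex f_adj f_eq _ fy.
Qed.

Lemma has_odd_closed_iso : (exists x, odd_closed G x) -> exists y, odd_closed K y.
Proof.
have [f [f_ex f_adj f_eq]] := iso_walk_witness.
case=> x ox; have xG : x \in vset G by case: ox => n on; apply: odd_vset on.
have [y fxy] := f_ex _ xG; exists y.
exact: odd_closed_iso ox _ f_ex f_adj f_eq _ fxy.
Qed.

End InvarianceIso.

Lemma pawlike_contains (T U : finType) (G : graph T) (H : graph U) :
  contains_pivot_minor G H -> pawlike H -> pawlike G.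
Proof.
case=> s [G' sG' isoG'] /(pawlike_iso (iso_sym isoG')); elim: s G sG' => [|o s IHs] G /=.
  by case=> ->.
case oG: (apply_op G o) => [G1|] // /IHs{}IH /IH.
case: o oG => [v|u v] /=; case: ifP => // ok [<-].
  exact: pawlike_delete.
exact: pawlike_pivot.
Qed.

Lemma odd_closed_contains (T U : finType) (G : graph T) (H : graph U) :
  contains_pivot_minor G H -> (exists x, odd_closed H x) -> exists x, odd_closed G x.
Proof.
case=> s [G' sG' isoG'] /(has_odd_closed_iso (iso_sym isoG')); elim: s G sG' => [|o s IHs] G /=.
  by case=> ->.
case oG: (apply_op G o) => [G1|] // /IHs{}IH /IH.
case: o oG => [v|u v] /=; case: ifP => // ok [<-] [x ox].
  exists x; case: ox => n on xx; exists n => //; apply: walk_mono xx => a b.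
  by rewrite adj_delete => /and3P[].
by apply: (odd_closed_pivot ok); exists x.
Qed.

(** * Pivoting down to triangles and paws *)

Section Certify.
Variable T : finType.
Implicit Types G : graph T.

Lemma contains_triangle G a b c : adj G a b -> adj G b c -> adj G a c ->
  contains_pivot_minor G (cycle_graph 3).
Proof.
move=> ab bc ac; have ba : adj G b a by rewrite adj_sym.
have cb : adj G c b by rewrite adj_sym. have ca : adj G c a by rewrite adj_sym.
pose f (i : 'I_3) := nth a [:: a; b; c] i.
apply: (contains_sub (f := f)) (contains_of_iso (iso_refl _)).
- move=> [[|[|[|i]]] Hi] [[|[|[|j]]] Hj] _ _ //= /eqP; rewrite /f /= => e;
    try exact: val_inj;
    by rewrite ?(negPf (adj_neq ab)) ?(negPf (adj_neq ba)) ?(negPf (adj_neq ac))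
     ?(negPf (adj_neq ca)) ?(negPf (adj_neq bc)) ?(negPf (adj_neq cb)) in e.
- by move=> [[|[|[|i]]] Hi] _ //; rewrite /f /= ?(adj_vset ab) ?(adj_vset bc) ?(adj_vsetr bc).
- move=> [[|[|[|i]]] Hi] [[|[|[|j]]] Hj] _ _ //; rewrite /f /= ?adj_irrefl;
  by rewrite ?ab ?ba ?ac ?ca ?bc ?cb.
Qed.

Lemma contains_paw_induced G a b c d : adj G a b -> adj G b c -> adj G a c ->
  adj G c d -> ~~ adj G a d -> ~~ adj G b d -> contains_pivot_minor G paw_graph.
Proof.
move=> ab bc ac cd ad bd; have ba : adj G b a by rewrite adj_sym.
have cb : adj G c b by rewrite adj_sym. have ca : adj G c a by rewrite adj_sym.
have dc : adj G d c by rewrite adj_sym.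
have da : adj G d a = false by rewrite adj_sym; apply/negbTE.
have db : adj G d b = false by rewrite adj_sym; apply/negbTE.
have aDd : a != d by apply: contraTneq ab => ->; rewrite db.
have bDd : b != d by apply: contraTneq ba => ->; rewrite da.
pose f (i : 'I_4) := nth a [:: a; b; c; d] i.
apply: (contains_sub (f := f)) (contains_of_iso (iso_refl _)).
- move=> [[|[|[|[|i]]]] Hi] [[|[|[|[|j]]]] Hj] _ _ //= /eqP; rewrite /f /= => e;
    try exact: val_inj; move: e;
    by rewrite ?(negPf (adj_neq ab)) ?(negPf (adj_neq ba)) ?(negPf (adj_neq ac))
     ?(negPf (adj_neq ca)) ?(negPf (adj_neq bc)) ?(negPf (adj_neq cb))
     ?(negPf (adj_neq cd)) ?(negPf (adj_neq dc)) ?(negPf aDd) ?(negPf bDd) 1?eq_sym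
     ?(negPf aDd) ?(negPf bDd).
- by move=> [[|[|[|[|i]]]] Hi] _ //; rewrite /f /= ?(adj_vset ab) ?(adj_vset bc) ?(adj_vset cd) ?(adj_vset dc).
- move=> [[|[|[|[|i]]]] Hi] [[|[|[|[|j]]]] Hj] _ _ //; rewrite /f /= ?adj_irrefl;
  by rewrite ?ab ?ba ?ac ?ca ?bc ?cb ?cd ?dc ?da ?db ?(negPf ad) ?(negPf bd).
Qed.

(** The four vertices induce a diamond in which [b] and [d] are nonadjacent. Pivoting [bp] makes it
    a paw with triangle [a p b] and pendant vertex [d] at [b]. *)
Lemma contains_paw_diamond G p a b d : adj G p a -> adj G p b -> adj G p d ->
  adj G a b -> adj G a d -> ~~ adj G b d -> b != d ->
  contains_pivot_minor G paw_graph.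
Proof.
move=> pa pb pd ab ad bd bDd; have bp : adj G b p by rewrite adj_sym.
have nz x y : adj G x y -> (x != y) && (y != x) by move/adj_neq => xy; rewrite [y == x]eq_sym xy.
have /andP[_ aDp] := nz _ _ pa; have /andP[aDb _] := nz _ _ ab.
have /andP[_ dDp] := nz _ _ pd; have dDb : d != b by rewrite eq_sym.
have ba : adj G b a by rewrite adj_sym.
apply: (contains_pivot bp); apply: (@contains_paw_induced _ a p b d).
- by rewrite adj_sym pivot_adjr.
- by rewrite adj_sym pivot_adj_edge.
- by rewrite adj_sym pivot_adjl.
- by rewrite pivot_adjl.
- rewrite pivot_adjE // ad ab [adj G d p]adj_sym pd [adj G d b]adj_sym (negPf bd).
  by rewrite andbF.
- by rewrite pivot_adjr.
Qed.

Lemma odd_closed_triangle G : (exists x, odd_closed G x) ->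
  contains_pivot_minor G (cycle_graph 3).
Proof.
case=> x [n on xx]; elim/ltn_ind: n G x on xx => n IHn G x on xx.
have [L [w [k [leL oL xw ww minL]]]] := min_odd_closed on xx.
have [ltL5|leL5] := ltnP L 5.
  move: L oL ltL5 ww {leL minL xw} => [|[|[|[|[|]]]]] // _ _.
    by case/walkSP=> z wz /eqP zw; rewrite zw adj_irrefl in wz.
  case/walkSP=> a wa /walkSP[b ab /walkSP[c bc /eqP cw]].
  by apply: contains_triangle wa ab _; rewrite -cw adj_sym.
have minW k' z L' : walk G k' w z -> odd L' -> walk G L' z z -> L <= L'.
  by move=> wz; apply: (minL _ _ _ (walk_cat xw wz)).
have [w0 [w1 [w2 [w3 [w12 w33 _]]]]] := shorten_odd_closed oL leL5 ww minW.
apply: (contains_pivot w12); apply: IHn w33; first by clear -leL leL5; lia.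
by rewrite oddB ?oL //; apply: leq_trans leL5.
Qed.

(** Pivots shorten the odd walk to a triangle. Without a paw or diamond, a neighbour of one corner
    of a triangle is adjacent to its other corners. Hence triangles spread along walks as far as
    [y], and the neighbours of [y] form a clique, against the choice of [x] and [z]. *)
Lemma pawlike_paw G : pawlike G -> contains_pivot_minor G paw_graph.
Proof.
case=> x [y [z [yx yz xz nxz [n on yy]]]].
elim/ltn_ind: n G x y z yx yz xz nxz on yy => n IHn G x y z yx yz xz nxz on yy.
have [L [w [k [leL oL yw ww minL]]]] := min_odd_closed on yy.
have [ltL5|leL5] := ltnP L 5; last first.
  have minW k' z' L' : walk G k' w z' -> odd L' -> walk G L' z' z' -> L <= L'.
    by move=> wz; apply: (minL _ _ _ (walk_cat yw wz)).
  have [w0 [w1 [w2 [w3 [w12 w33 [w31 w30 n10 d10]]]]]] := shorten_odd_closed oL leL5 ww minW.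
  (* The path [x y z] may be lost in the pivot; [w1 w3 w0] takes its place. *)
  apply: (contains_pivot w12); apply: IHn w31 w30 d10 n10 _ w33.
    by clear -leL leL5; lia.
  by rewrite oddB ?oL //; apply: leq_trans leL5.
pose tri p := exists a b, [/\ adj G p a, adj G p b & adj G a b].
have tri_w : tri w.
  move: L oL ltL5 ww {leL minL} => [|[|[|[|[|]]]]] // _ _.
    by case/walkSP=> a wa /eqP aw; rewrite aw adj_irrefl in wa.
  case/walkSP=> a wa /walkSP[b ab /walkSP[c bc /eqP cw]].
  by exists a, b; rewrite wa ab adj_sym -cw.
apply: NNPP => noP.
have core p a b d : adj G p a -> adj G p b -> adj G a b -> adj G p d ->
    d != a -> d != b -> adj G d a.
  move=> pa pb ab pd da db; apply: contraT => nda; case: noP.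
  have [bd|nbd] := boolP (adj G d b).
    apply: (contains_paw_diamond (p := p) (a := b) (b := a) (d := d)) => //.
    - by rewrite adj_sym.
    - by rewrite adj_sym.
    - by rewrite adj_sym.
    - by rewrite eq_sym.
  apply: (@contains_paw_induced _ a b p d) => //; rewrite 1?adj_sym //.
have prop p d : tri p -> adj G p d -> tri d.
  case=> a [b [pa pb ab]] pd; have [da|da] := eqVneq d a.
    by exists p, b; split=> //; rewrite da // adj_sym.
  have [db|db] := eqVneq d b.
    by exists p, a; split=> //; rewrite db adj_sym.
  by exists p, a; split=> //; [rewrite adj_sym | apply: core pa pb ab pd da db].
have tri_y : tri y.
  have := walk_rev yw; elim: k w tri_w {L ww leL oL minL ltL5 yw} => [|k IHk] w tri_w.
    by move/eqP <-.
  by case/walkSP=> w' ww' /IHk; apply; apply: prop tri_w ww'.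
case: tri_y => a [b [ya yb ab]]; have ba : adj G b a by rewrite adj_sym.
have clique c d e : adj G y c -> adj G y d -> adj G c d -> adj G y e -> e != c -> adj G e c.
  move=> yc yd cd ye ec; have [->|ed] := eqVneq e d; first by rewrite adj_sym.
  exact: core yc yd cd ye ec ed.
have [xa|xa] := eqVneq x a.
  by case/negP: nxz; rewrite adj_sym xa; apply: clique ya yb ab yz _; rewrite -xa eq_sym.
have a_x : adj G x a := clique _ _ _ ya yb ab yx xa.
by case/negP: nxz; rewrite adj_sym; apply: clique yx ya a_x yz _; rewrite eq_sym.
Qed.

End Certify.

(** * A calculus of polynomial-time functions *)

(** The base [n.+1] is positive, so exponents can be raised and constants absorbed at [n = 0] as
    well. *)
Definition polyb (q : nat -> nat) := exists c k, forall n, q n <= c * n.+1 ^ k.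

Lemma polyb_le f g : (forall n, f n <= g n) -> polyb g -> polyb f.
Proof. by move=> le [c [k H]]; exists c, k => n; apply: leq_trans (le n) (H n). Qed.

Lemma polyb_const c : polyb (fun _ => c).
Proof. by exists c, 0 => n; rewrite expn0 muln1. Qed.

Lemma polyb_id : polyb id.
Proof. by exists 1, 1 => n; rewrite expn1 mul1n. Qed.

Lemma polyb_add f g : polyb f -> polyb g -> polyb (fun n => f n + g n).
Proof.
move=> [c [k Hf]] [d [l Hg]]; exists (c + d), (k + l) => n; rewrite mulnDl.
apply: leq_add; [apply: leq_trans (Hf n) _ | apply: leq_trans (Hg n) _];
  by rewrite leq_mul2l leq_pexp2l ?leq_addr ?leq_addl ?orbT.
Qed.

Lemma polyb_mul f g : polyb f -> polyb g -> polyb (fun n => f n * g n).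
Proof.
move=> [c [k Hf]] [d [l Hg]]; exists (c * d), (k + l) => n.
by rewrite expnD mulnACA leq_mul.
Qed.

Lemma polyb_pb c k f : polyb f -> polyb (fun n => c * (f n).+1 ^ k).
Proof.
move=> [d [l Hf]]; exists (c * d.+1 ^ k), (l * k) => n.
rewrite -mulnA leq_mul2l expnM -expnMn; apply/orP; right.
case: k => // k; rewrite leq_exp2r // mulSn.
apply: leq_ltn_trans (Hf n) _; rewrite -[X in X < _]add0n ltn_add2r.
by rewrite expn_gt0.
Qed.

Lemma polyb_S f : polyb f -> polyb (fun n => (f n).+1).
Proof.
move=> pf; apply: polyb_le (polyb_add (polyb_const 1) pf) => n.
by rewrite add1n.
Qed.

(** By injectivity, the equality test on trees decides equality of the encoded data. *)
Class enc_type (A : Type) := EncType { enc : A -> tree; enc_inj : injective enc }.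

#[export, program] Instance enc_bool : enc_type bool := {| enc := of_bool |}.
Next Obligation. by move=> [] []. Qed.

#[export, program] Instance enc_unit : enc_type unit := {| enc := fun _ => Nil |}.
Next Obligation. by move=> [] []. Qed.

#[export, program] Instance enc_num : enc_type nat := {| enc := enc_nat |}.
Next Obligation. by elim=> [|n IHn] [|m] //= [/IHn->]. Qed.

#[export, program] Instance enc_prod A B `{enc_type A} `{enc_type B} :
  enc_type (A * B) := {| enc := fun x => Cons (enc x.1) (enc x.2) |}.
Next Obligation. by move=> [a b] [c d] /= [e1 e2]; congr (_, _); apply: enc_inj. Qed.

#[export, program] Instance enc_list A `{enc_type A} : enc_type (seq A) :=
  {| enc := fun s => enc_seq (map enc s) |}.
Next Obligation.
by elim=> [|x s IHs] [|y s'] //= [e1 /IHs ->]; congr (_ :: _); apply: enc_inj.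
Qed.

(** Vertices are plain numbers here, since the type ['I_n] varies with the input; the trees are
    those of [enc_op]. *)
#[export, program] Instance enc_ops : enc_type (op nat) :=
  {| enc := fun o => match o with
     | Del v => Cons (of_bool false) (enc_nat v)
     | Piv u v => Cons (of_bool true) (Cons (enc_nat u) (enc_nat v))
     end |}.
Next Obligation.
move=> [v|u v] [v'|u' v'] //=.
  by case=> /(@enc_inj _ enc_num) ->.
by case=> /(@enc_inj _ enc_num) -> /(@enc_inj _ enc_num) ->.
Qed.

(** A Hoare triple for total correctness, with an upper bound on the cost. *)
Definition runs p s (t : nat) (R : store -> Prop) :=
  exists s' t', [/\ exec p s s' t', t' <= t & R s'].

Lemma runs_le p s t t' R : t <= t' -> runs p s t R -> runs p s t' R.
Proof.
by move=> le [s' [t1 [e le1 Rs']]]; exists s', t1; split=> //; apply: leq_trans le.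
Qed.

Lemma runs_weaken p s t (R R' : store -> Prop) :
  (forall s', R s' -> R' s') -> runs p s t R -> runs p s t R'.
Proof. by move=> RR' [s' [t1 [e le1 Rs']]]; exists s', t1; split=> //; apply: RR'. Qed.

Lemma runs_assign s x e v n (R : store -> Prop) : eval s e = v ->
  ecost s e <= n -> R (update s x v) -> runs (Assign x e) s n.+1 R.
Proof.
by move=> <- le Rs; exists (update s x (eval s e)), (ecost s e).+1; split=> //; constructor.
Qed.

Lemma runs_seq p1 p2 s t1 t2 R1 R2 : runs p1 s t1 R1 ->
  (forall s1, R1 s1 -> runs p2 s1 t2 R2) -> runs (Seq p1 p2) s (t1 + t2).+1 R2.
Proof.
move=> [s1 [u1 [e1 le1 /[swap] /[apply]]]] [s2 [u2 [e2 le2 R2s]]].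
by exists s2, (u1 + u2).+1; split; [apply: ExecSeq e1 e2 | rewrite ltnS leq_add |].
Qed.

Lemma runs_assign_seq s x e v n p t R : eval s e = v -> ecost s e <= n ->
  runs p (update s x v) t R -> runs (Seq (Assign x e) p) s (n.+1 + t).+1 R.
Proof.
move=> ev le H; apply: (@runs_seq _ _ _ _ _ (eq (update s x v))).
  exact: runs_assign ev le _.
by move=> _ <-.
Qed.

Lemma runs_if s e c1 c2 t R : runs (if eval s e == Nil then c2 else c1) s t R ->
  runs (If e c1 c2) s (ecost s e + t).+1 R.
Proof.
move=> [s' [t' [ex le Rs']]]; exists s', (ecost s e + t').+1; split=> //.
  exact: ExecIf.
by rewrite ltnS leq_add2l.
Qed.

Lemma runs_while_done s e c (R : store -> Prop) : eval s e = Nil -> R s ->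
  runs (While e c) s (ecost s e).+1 R.
Proof. by move=> e0 Rs; exists s, (ecost s e).+1; split=> //; apply: ExecWhileDone. Qed.

Lemma runs_while_step s e c t1 t2 R1 R2 : eval s e <> Nil -> runs c s t1 R1 ->
  (forall s1, R1 s1 -> runs (While e c) s1 t2 R2) ->
  runs (While e c) s (ecost s e + t1 + t2).+1 R2.
Proof.
move=> e0 [s1 [u1 [e1 le1 /[swap] /[apply]]]] [s2 [u2 [e2 le2 R2s]]].
exists s2, (ecost s e + u1 + u2).+1; split=> //; last by rewrite ltnS !leq_add.
exact: ExecWhileStep e0 e1 e2.
Qed.

Lemma tsize_gt0 a : 0 < tsize a. Proof. by case: a. Qed.

Lemma tsize_eval s e : tsize (eval s e) <= ecost s e.
Proof. by case: e => *; rewrite /= leq_addr. Qed.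

(** An assignment is charged the size of the value that it stores. Hence polynomial cost implies
    polynomial size of the output. *)
Lemma exec_tsize p s s' t i : exec p s s' t -> tsize (s' i) <= tsize (s i) + t.
Proof.
move=> e; elim: {p s s' t} e => /=.
- by move=> s; rewrite leq_addr.
- move=> s x e; rewrite /update; case: eqP => _; last by rewrite leq_addr.
  by rewrite addnS ltnW // ltnS (leq_trans (tsize_eval _ _)) // leq_addl.
- by move=> *; lia.
- by move=> *; lia.
- by move=> *; lia.
- by move=> *; lia.
Qed.

Section Fp.
Context {A B : Type} `{enc_type A} `{enc_type B}.

Definition tsz {C} `{enc_type C} (c : C) := tsize (enc c).

(* Computability in polynomial time on the inputs in [D].  The program may start
   in any store and does not change the variables from [m] on, so that a caller
   can keep values there. *)
Definition fp_on (D : A -> Prop) (f : A -> B) := exists p m c k, 0 < m /\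
  forall s a, D a -> s 0 = enc a ->
  runs p s (c * (tsz a).+1 ^ k)
    (fun s' => s' 0 = enc (f a) /\ forall i, m <= i -> s' i = s i).

Lemma fp_onI (D : A -> Prop) (f : A -> B) p m q : 0 < m -> polyb q ->
  (forall s a, D a -> s 0 = enc a -> runs p s (q (tsz a))
     (fun s' => s' 0 = enc (f a) /\ forall i, m <= i -> s' i = s i)) ->
  fp_on D f.
Proof.
move=> m0 [c [k le]] H1; exists p, m, c, k; split=> // s a Da sa.
by apply: runs_le (le _) _; apply: H1.
Qed.

Lemma fp_on_size (D : A -> Prop) (f : A -> B) : fp_on D f ->
  exists c k, forall a, D a -> tsz (f a) <= c * (tsz a).+1 ^ k.
Proof.
move=> [p [m [c [k [m0 H1]]]]].
have [c' [k' le]] : polyb (fun n => n + c * n.+1 ^ k).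
  exact: polyb_add polyb_id (polyb_pb _ _ polyb_id).
exists c', k' => a Da; apply: leq_trans (le _).
have [s' [t [e let' [s'0 _]]]] := H1 (fun _ => enc a) a Da erefl.
rewrite /tsz -s'0; apply: leq_trans (exec_tsize 0 e) _.
by rewrite leq_add2l.
Qed.

End Fp.

Notation fp f := (fp_on (fun _ => True) f).

(** * Composition, pairing and primitive functions *)

Section FpBasic.
Context {A B C : Type} {eA : enc_type A} {eB : enc_type B} {eC : enc_type C}.

Lemma fp_ext (f g : A -> B) : f =1 g -> fp f -> fp g.
Proof.
by move=> fg [p [m [c [k [m0 H]]]]]; exists p, m, c, k; split=> // s a; rewrite -fg; apply: H.
Qed.

Lemma fp_cast (f : A -> B) (g : A -> C) : (forall a, enc (f a) = enc (g a)) ->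
  fp f -> fp g.
Proof.
by move=> fg [p [m [c [k [m0 H]]]]]; exists p, m, c, k; split=> // s a; rewrite -fg; apply: H.
Qed.

Lemma fp_comp_on (D : B -> Prop) (f : A -> B) (g : B -> C) : fp f ->
  (forall a, D (f a)) -> fp_on D g -> fp (fun a => g (f a)).
Proof.
move=> pf Df; have [cs [ks les]] := fp_on_size pf.
move: pf => [p1 [m1 [c1 [k1 [m10 H1]]]]] [p2 [m2 [c2 [k2 [m20 H2]]]]].
apply: (@fp_onI _ _ _ _ _ _ (Seq p1 p2) (maxn m1 m2)
  (fun n => (c1 * n.+1 ^ k1 + c2 * (cs * n.+1 ^ ks).+1 ^ k2).+1)).
- by rewrite leq_max m10.
- by do ?[apply: polyb_S | apply: polyb_add | apply: polyb_pb | apply: polyb_id].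
move=> s a _ sa; apply: runs_seq; first exact: H1.
move=> s1 [s10 s1m]; apply: runs_le; last apply: runs_weaken (H2 _ (f a) (Df a) s10).
  rewrite leq_mul2l; apply/orP; right; case: (k2) => // k'; rewrite leq_exp2r // ltnS.
  exact: les.
move=> s2 [s20 s2m]; split=> // i; rewrite geq_max => /andP[le1 le2].
by rewrite s2m // s1m.
Qed.

Lemma fp_comp (f : A -> B) (g : B -> C) : fp f -> fp g -> fp (fun a => g (f a)).
Proof. by move=> pf; apply: fp_comp_on. Qed.

Lemma fp_id : fp (fun a : A => a).
Proof.
apply: (@fp_onI _ _ _ _ _ _ Skip 1 (fun=> 1)) => //; first exact: polyb_const.
by move=> s a _ sa; exists s, 1; split=> //; constructor.
Qed.

Fixpoint const_expr (t : tree) : expr :=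
  if t is Cons a b then ECons (const_expr a) (const_expr b) else ENil.

Lemma eval_const s t : eval s (const_expr t) = t.
Proof. by elim: t => //= a -> b ->. Qed.

Lemma ecost_const s s' t : ecost s (const_expr t) = ecost s' (const_expr t).
Proof. by elim: t => //= a -> b ->; rewrite !eval_const. Qed.

Lemma fp_const (b : B) : fp (fun _ : A => b).
Proof.
apply: (@fp_onI _ _ _ _ _ _ (Assign 0 (const_expr (enc b))) 1
  (fun=> (ecost (fun=> Nil) (const_expr (enc b))).+1)) => //; first exact: polyb_const.
move=> s a _ sa; rewrite (ecost_const _ s); apply: runs_assign (leqnn _) _ => //.
by rewrite eval_const; split=> // -[].
Qed.

End FpBasic.

Section FpPair.
Context {A B C : Type} {eA : enc_type A} {eB : enc_type B} {eC : enc_type C}.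

Lemma fp_pair (f : A -> B) (g : A -> C) : fp f -> fp g -> fp (fun a => (f a, g a)).
Proof.
move=> pf pg; have [cs [ks les]] := fp_on_size pf; have [ds [ls led]] := fp_on_size pg.
move: pf pg => [p1 [m1 [c1 [k1 [m10 H1]]]]] [p2 [m2 [c2 [k2 [m20 H2]]]]].
(* Variable [m] keeps the input during the first call and [m.+1] keeps its result during the second;
   both lie beyond what the two programs change. *)
pose m := maxn m1 m2.
have le1 : m1 <= m by rewrite leq_maxl.
have le2 : m2 <= m by rewrite leq_maxr.
have m0 : 0 == m = false by apply/negbTE; rewrite eq_sym -lt0n (leq_trans m10).
pose q1 n := cs * n.+1 ^ ks; pose q2 n := ds * n.+1 ^ ls.
apply: (@fp_onI _ _ _ _ _ _
  (Seq (Assign m (EVar 0)) (Seq p1 (Seq (Assign m.+1 (EVar 0))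
  (Seq (Assign 0 (EVar m)) (Seq p2 (Assign 0 (ECons (EVar m.+1) (EVar 0))))))))
  m.+2 (fun n => 20 + (n + n + c1 * n.+1 ^ k1 + c2 * n.+1 ^ k2 +
     (q1 n + q1 n + q1 n) + (q2 n + q2 n)))) => //.
  by do ?[apply: polyb_S | apply: polyb_add | apply: polyb_pb | apply: polyb_id | apply: polyb_const].
move=> s a _ sa; apply: runs_le; last first.
  apply: (@runs_assign_seq _ _ _ (enc a) (tsz a)); rewrite ?addn0 /= ?sa ?addn0 //.
  apply: runs_seq; first by apply: (H1 _ a) => //; rewrite /update m0.
  move=> s1 [s10 s1m].
  apply: (@runs_assign_seq _ _ _ (enc (f a)) (q1 (tsz a))); rewrite //= ?s10 ?addn0 ?les //.
  apply: (@runs_assign_seq _ _ _ (enc a) (tsz a)); rewrite /= /update.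
  - by rewrite [m == m.+1]eqn_leq ltnn andbF s1m // /update eqxx.
  - by rewrite [m == m.+1]eqn_leq ltnn andbF s1m // /update eqxx addn0.
  apply: runs_seq; first exact: (H2 _ a).
  move=> s2 [s20 s2m].
  have s2E : s2 m.+1 = enc (f a) by rewrite s2m ?leqW //= eqxx.
  apply: (@runs_assign _ _ _ (Cons (enc (f a)) (enc (g a)))
     ((q1 (tsz a) + q2 (tsz a)).+1 + (q1 (tsz a) + q2 (tsz a)))).
  - by rewrite /= s2E s20.
  - rewrite /= s2E s20 !addn0.
    by have := les a I; have := led a I; rewrite -/(q1 _) -/(q2 _) /tsz => ? ?; lia.
  split=> // i lei.
  have i0 : i == 0 = false by case: (i) lei.
  rewrite /update i0 s2m ?i0; last by rewrite (leq_trans le2) // ltnW // ltnW.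
  rewrite gtn_eqF // s1m; last by rewrite (leq_trans le1) // ltnW // ltnW.
  by rewrite /update gtn_eqF // ltnW.
by lia.
Qed.

End FpPair.

Ltac poly := repeat first [apply: polyb_const | apply: polyb_id | apply: polyb_pb
  | apply: polyb_add | apply: polyb_mul | apply: polyb_S].

Lemma fp_expr {A B : Type} {eA : enc_type A} {eB : enc_type B} (f : A -> B) e c : (forall s a, s 0 = enc a ->
    eval s e = enc (f a) /\ ecost s e <= c * tsz a + c) -> fp f.
Proof.
move=> H; apply: (@fp_onI _ _ _ _ _ _ (Assign 0 e) 1 (fun n => (c * n + c).+1)) => //.
  by poly.
move=> s a _ /H[ev le]; apply: runs_assign ev le _; split=> // i.
by rewrite /update; case: i.
Qed.

Section Primitives.
Context {A B C : Type} {eA : enc_type A} {eB : enc_type B} {eC : enc_type C}.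

Lemma fp_fst_prim : fp (fun x : A * B => x.1).
Proof.
apply: (fp_expr (e := EHd (EVar 0)) (c := 2)) => s [a b] /= -> /=; split=> //.
by rewrite /tsz /=; lia.
Qed.

Lemma fp_snd_prim : fp (fun x : A * B => x.2).
Proof.
apply: (fp_expr (e := ETl (EVar 0)) (c := 2)) => s [a b] /= -> /=; split=> //.
by rewrite /tsz /=; lia.
Qed.

Lemma fp_eq_prim (D : eqType) (eD : enc_type D) : fp (fun x : D * D => x.1 == x.2).
Proof.
apply: (fp_expr (e := EEq (EHd (EVar 0)) (ETl (EVar 0))) (c := 8)) => s [a b] /= -> /=.
rewrite (inj_eq enc_inj); split=> //.
have := tsize_gt0 (enc a); have := tsize_gt0 (enc b).
by rewrite /tsz /=; case: (a == b) => /=; lia.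
Qed.

Lemma fp_behead_prim : fp (@behead A).
Proof.
apply: (fp_expr (e := ETl (EVar 0)) (c := 2)) => s [|a l] /= -> /=; split=> //.
by rewrite /tsz /=; lia.
Qed.

Lemma fp_nilp_prim : fp (@nilp A).
Proof.
apply: (fp_expr (e := EEq (EVar 0) ENil) (c := 8)) => s [|a l] /= -> /=; split=> //.
by rewrite /tsz /=; lia.
Qed.

Lemma fp_cond_prim (f g : A -> B) : fp f -> fp g ->
  fp (fun x : bool * A => if x.1 then f x.2 else g x.2).
Proof.
move=> [p1 [m1 [c1 [k1 [m10 H1]]]]] [p2 [m2 [c2 [k2 [m20 H2]]]]].
apply: (@fp_onI _ _ _ _ _ _ (If (EHd (EVar 0)) (Seq (Assign 0 (ETl (EVar 0))) p1)
   (Seq (Assign 0 (ETl (EVar 0))) p2)) (maxn m1 m2)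
   (fun n => 20 + (6 * n + c1 * n.+1 ^ k1 + c2 * n.+1 ^ k2))).
- by rewrite leq_max m10.
- by poly.
have mono c k a b : c * (tsz b).+1 ^ k <= c * (tsz ((a, b) : bool * A)).+1 ^ k.
  rewrite leq_mul2l; apply/orP; right; case: k => // k; rewrite leq_exp2r // ltnS.
  by rewrite /tsz /=; lia.
move=> s [b a] _ s0; have n1 : tsz a < tsz (b, a) by rewrite /tsz /=; lia.
have tb : tsize (of_bool b) <= 3 by case: (b).
have n0 : 0 < tsz (b, a) by apply: tsize_gt0.
have ec : ecost s (EHd (EVar 0)) <= 2 * tsz (b, a) by rewrite /= s0 /tsz /=; lia.
apply: (@runs_le _ _ (4 + (6 * tsz (b, a) + (if b then c1 * (tsz (b, a)).+1 ^ k1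
   else c2 * (tsz (b, a)).+1 ^ k2) + 3)).+1); first by case: (b); clear; lia.
apply: (@runs_le _ _ (ecost s (EHd (EVar 0)) + ((3 * tsz (b, a)).+1 +
   (if b then c1 * (tsz (b, a)).+1 ^ k1 else c2 * (tsz (b, a)).+1 ^ k2)).+1).+1).
  by rewrite !ltnS; clear -ec; lia.
apply: runs_if; rewrite /= s0 /=.
have step p m c k (h : A -> B) :
   (forall s a, True -> s 0 = enc a -> runs p s (c * (tsz a).+1 ^ k)
     (fun s' => s' 0 = enc (h a) /\ forall i, m <= i -> s' i = s i)) -> 0 < m ->
   m <= maxn m1 m2 ->
   runs (Seq (Assign 0 (ETl (EVar 0))) p) s ((3 * tsz (b, a)).+1 + c * (tsz (b, a)).+1 ^ k).+1
     (fun s' => s' 0 = enc (h a) /\ forall i, maxn m1 m2 <= i -> s' i = s i).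
  move=> H m0 lem; apply: (@runs_assign_seq _ _ _ (enc a)); rewrite /= ?s0 //=.
    by rewrite /tsz /= in n1 *; lia.
  apply: runs_le (mono _ _ b a) _; apply: runs_weaken (H _ a I erefl) => s' [-> fr].
  split=> // i lei; rewrite fr; last exact: leq_trans lei.
  by rewrite /update; case: i lei => //; rewrite leqn0 => /eqP e; rewrite e leqn0 -leqn0 in lem; lia.
by case: (b) step => /= step;
  [apply: (step _ _ _ _ _ H1) | apply: (step _ _ _ _ _ H2)];
  rewrite // ?leq_maxl ?leq_maxr.
Qed.

End Primitives.

(** * Iteration with bounded accumulators *)

Section Loop.
Context {E A R : Type} {eE : enc_type E} {eA : enc_type A} {eR : enc_type R}.
Variables (step : E -> A -> R -> R) (cq kq : nat).

(** Iterating a polynomial-time step may produce data of exponential size. As in Cobham's limited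
    recursion, all intermediate results are therefore required to stay polynomial in the size of the
    input. *)
Definition loop_dom (x : E * (seq A * R)) := forall l1 l2, x.2.1 = l1 ++ l2 ->
  tsz (foldl (fun r a => step x.1 a r) x.2.2 l1) <= cq * (tsz x).+1 ^ kq.

Lemma tsz_cat_r (l1 l2 : seq A) : tsz l2 <= tsz (l1 ++ l2).
Proof.
elim: l1 => //= a l1 IH; apply: leq_trans IH _; rewrite /tsz /=.
by clear; lia.
Qed.

Lemma size_le_tsz (l : seq A) : size l <= tsz l.
Proof. by elim: l => //= a l IH; rewrite /tsz /= -/(tsz l) in IH *; lia. Qed.

Lemma fp_loop : fp (fun x : E * (A * R) => step x.1 x.2.1 x.2.2) ->
  fp_on loop_dom (fun x => foldl (fun r a => step x.1 a r) x.2.2 x.2.1).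
Proof.
move=> [p [m [c [k [m0 H]]]]].
(* Variable [m] holds the parameter [e], [m.+1] the rest of the list and [m.+2] the accumulator. *)
pose body := Seq (Assign 0 (ECons (EVar m) (ECons (EHd (EVar m.+1)) (EVar m.+2))))
  (Seq p (Seq (Assign m.+2 (EVar 0)) (Assign m.+1 (ETl (EVar m.+1))))).
(* [Q] bounds the accumulator and [W] the cost of a round, in which [p] is called on a triple of
   size at most [2 * n + Q n + 2]. *)
pose Q n := cq * n.+1 ^ kq.
pose W n := 50 + (20 * n + 20 * Q n + c * (2 * n + Q n + 2).+1 ^ k).
apply: (@fp_onI _ _ _ _ _ _
  (Seq (Assign m (EHd (EVar 0))) (Seq (Assign m.+1 (EHd (ETl (EVar 0))))
    (Seq (Assign m.+2 (ETl (ETl (EVar 0)))) (Seq (While (EVar m.+1) body)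
      (Assign 0 (EVar m.+2)))))) m.+3
  (fun n => 30 + (30 * n + (n + 2) * W n + 3 * Q n))) => //.
  by rewrite /W /Q; poly.
move=> s [e [l r0]] D s0; set x := (e, (l, r0)) in D s0 *; set n := tsz x.
have xE : enc x = Cons (enc e) (Cons (enc l) (enc r0)) by [].
have nE : n = (tsz e + (tsz l + tsz r0).+1).+1 by [].
have D0 : 0 == m = false by apply/negbTE; rewrite eq_sym -lt0n.
have D1 : m == m.+1 = false by rewrite eqn_leq ltnn andbF.
have D2 : m == m.+2 = false by rewrite eqn_leq [_ < m]ltnNge leqnSn andbF.
have D3 : m.+1 == m.+2 = false by rewrite eqn_leq ltnn andbF.
have accle l1 l2 : l = l1 ++ l2 -> tsz (foldl (fun r a => step e a r) r0 l1) <= Q n.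
  by move=> el; apply: (D l1 l2).
have loopH l2 : forall l1 s, l = l1 ++ l2 -> s m = enc e -> s m.+1 = enc l2 ->
    s m.+2 = enc (foldl (fun r a => step e a r) r0 l1) ->
    runs (While (EVar m.+1) body) s ((size l2).+1 * W n)
      (fun s' => s' m.+2 = enc (foldl (fun r a => step e a r) r0 l) /\
                 forall i, m.+3 <= i -> s' i = s i).
  elim: l2 => [|a l2 IH] l1 {s0}s el se sl sr.
    apply: (@runs_le _ _ ((ecost s (EVar m.+1)).+1)).
      by rewrite /= sl /= mul1n /W; lia.
    by apply: runs_while_done => //=; split=> //; rewrite sr el cats0.
  have le2 : tsz (a :: l2) <= n.
    by have := tsz_cat_r l1 (a :: l2); rewrite -el nE; clear; lia.
  have eal : tsz (a :: l2) = (tsz a + tsz l2).+1 by [].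
  have le2' : (tsz a + tsz l2).+1 <= n by rewrite -eal.
  have elr : l = rcons l1 a ++ l2 by rewrite cat_rcons.
  set r := foldl _ r0 l1 in sr; have ler : tsz r <= Q n by apply: accle el.
  have ler' : tsz (step e a r) <= Q n.
    by have := accle _ _ elr; rewrite foldl_rcons.
  have lee : tsz e <= n by rewrite nE; clear; lia.
  have -> : (size (a :: l2)).+1 * W n = W n + (size l2).+1 * W n by rewrite mulSn.
  apply: (@runs_le _ _ (ecost s (EVar m.+1) + (W n - ecost s (EVar m.+1) - 1) + (size l2).+1 * W n).+1).
    rewrite /= sl addn0 -[tsize _]/(tsz (a :: l2)).
    have : tsz (a :: l2) < W n by rewrite /W; clear -le2; lia.
    by clear; lia.
  apply: (@runs_while_step _ _ _ _ _ (fun s' => [/\ s' m = enc e, s' m.+1 = enc l2,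
      s' m.+2 = enc (step e a r) & forall i, m.+3 <= i -> s' i = s i])).
  - by rewrite /= sl.
  - apply: runs_le; last first.
      apply: (@runs_assign_seq _ _ _ (enc (e, (a, r))) (8 * (n + Q n) + 10)).
      + by rewrite /= se sl sr.
      + rewrite /= se sl sr /=; move: le2' lee ler; rewrite /tsz /=; clear; lia.
      apply: (@runs_seq _ _ _ (c * (2 * n + Q n + 2).+1 ^ k)).
        apply: runs_le; last by apply: (H _ (e, (a, r)) I); rewrite /update eqxx.
        rewrite leq_mul2l; apply/orP; right; case: (k) => // k'; rewrite leq_exp2r // ltnS.
        have -> : tsz (e, (a, r)) = (tsz e + (tsz a + tsz r).+1).+1 by [].
        by clear -le2' lee ler; lia.
      move=> s1 [/= s10 s1m].
      apply: (@runs_assign_seq _ _ _ (enc (step e a r)) (Q n)).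
      + by rewrite /= s10.
      + by rewrite /= s10 addn0.
      apply: (@runs_assign _ _ _ (enc l2) (3 * n)).
      + by rewrite /= /update D3 s1m // /update /= sl.
      + rewrite /= /update D3 s1m // /update /= sl /=.
        by move: le2'; rewrite /tsz /=; clear; lia.
      rewrite /update; split.
      + by rewrite D1 D2 s1m // /update eq_sym D0.
      + by rewrite eqxx.
      + by rewrite [m.+2 == _]eq_sym D3 eqxx.
      move=> i lei; rewrite !gtn_eqF //; last by rewrite ltnW.
      by rewrite s1m ?gtn_eqF // /update ?gtn_eqF //; rewrite ?(leq_trans _ lei) //; lia.
    rewrite /= sl addn0 -[tsize _]/(tsz (a :: l2)) /W; clear -le2; lia.
  move=> s1 [s1e s1l s1r s1f].
  apply: runs_weaken (IH (rcons l1 a) s1 elr s1e s1l _).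
    by move=> s' [s'r s'f]; split=> // i lei; rewrite s'f // s1f.
  by rewrite s1r foldl_rcons.
have lee : tsize (enc e) <= n by rewrite nE /tsz; clear; lia.
have lel : tsize (enc l) <= n by rewrite nE /tsz; clear; lia.
have ler0 : tsize (enc r0) <= n by rewrite nE /tsz; clear; lia.
have lex : tsize (enc x) <= n by [].
have ler : tsize (enc (foldl (fun r a => step e a r) r0 l)) <= Q n.
  by apply: (accle l [::]); rewrite cats0.
have lenx : n <= tsize (enc x) by [].
apply: runs_le; last first.
  apply: (@runs_assign_seq _ _ _ (enc e) (2 * n)); rewrite /= ?s0 //=.
    by move: lee lenx lex; rewrite /=; clear; lia.
  apply: (@runs_assign_seq _ _ _ (enc l) (4 * n)); rewrite /= /update ?D0 ?s0 //=.
    by move: lel lex; rewrite /=; clear; lia.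
  apply: (@runs_assign_seq _ _ _ (enc r0) (4 * n)); rewrite /= /update ?D0 ?s0 //=.
    by move: ler0 lex; rewrite /=; clear; lia.
  apply: (@runs_seq _ _ _ (((size l).+1 * W n))).
    apply: (loopH l [::]) => //.
    - by rewrite D2 D1 eqxx.
    - by rewrite D3 eqxx.
    - by rewrite eqxx.
  move=> s1 [s1r s1f].
  apply: (@runs_assign _ _ _ (enc (foldl (fun r a => step e a r) r0 l)) (Q n)).
  - by rewrite /= s1r.
  - by rewrite /= s1r addn0.
  split=> // i lei; rewrite /update.
  have -> : i == 0 = false by case: (i) lei.
  rewrite s1f // !gtn_eqF //; by move: lei; clear; lia.
have : (size l).+1 * W n <= (n + 2) * W n.
  rewrite leq_mul2r; apply/orP; right.
  by have := size_le_tsz l; move: lel; rewrite /tsz; clear; lia.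
by clear; lia.
Qed.

End Loop.

Section Sizes.
Context {A B : Type} {eA : enc_type A} {eB : enc_type B}.

Lemma tsz_pair (a : A) (b : B) : tsz (a, b) = (tsz a + tsz b).+1.
Proof. by []. Qed.

Lemma tsz_cons (a : A) l : tsz (a :: l) = (tsz a + tsz l).+1.
Proof. by []. Qed.

Lemma tsz_nil : tsz (@nil A) = 1.
Proof. by []. Qed.

Lemma tsz_gt0 (a : A) : 0 < tsz a.
Proof. exact: tsize_gt0. Qed.

Lemma tsz_cat (l1 l2 : seq A) : (tsz (l1 ++ l2)).+1 = tsz l1 + tsz l2.
Proof. by elim: l1 => [|a l1 IH] /=; rewrite ?tsz_nil ?add1n // !tsz_cons; lia. Qed.

Lemma tsz_catrev (l1 l2 : seq A) : (tsz (catrev l1 l2)).+1 = tsz l1 + tsz l2.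
Proof.
elim: l1 l2 => [|a l1 IH] l2 /=; first by rewrite tsz_nil add1n.
by rewrite IH !tsz_cons; lia.
Qed.

Lemma tsz_mem (a : A) (l1 l2 : seq A) : tsz a <= tsz (l1 ++ a :: l2).
Proof. by have := tsz_cat l1 (a :: l2); have := tsz_gt0 a; rewrite tsz_cons; case: l1 => [|b l1]; rewrite ?tsz_nil ?tsz_cons; lia. Qed.

Lemma tsz_le_app (s1 s2 : seq A) : tsz s1 <= tsz (s1 ++ s2).
Proof. by rewrite -ltnS tsz_cat -{1}[tsz s1]addn0 ltn_add2l tsize_gt0. Qed.

Lemma tsz_rev (s : seq A) : tsz (rev s) = tsz s.
Proof. by have := tsz_catrev s [::]; rewrite tsz_nil -/(rev s); clear; lia. Qed.

Lemma tsz_bool (b : bool) : tsz b <= 3.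
Proof. by case: b. Qed.

Lemma tsz_nat (n : nat) : tsz n = (2 * n).+1.
Proof.
have E m : tsize (iter m (Cons Nil) Nil) = (2 * m).+1 by elim: m => //= m ->; lia.
exact: E.
Qed.

End Sizes.

(** * Functions on Booleans, lists and numbers *)

Section Combinators.
Context {E A B R : Type} {eE : enc_type E} {eA : enc_type A} {eB : enc_type B}.
Context {eR : enc_type R}.

Lemma fp_fst (f : E -> A * B) : fp f -> fp (fun e => (f e).1).
Proof. by move=> pf; apply: fp_comp pf fp_fst_prim. Qed.

Lemma fp_snd (f : E -> A * B) : fp f -> fp (fun e => (f e).2).
Proof. by move=> pf; apply: fp_comp pf fp_snd_prim. Qed.

Lemma fp_if (b : E -> bool) (f g : E -> A) : fp b -> fp f -> fp g ->
  fp (fun e => if b e then f e else g e).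
Proof. by move=> pb pf pg; apply: fp_comp (fp_pair pb fp_id) (fp_cond_prim pf pg). Qed.

Lemma fp_eq (D : eqType) (eD : enc_type D) (f g : E -> D) : fp f -> fp g ->
  fp (fun e => f e == g e).
Proof. by move=> pf pg; apply: fp_comp (fp_pair pf pg) (fp_eq_prim eD). Qed.

Lemma fp_cons (a : E -> A) (l : E -> seq A) : fp a -> fp l -> fp (fun e => a e :: l e).
Proof. by move=> pa pl; apply: fp_cast (fp_pair pa pl). Qed.

Lemma fp_behead (l : E -> seq A) : fp l -> fp (fun e => behead (l e)).
Proof. by move=> pl; apply: fp_comp pl fp_behead_prim. Qed.

Lemma fp_nilp (l : E -> seq A) : fp l -> fp (fun e => nilp (l e)).
Proof. by move=> pl; apply: fp_comp pl fp_nilp_prim. Qed.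

Lemma fp_foldl (l : E -> seq A) (init : E -> R) (step : E -> A -> R -> R) q :
  fp l -> fp init -> fp (fun x : E * (A * R) => step x.1 x.2.1 x.2.2) ->
  polyb q -> (forall e l1 l2, l e = l1 ++ l2 ->
    tsz (foldl (fun r a => step e a r) (init e) l1) <= q (tsz e)) ->
  fp (fun e => foldl (fun r a => step e a r) (init e) (l e)).
Proof.
move=> pl pinit pstep [cq [kq le]] bound.
apply: (fp_comp_on (fp_pair fp_id (fp_pair pl pinit)) _ (@fp_loop _ _ _ _ _ _ _ cq kq pstep)).
move=> e l1 l2 /= el; apply: leq_trans (bound _ _ _ el) _; apply: leq_trans (le _) _.
rewrite leq_mul2l; apply/orP; right; case: kq {le} => // kq; rewrite leq_exp2r //.
by rewrite ltnS tsz_pair; clear; lia.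
Qed.

End Combinators.

Lemma fp_size_bound {E A : Type} {eE : enc_type E} {eA : enc_type A} (f : E -> A) : fp f -> exists2 q, polyb q & forall e, tsz (f e) <= q (tsz e).
Proof.
move=> /fp_on_size[c [k le]]; exists (fun n => c * n.+1 ^ k); first by poly.
by move=> e; apply: le.
Qed.

Section Combinators2.
Context {E A B : Type} {eE : enc_type E} {eA : enc_type A} {eB : enc_type B}.

Lemma fp_not (b : E -> bool) : fp b -> fp (fun e => ~~ b e).
Proof.
move=> pb; apply: fp_ext (fp_if pb (fp_const false) (fp_const true)) => e.
by case: (b e).
Qed.

Lemma fp_and (b c : E -> bool) : fp b -> fp c -> fp (fun e => b e && c e).
Proof. by move=> pb pc; apply: fp_ext (fp_if pb pc (fp_const false)) => e; case: (b e). Qed.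

Lemma fp_or (b c : E -> bool) : fp b -> fp c -> fp (fun e => b e || c e).
Proof. by move=> pb pc; apply: fp_ext (fp_if pb (fp_const true) pc) => e; case: (b e). Qed.

Lemma fp_xor (b c : E -> bool) : fp b -> fp c -> fp (fun e => b e (+) c e).
Proof.
move=> pb pc; apply: fp_ext (fp_if pb (fp_not pc) pc) => e.
by case: (b e).
Qed.

Lemma fp_rev (l : E -> seq A) : fp l -> fp (fun e => rev (l e)).
Proof.
move=> pl; have [q pq le] := fp_size_bound pl.
have revE (s r : seq A) : foldl (fun r a => a :: r) r s = catrev s r by elim: s r => //=.
apply: (fp_ext (f := fun e => foldl (fun r a => a :: r) [::] (l e))) => [e|].
  by rewrite revE.
apply: (fp_foldl (q := q)) => //.
- exact: fp_const.
- by apply: fp_cons; [apply: fp_fst; apply: fp_snd fp_id | apply: fp_snd; apply: fp_snd fp_id].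
- move=> e l1 l2 el; rewrite revE tsz_rev; apply: leq_trans (le e); rewrite el; exact: tsz_le_app.
Qed.

Lemma fp_head d (l : E -> seq A) : fp l -> fp (fun e => head d (l e)).
Proof.
move=> pl; have [q pq le] := fp_size_bound pl.
have headE (s : seq A) : foldl (fun _ a => a) d (rev s) = head d s.
  by case: s => // a s; rewrite rev_cons foldl_rcons.
apply: (fp_ext (f := fun e => foldl (fun _ a => a) d (rev (l e)))) => //.
apply: (fp_foldl (q := fun n => q n + tsz d)); first exact: fp_rev.
- exact: fp_const.
- by apply: fp_fst; apply: fp_snd fp_id.
- by poly.
- move=> e l1 l2 el; case/lastP: l1 el => [|l1 a] el /=; first exact: leq_addl.
  rewrite foldl_rcons; apply: leq_trans (leq_addr _ _); apply: leq_trans (le e).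
  by rewrite -[l e]revK el rev_cat rev_rcons; apply: tsz_mem.
Qed.

End Combinators2.

Section Combinators3.
Context {E A B : Type} {eE : enc_type E} {eA : enc_type A} {eB : enc_type B}.

Lemma fp_cat (l1 l2 : E -> seq A) : fp l1 -> fp l2 -> fp (fun e => l1 e ++ l2 e).
Proof.
move=> p1 p2; have [q1 pq1 le1] := fp_size_bound p1; have [q2 pq2 le2] := fp_size_bound p2.
have catE (s r : seq A) : foldl (fun r a => a :: r) r s = catrev s r by elim: s r => //=.
apply: (fp_ext (f := fun e => foldl (fun r a => a :: r) (l2 e) (rev (l1 e)))) => [e|].
  by rewrite catE catrevE revK.
apply: (fp_foldl (q := fun n => q1 n + q2 n)) => //.
- exact: fp_rev.
- by apply: fp_cons; [apply: fp_fst; apply: fp_snd fp_id | apply: fp_snd; apply: fp_snd fp_id].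
- by poly.
- move=> e s1 s2 es; rewrite catE.
  have := tsz_catrev (eA := eA) s1 (l2 e); have := tsz_cat (eA := eA) s1 s2; rewrite -es tsz_rev.
  by have := le1 e; have := le2 e; have := tsz_gt0 (eA := @enc_list _ eA) s2; clear; lia.
Qed.

Lemma fp_filter (P : E -> A -> bool) (l : E -> seq A) :
  fp (fun x : E * A => P x.1 x.2) -> fp l -> fp (fun e => filter (P e) (l e)).
Proof.
move=> pP pl; have [q pq le] := fp_size_bound pl.
have filE e (s r : seq A) :
    foldl (fun r a => if P e a then a :: r else r) r s = catrev (filter (P e) s) r.
  by elim: s r => //= a s IH r; rewrite IH; case: (P e a).
apply: (fp_ext (f := fun e => rev (foldl (fun r a => if P e a then a :: r else r) [::] (l e)))) => [e|].
  by rewrite filE catrevE cats0 revK.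
apply: fp_rev; apply: (fp_foldl (q := q)) => //.
- exact: fp_const.
- apply: fp_if; last by apply: fp_snd; apply: fp_snd fp_id.
    by apply: (fp_comp (f := fun x : E * (A * seq A) => (x.1, x.2.1))) pP; apply: fp_pair;
      [apply: fp_fst fp_id | apply: fp_fst; apply: fp_snd fp_id].
  by apply: fp_cons; [apply: fp_fst; apply: fp_snd fp_id | apply: fp_snd; apply: fp_snd fp_id].
- move=> e l1 l2 el; rewrite filE catrevE cats0 tsz_rev; apply: leq_trans (le e); rewrite el.
  apply: leq_trans (tsz_le_app _ _); elim: (l1) => //= a s IH; case: (P e a); rewrite !tsz_cons.
    by rewrite ltnS leq_add2l.
  by apply: leq_trans IH _; clear; lia.
Qed.

Lemma fp_has (P : E -> A -> bool) (l : E -> seq A) :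
  fp (fun x : E * A => P x.1 x.2) -> fp l -> fp (fun e => has (P e) (l e)).
Proof.
move=> pP pl.
apply: (fp_ext (f := fun e => ~~ nilp (filter (P e) (l e)))) => [e|].
  by rewrite /nilp size_filter -lt0n has_count.
by apply: fp_not; apply: fp_nilp; apply: fp_filter.
Qed.

Lemma fp_map (f : E -> A -> B) (l : E -> seq A) :
  fp (fun x : E * A => f x.1 x.2) -> fp l -> fp (fun e => map (f e) (l e)).
Proof.
move=> pf pl; have [q pq le] := fp_size_bound pl.
have [c [k lef]] := fp_on_size pf.
have mapE e (s : seq A) (r : seq B) :
    foldl (fun r a => f e a :: r) r s = catrev (map (f e) s) r by elim: s r => //=.
apply: (fp_ext (f := fun e => rev (foldl (fun r a => f e a :: r) [::] (l e)))) => [e|].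
  by rewrite mapE catrevE cats0 revK.
apply: fp_rev; apply: (fp_foldl (q := fun n => q n * (c * (n + q n).+2 ^ k).+1 + 1)) => //.
- exact: fp_const.
- apply: fp_cons; last by apply: fp_snd; apply: fp_snd fp_id.
  by apply: (fp_comp (f := fun x : E * (A * seq B) => (x.1, x.2.1))) pf; apply: fp_pair;
    [apply: fp_fst fp_id | apply: fp_fst; apply: fp_snd fp_id].
- by poly.
- move=> e l1 l2 el; rewrite mapE catrevE cats0 tsz_rev.
  set K := c * _; have bd a s1 s2 : l e = s1 ++ a :: s2 -> tsz (f e a) <= K.
    move=> es; apply: leq_trans (lef (e, a) I) _; rewrite leq_mul2l; apply/orP; right.
    case: k {lef K} => // k; rewrite leq_exp2r // tsz_pair !ltnS leq_add2l.
    by apply: leq_trans (le e); rewrite es; apply: tsz_mem.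
  apply: (@leq_trans (size l1 * K.+1 + 1)).
    elim/last_ind: l1 l2 el => [|s a IH] l2 el; first by rewrite tsz_nil.
    have es : l e = s ++ a :: l2 by rewrite el cat_rcons.
    rewrite map_rcons -cats1 size_rcons mulSn.
    have := tsz_cat (eA := eB) (map (f e) s) [:: f e a]; rewrite tsz_cons tsz_nil.
    have := IH _ es; have := bd _ _ _ es; clear; lia.
  rewrite leq_add2r leq_mul2r; apply/orP; right; apply: leq_trans (le e).
  apply: leq_trans (size_le_tsz _) _; rewrite el; exact: tsz_le_app.
Qed.

End Combinators3.

Section Flatten.
Context {E A : Type} {eE : enc_type E} {eA : enc_type A}.

Lemma fp_flatten (s : E -> seq (seq A)) : fp s -> fp (fun e => flatten (s e)).
Proof.
move=> ps; have [q pq le] := fp_size_bound ps.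
have flE (t : seq (seq A)) (r : seq A) : foldl (fun r a => r ++ a) r t = r ++ flatten t.
  by elim: t r => [|a t IH] r /=; rewrite ?cats0 // IH catA.
apply: (fp_ext (f := fun e => foldl (fun r a => r ++ a) [::] (s e))) => [e|].
  by rewrite flE.
apply: (fp_foldl (q := q)) => //.
- exact: fp_const.
- by apply: fp_cat; [apply: fp_snd; apply: fp_snd fp_id | apply: fp_fst; apply: fp_snd fp_id].
- move=> e l1 l2 el; rewrite flE /=; apply: leq_trans (le e); rewrite el.
  apply: leq_trans (tsz_le_app _ _); elim: (l1) => //= a t IH; rewrite tsz_cons.
  by have := tsz_cat (eA := eA) a (flatten t); move: IH; clear; lia.
Qed.

End Flatten.

Section Combinators4.
Context {E A : Type} {eE : enc_type E} {eA : enc_type A}.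

(** In unary, a number has the same tree as the list of that many [tt], so the successor is a
    [cons]. *)
Lemma fp_succ (n : E -> nat) : fp n -> fp (fun e => (n e).+1).
Proof. by move=> pn; apply: fp_cast (fp_cons (fp_const tt) (fp_cast (g := fun e => nseq (n e) tt) _ pn)) => e //=; elim: (n e) => //= m ->. Qed.

End Combinators4.

Section Combinators5.
Context {E A : Type} {eE : enc_type E} {eA : enc_type A}.

Lemma fp_units (n : E -> nat) : fp n -> fp (fun e => nseq (n e) tt).
Proof. by move=> pn; apply: fp_cast pn => e; rewrite /=; elim: (n e) => //= m ->. Qed.

Lemma fp_nth d (l : E -> seq A) (n : E -> nat) : fp l -> fp n ->
  fp (fun e => nth d (l e) (n e)).
Proof.
move=> pl pn; have [q pq le] := fp_size_bound pl.
have dropE m (s : seq A) : foldl (fun r (_ : unit) => behead r) s (nseq m tt) = drop m s.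
  by elim: m s => [|m IH] [|a s] //=; rewrite IH.
apply: (fp_ext (f := fun e => head d (foldl (fun r (_ : unit) => behead r) (l e) (nseq (n e) tt)))) => [e|].
  by rewrite dropE -nth0 nth_drop addn0.
apply: fp_head; apply: (fp_foldl (q := q)) => //.
- exact: fp_units.
- by apply: fp_behead; apply: fp_snd; apply: fp_snd fp_id.
- move=> e l1 l2 el; have -> : l1 = nseq (size l1) tt by elim: (l1) => //= -[] s <-.
  rewrite dropE; apply: leq_trans (le e).
  by rewrite -{2}(cat_take_drop (size l1) (l e)); apply: tsz_cat_r.
Qed.

Lemma fp_iota (l : E -> seq A) : fp l -> fp (fun e => iota 0 (size (l e))).
Proof.
move=> pl; have [q pq le] := fp_size_bound pl.
(* The accumulator lists the numbers so far in decreasing order, so its head yields the next one. *)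
have ioE (s : seq A) : foldl (fun r (_ : A) => (if nilp r then 0 else (head 0 r).+1) :: r) [::] s
    = rev (iota 0 (size s)).
  elim/last_ind: s => // s a IH; rewrite foldl_rcons IH size_rcons.
  have -> : (size s).+1 = size s + 1 by rewrite addn1.
  rewrite iotaD rev_cat /=; congr cons.
  case: (size s) => // m; have -> : m.+1 = m + 1 by rewrite addn1.
  by rewrite iotaD rev_cat /= addn1.
apply: (fp_ext (f := fun e => rev (foldl (fun r (_ : A) => (if nilp r then 0 else (head 0 r).+1) :: r)
  [::] (l e)))) => [e|]; first by rewrite ioE revK.
apply: fp_rev; apply: (fp_foldl (q := fun n => q n * (2 * q n + 2) + 1)) => //.
- exact: fp_const.
- apply: fp_cons; last by apply: fp_snd; apply: fp_snd fp_id.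
  apply: fp_if; [|exact: fp_const|].
    by apply: fp_nilp; apply: fp_snd; apply: fp_snd fp_id.
  by apply: fp_succ; apply: fp_head; apply: fp_snd; apply: fp_snd fp_id.
- by poly.
- move=> e l1 l2 el; rewrite ioE tsz_rev.
  have sz : size l1 <= q (tsz e).
    apply: leq_trans (le e); apply: leq_trans (size_le_tsz _) _; rewrite el.
    exact: tsz_le_app.
  apply: (@leq_trans (size l1 * (2 * size l1 + 2) + 1)); last first.
    by rewrite leq_add2r leq_mul // leq_add2r leq_mul2l sz.
  have io m j : tsz (iota j m) <= m * (2 * (j + m) + 2) + 1.
    elim: m j => [|m IH] j /=; first by rewrite tsz_nil.
    by rewrite tsz_cons tsz_nat; have := IH j.+1; nia.
  exact: io.
Qed.

Lemma fp_del (n : E -> nat) : fp n -> fp (fun e => Del (n e)).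
Proof. by move=> pn; apply: fp_cast (fp_pair (fp_const false) pn). Qed.

Lemma fp_piv (n m : E -> nat) : fp n -> fp m -> fp (fun e => Piv (n e) (m e)).
Proof. by move=> pn pm; apply: fp_cast (fp_pair (fp_const true) (fp_pair pn pm)). Qed.

End Combinators5.

(** * Certificates by self-reduction *)

(* A current graph is an [n * n] matrix whose diagonal marks the vertices that have
   not been deleted, see [represents]. *)
Notation matrix := (seq (seq bool)).

Definition get (M : matrix) i j := nth false (nth [::] M i) j.
Definition names (M : matrix) := iota 0 (size M).
Definition act M := [seq v <- names M | get M v v].
Definition mk (M : matrix) (f : nat -> nat -> bool) : matrix :=
  [seq [seq f i j | j <- names M] | i <- names M].
Definition del M v := mk M (fun i j => [&& get M i j, i != v & j != v]).
Definition sw (u v i : nat) := if i == u then v else if i == v then u else i.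
(** [sw] treats the rows and columns of [u] and [v], which trade neighbourhoods; the added term is
    zero there and toggles the other entries. The diagonal, which marks the vertices present,
    stays. *)
Definition piv_entry M u v i j :=
  if i == j then get M i j else
  get M (sw u v i) (sw u v j) (+)
  [&& i != u, i != v, j != u, j != v &
      (get M i u && get M j v) (+) (get M i v && get M j u)].
Definition piv M u v := mk M (piv_entry M u v).
Definition submx M (V : seq nat) : matrix := [seq [seq get M i j | j <- V] | i <- V].

Section FpMatrix.
Context {E : Type} {eE : enc_type E}.

Lemma fp_get (M : E -> matrix) i j : fp M -> fp i -> fp j ->
  fp (fun e => get (M e) (i e) (j e)).
Proof. by move=> pM pi pj; apply: fp_nth pj; apply: fp_nth pi. Qed.

Lemma fp_names (M : E -> matrix) : fp M -> fp (fun e => names (M e)).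
Proof. exact: fp_iota. Qed.

Lemma fp_sw (u v i : E -> nat) : fp u -> fp v -> fp i ->
  fp (fun e => sw (u e) (v e) (i e)).
Proof. by move=> pu pv pi; do 2!(apply: fp_if => //; first exact: fp_eq). Qed.

End FpMatrix.

(** Composition comes last, because its pattern fits every application. *)
Ltac fpt := repeat first [ eassumption | lazymatch goal with
  | |- fp_on _ (fun x => x) => apply: fp_id
  | |- fp_on _ snd => apply: fp_snd_prim
  | |- fp_on _ fst => apply: fp_fst_prim
  | |- fp_on _ (fun _ => ?c) => apply: fp_const
  | |- fp_on _ (fun x => (@?f x).1) => apply: (fp_fst (f := f))
  | |- fp_on _ (fun x => (@?f x).2) => apply: (fp_snd (f := f))
  | |- fp_on _ (fun x => (@?f x, @?g x)) => apply: (fp_pair (f := f) (g := g))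
  | |- fp_on _ (fun x => @?f x && @?g x) => apply: (fp_and (b := f) (c := g))
  | |- fp_on _ (fun x => @?f x || @?g x) => apply: (fp_or (b := f) (c := g))
  | |- fp_on _ (fun x => @?f x (+) @?g x) => apply: (fp_xor (b := f) (c := g))
  | |- fp_on _ (fun x => ~~ @?f x) => apply: (fp_not (b := f))
  | |- fp_on _ (fun x => @?f x == @?g x) => apply: (fp_eq (f := f) (g := g))
  | |- fp_on _ (fun x => get (@?a x) (@?b x) (@?c x)) => apply: fp_get
  | |- fp_on _ (fun x => sw (@?a x) (@?b x) (@?c x)) => apply: fp_sw
  | |- fp_on _ (fun x => names (@?a x)) => apply: fp_names
  | |- fp_on _ (fun x => (@?a x) :: (@?b x)) => apply: fp_cons
  | |- fp_on _ (fun x => (@?a x) ++ (@?b x)) => apply: fp_cat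
  | |- fp_on _ (fun x => nilp (@?a x)) => apply: fp_nilp
  | |- fp_on _ (fun x => head _ (@?a x)) => apply: fp_head
  | |- fp_on _ (fun x => nth _ (@?a x) (@?b x)) => apply: fp_nth
  | |- fp_on _ (fun x => Del (@?a x)) => apply: fp_del
  | |- fp_on _ (fun x => Piv (@?a x) (@?b x)) => apply: fp_piv
  | |- fp_on _ (fun x => match @?b x with _ => _ end) => apply: fp_if
  | |- fp_on _ (fun x => ?h (@?a x)) => apply: (fp_comp (f := a) (g := h))
  end ].

Section FpMatrix2.
Context {E : Type} {eE : enc_type E}.

Lemma fp_mk (M : E -> matrix) (f : E -> nat -> nat -> bool) : fp M ->
  fp (fun x : E * (nat * nat) => f x.1 x.2.1 x.2.2) -> fp (fun e => mk (M e) (f e)).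
Proof.
move=> pM pf; rewrite /mk; apply: fp_map; last by fpt.
apply: fp_map; last by fpt.
by apply: (fp_comp (f := fun x : E * nat * nat => (x.1.1, (x.1.2, x.2))) _ pf); fpt.
Qed.

Lemma fp_act (M : E -> matrix) : fp M -> fp (fun e => act (M e)).
Proof. by move=> pM; apply: fp_filter; fpt. Qed.

Lemma fp_delm (M : E -> matrix) v : fp M -> fp v -> fp (fun e => del (M e) (v e)).
Proof. by move=> pM pv; apply: fp_mk => //; fpt. Qed.

Lemma fp_pivm (M : E -> matrix) u v : fp M -> fp u -> fp v ->
  fp (fun e => piv (M e) (u e) (v e)).
Proof. by move=> pM pu pv; apply: fp_mk => //; rewrite /piv_entry; fpt. Qed.

Lemma fp_submx (M : E -> matrix) V : fp M -> fp V -> fp (fun e => submx (M e) (V e)).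
Proof.
move=> pM pV; apply: fp_map => //; apply: fp_map; fpt.
Qed.

End FpMatrix2.

Ltac fpm := repeat first [ progress fpt | lazymatch goal with
  | |- fp_on _ act => apply: fp_act
  | |- fp_on _ (fun x => del (@?a x) (@?b x)) => apply: fp_delm
  | |- fp_on _ (fun x => piv (@?a x) (@?b x) (@?c x)) => apply: fp_pivm
  | |- fp_on _ (fun x => submx (@?a x) (@?b x)) => apply: fp_submx
  end ].

(** * The loop that deletes vertices *)

Section SelfReduction.
Variable D : matrix -> bool.

Definition cand1 M := [seq v <- act M | D (del M v)].
Definition pairs M := flatten [seq [seq (u, v) | v <- act M] | u <- act M].
Definition cand2 M := [seq x <- pairs M |
  [&& x.1 != x.2, get M x.1 x.2 & D (del (piv M x.1 x.2) x.1)]].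
Definition pick2 M := head (0, 0) (cand2 M).
Definition next_matrix M := if ~~ nilp (cand1 M) then del M (head 0 (cand1 M)) else
  if ~~ nilp (cand2 M) then del (piv M (pick2 M).1 (pick2 M).2) (pick2 M).1 else M.
Definition newops M := if ~~ nilp (cand1 M) then [:: Del (head 0 (cand1 M))] else
  if ~~ nilp (cand2 M) then [:: Piv (pick2 M).1 (pick2 M).2; Del (pick2 M).1] else [::].
Definition step (st : matrix * seq (op nat)) := (next_matrix st.1, st.2 ++ newops st.1).
Definition init M := mk M (fun i j => (i == j) || get M i j).
(** The rows of [M] merely count the rounds. There are enough of them, since every round removes a
    vertex until only as many as in [H] are left. *)
Definition reduce M := foldl (fun st (_ : seq bool) => step st) (init M, [::]) M.

Hypothesis fpD : fp D.

Lemma fp_cand1 : fp cand1.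
Proof. by apply: fp_filter; fpm. Qed.

Lemma fp_cand2 : fp cand2.
Proof.
apply: fp_filter; first by fpm.
by apply: fp_flatten; apply: fp_map; [apply: fp_map; fpm | fpm].
Qed.

Lemma fp_pick2 : fp pick2.
Proof. by apply: fp_head; exact: fp_cand2. Qed.

Lemma fp_next_matrix : fp next_matrix.
Proof. by have p2 := fp_pick2; have c1 := fp_cand1; have c2 := fp_cand2; rewrite /next_matrix; fpm. Qed.

Lemma fp_newops : fp newops.
Proof. by have p2 := fp_pick2; have c1 := fp_cand1; have c2 := fp_cand2; rewrite /newops; fpm. Qed.

Lemma fp_init : fp init.
Proof. by apply: fp_mk; fpt. Qed.

Definition square n (M : matrix) := size M = n /\ (forall r, r \in M -> size r = n).

Lemma square_mk M f : square (size M) (mk M f).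
Proof.
split=> [|r]; first by rewrite size_map size_iota.
by case/mapP=> i _ ->; rewrite size_map size_iota.
Qed.

Lemma tsz_square n M : square n M -> tsz M <= n * (4 * n + 2) + 1.
Proof.
case=> <-; move eN: (size M) => N HM; rewrite -{1}eN; elim: M {eN} HM => [|r M IH] HM.
  by rewrite tsz_nil.
rewrite tsz_cons /= mulSn; have /IH : forall r, r \in M -> size r = N.
  by move=> r' r'M; apply: HM; rewrite inE r'M orbT.
have er : size r = N by apply: HM; rewrite mem_head.
have : tsz r <= 4 * N + 1.
  rewrite -er; elim: (r) => //= b s IHs; rewrite tsz_cons.
  by have := tsz_bool b; move: IHs; clear; lia.
by move: (size M * _) => X; clear; lia.
Qed.

Lemma act_lt M v : v \in act M -> v < size M.
Proof. by rewrite mem_filter mem_iota => /andP[_]. Qed.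

Lemma head_cand1 M : ~~ nilp (cand1 M) -> head 0 (cand1 M) \in cand1 M.
Proof. by case: (cand1 M) => //= v s _; rewrite mem_head. Qed.

Lemma head_cand2 M : ~~ nilp (cand2 M) -> pick2 M \in cand2 M.
Proof. by rewrite /pick2; case: (cand2 M) => //= v s _; rewrite mem_head. Qed.

Lemma mem_pairs M u v : ((u, v) \in pairs M) = (u \in act M) && (v \in act M).
Proof.
apply/flattenP/andP => [[_ /mapP[u' u'M ->] /mapP[v' v'M [-> ->]]] //|[uM vM]].
by exists [seq (u, v) | v <- act M]; apply/mapP; [exists u | exists v].
Qed.

Lemma tsz_newops M : tsz (newops M) <= 6 * size M + 20.
Proof.
have tszDel v : tsz (Del v) = 2 * v + 3.
  have := tsz_nat v; rewrite /tsz /= => ->; clear; lia.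
have tszPiv u v : tsz (Piv u v) = 2 * u + 2 * v + 7.
  have := tsz_nat u; have := tsz_nat v; rewrite /tsz /= => -> ->; clear; lia.
rewrite /newops; case: ifP => [/head_cand1|_].
  rewrite mem_filter => /andP[_ /act_lt]; rewrite tsz_cons tsz_nil tszDel; clear; lia.
case: ifP => [/head_cand2|_]; last by rewrite tsz_nil addn_gt0 orbT.
rewrite mem_filter => /andP[_]; case: (pick2 M) => u v; rewrite mem_pairs /=.
case/andP=> /act_lt + /act_lt; rewrite !tsz_cons tsz_nil tszDel tszPiv; clear; lia.
Qed.

Lemma square_next_matrix n M : square n M -> square n (next_matrix M).
Proof.
move=> sq; have sz : size M = n by case: sq.
have szp u v : size (piv M u v) = n by rewrite size_map size_iota.
rewrite /next_matrix; case: ifP => _; first by rewrite -sz; apply: square_mk.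
by case: ifP => _ //; rewrite -(szp (pick2 M).1 (pick2 M).2); apply: square_mk.
Qed.

(** The accumulator stays small: the matrix keeps its format, as deletions only clear entries, and a
    round appends at most two operations. *)
Lemma fp_reduce : fp reduce.
Proof.
apply: (fp_foldl (q := fun n => (n * (4 * n + 2) + 1 + (n * (6 * n + 20) + 1)).+1)).
- exact: fp_id.
- by fpt; exact: fp_init.
- by have pn := fp_next_matrix; have po := fp_newops; rewrite /step; fpt.
- by poly.
move=> M l1 l2 el; have lel1 : size l1 <= size M by rewrite el size_cat leq_addr.
have [sq ops] : square (size M) (foldl (fun st (_ : seq bool) => step st) (init M, [::]) l1).1 /\
   tsz (foldl (fun st (_ : seq bool) => step st) (init M, [::]) l1).2 <= size l1 * (6 * size M + 20) + 1.
  elim/last_ind: l1 {l2 el lel1} => [|l1 a [IH1 IH2]].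
    by rewrite /= tsz_nil; split=> //; apply: square_mk.
  rewrite foldl_rcons size_rcons; move: IH1 IH2; set st := foldl _ _ _ => IH1 IH2.
  split; first exact: square_next_matrix.
  have sz : size st.1 = size M by case: IH1.
  have e1 : (tsz (st.2 ++ newops st.1)).+1 = tsz st.2 + tsz (newops st.1).
    by apply: tsz_cat.
  have := tsz_newops st.1; rewrite sz mulSn; move: e1 IH2; rewrite /step /=.
  by set X := size l1 * _; clear; lia.
move: sq ops; set st := foldl _ _ _ => sq ops.
have -> : tsz st = (tsz st.1 + tsz st.2).+1 by case: (st) => x y; apply: tsz_pair.
have leM : size M <= tsz M by apply: size_le_tsz.
have le1 := tsz_square sq; rewrite ltnS; apply: leq_add.
  by apply: leq_trans le1 _; rewrite leq_add2r leq_mul // leq_add2r leq_mul2l.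
apply: leq_trans ops _; rewrite leq_add2r; apply: leq_mul.
  exact: leq_trans lel1 leM.
by rewrite leq_add2r leq_mul2l.
Qed.

End SelfReduction.

(** * Matrices that represent graphs *)

Lemma get_mk M f i j : i < size M -> j < size M -> get (mk M f) i j = f i j.
Proof.
move=> ltiM ltjM; rewrite /get (nth_map 0) ?size_iota // (nth_map 0) ?size_iota //.
by rewrite !nth_iota.
Qed.

Lemma get_submx M V i j : i < size V -> j < size V ->
  get (submx M V) i j = get M (nth 0 V i) (nth 0 V j).
Proof. by move=> ltiV ltjV; rewrite /get (nth_map 0) // (nth_map 0). Qed.

Definition represents n (M : matrix) (G : graph 'I_n) := [/\ size M = n,
  forall i : 'I_n, get M i i = (i \in vset G)
  & forall i j : 'I_n, i != j -> get M i j = adj G i j].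

Definition adj_matrix n (G : graph 'I_n) : matrix :=
  [seq [seq adj G i j | j <- enum 'I_n] | i <- enum 'I_n].

Section Represents.
Variables (n : nat) (M : matrix) (G : graph 'I_n).

Lemma size_adj_matrix : size (adj_matrix G) = n.
Proof. by rewrite size_map size_enum_ord. Qed.

Lemma represents_init : vset G = setT -> represents (init (adj_matrix G)) G.
Proof.
move=> vG; have sz := size_adj_matrix.
split=> [|i|i j ij]; first by rewrite size_map size_iota.
  by rewrite get_mk ?sz // eqxx vG inE.
rewrite get_mk ?sz // -[(i : nat) == j]/(i == j) (negPf ij) /get.
rewrite (nth_map i) ?size_enum_ord // (nth_map i) ?size_enum_ord //.
by rewrite !nth_ord_enum.
Qed.

Hypothesis rMG : represents M G.

Let sz : size M = n. Proof. by case: rMG. Qed.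
Let diag (i : 'I_n) : get M i i = (i \in vset G). Proof. by case: rMG. Qed.
Let off (i j : 'I_n) : i != j -> get M i j = adj G i j. Proof. by case: rMG => _ _; apply. Qed.
Let lt (i : 'I_n) : i < size M. Proof. by rewrite sz. Qed.

Lemma represents_del (v : 'I_n) : represents (del M v) (delete G v).
Proof.
split=> [|i|i j ij]; first by rewrite size_map size_iota.
  by rewrite get_mk // diag !inE andbb.
by rewrite get_mk // off // adj_delete -!val_eqE; case: (adj G i j); rewrite ?andbT ?andbF.
Qed.

Lemma represents_piv (u v : 'I_n) : adj G u v -> represents (piv M u v) (pivot G u v).
Proof.
move=> uv; have uDv := adj_neq uv; have vDu : v != u by rewrite eq_sym.
have vu : adj G v u by rewrite adj_sym.
have eqE (x y : 'I_n) : (nat_of_ord x == y) = (x == y) by [].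
split=> [|i|i j ij]; first by rewrite size_map size_iota.
  by rewrite get_mk // /piv_entry eqxx diag.
rewrite get_mk // /piv_entry /sw !eqE (negPf ij).
case: (eqVneq i u) => [iu|iu]; subst.
  rewrite addbF; case: (eqVneq j u) => [ju|ju]; first by rewrite ju eqxx in ij.
  case: (eqVneq j v) => [->|jv]; first by rewrite off // vu pivot_adj_edge.
  by rewrite off 1?eq_sym // pivot_adjl.
case: (eqVneq i v) => [iv|iv]; subst.
  rewrite addbF; case: (eqVneq j u) => [->|ju].
    by rewrite off // uv adj_sym pivot_adj_edge.
  case: (eqVneq j v) => [jv|jv]; first by rewrite jv eqxx in ij.
  by rewrite off 1?eq_sym // pivot_adjr.
case: (eqVneq j u) => [->|ju].
  by rewrite addbF off // adj_sym [RHS]adj_sym pivot_adjl.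
case: (eqVneq j v) => [->|jv].
  by rewrite addbF off // adj_sym [RHS]adj_sym pivot_adjr.
by rewrite !off // pivot_adjE // addbA.
Qed.

Lemma mem_act (v : 'I_n) : (nat_of_ord v \in act M) = (v \in vset G).
Proof. by rewrite mem_filter mem_iota add0n lt /= andbT diag. Qed.

Lemma act_ord i : i \in act M -> exists2 v : 'I_n, i = v & v \in vset G.
Proof.
move=> iM; have lti := act_lt iM; rewrite sz in lti.
by exists (Ordinal lti) => //; rewrite -mem_act.
Qed.

Lemma size_act : size (act M) = #|vset G|.
Proof.
rewrite cardE -(size_map val); apply/perm_size/uniq_perm.
- by rewrite filter_uniq // iota_uniq.
- by rewrite map_inj_uniq ?enum_uniq //; apply: val_inj.
move=> i; apply/idP/mapP => [/act_ord[v -> vG]|[v vG ->]]; last by rewrite mem_act -mem_enum.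
by exists v; rewrite ?mem_enum.
Qed.

(** Small matrices are the keys of the finite tables; [rel_adj] discards their diagonal. *)
Definition key_graph (K : matrix) : graph 'I_(size K) :=
  graph_of_rel (fun i j : 'I_(size K) => get K i j).

Lemma embeds_submx V : uniq V -> {subset V <= act M} ->
  exists2 f : 'I_(size (submx M V)) -> 'I_n,
    embeds f (key_graph (submx M V)) (induced G [set x : 'I_n | val x \in V])
    & forall i, nat_of_ord (f i) = nth 0 V i.
Proof.
move=> uV VM; have szV : size (submx M V) = size V by rewrite size_map.
have ltV (i : 'I_(size (submx M V))) : i < size V by rewrite -szV.
have memV i : nth 0 V (i : 'I_(size (submx M V))) \in V by apply: mem_nth.
have ltn_ i : nth 0 V (i : 'I_(size (submx M V))) < n.
  by have := act_lt (VM _ (memV i)); rewrite sz.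
exists (fun i => Ordinal (ltn_ i)) => //.
have f_inj : injective (fun i => Ordinal (ltn_ i)).
  move=> i j /(congr1 val)/= /eqP; rewrite nth_uniq // => /eqP ij.
  exact: val_inj.
split=> [i j _ _ /f_inj //||i j _ _].
  apply/setP=> x; apply/setIP/imsetP => [[xG]|[i _ ->]]; rewrite ?inE.
    move=> xV; have ltx : index (val x) V < size (submx M V) by rewrite szV index_mem.
    by exists (Ordinal ltx) => //; apply: val_inj; rewrite /= nth_index.
  by rewrite memV -mem_act VM //=.
rewrite /= /induced_adj !inE !memV /= /rel_adj.
case: (eqVneq i j) => [->|ij]; first by rewrite adj_irrefl.
rewrite !get_submx //=.
have dij : Ordinal (ltn_ i) != Ordinal (ltn_ j) by rewrite (inj_eq f_inj).
have := off dij; have dji : Ordinal (ltn_ j) != Ordinal (ltn_ i) by rewrite eq_sym.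
by have := off dji; rewrite adj_sym /= => -> ->; rewrite orbb.
Qed.

End Represents.

#[export, program] Instance enc_opt A `{enc_type A} : enc_type (option A) :=
  {| enc := fun o => if o is Some a then Cons Nil (enc a) else Nil |}.
Next Obligation. by move=> [a|] [b|] //= [e]; congr Some; apply: enc_inj. Qed.

Lemma fp_some {E A} {eE : enc_type E} {eA : enc_type A} (f : E -> A) : fp f ->
  fp (fun e => Some (f e)).
Proof. by move=> pf; apply: fp_cast (fp_pair (fp_const tt) pf). Qed.

(** The answers on [L] are written into the program as a table, so for them mere existence is enough
    and [spec] is never computed. *)
Lemma fp_finite (A : eqType) (B : Type) {eA : enc_type A} {eB : enc_type B} (b0 : B)
    (L : seq A) (spec : A -> B -> Prop) :
  (forall a, exists b, spec a b) ->
  exists2 f : A -> B, fp f & forall a, a \in L -> spec a (f a).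
Proof.
move=> ex; elim: L => [|a L [f pf fP]]; first by exists (fun=> b0); [apply: fp_const|].
have [b ab] := ex a; exists (fun x => if x == a then b else f x).
  by apply: fp_if; [apply: fp_eq; [apply: fp_id|apply: fp_const] | apply: fp_const |].
move=> x; rewrite inE; case: eqP => [-> _ //|_ /=]; exact: fP.
Qed.

Lemma finite_square k : exists L : seq matrix, forall K, square k K -> K \in L.
Proof.
exists [seq [seq val r | r <- val t] | t : k.-tuple (k.-tuple bool) <- enum {: k.-tuple (k.-tuple bool)}].
move=> K [szK HK]; pose t := [seq insubd [tuple of nseq k false] r | r <- K].
have szt : size t == k by rewrite size_map szK.
apply/mapP; exists (Tuple szt); first by rewrite mem_enum.
rewrite /= -map_comp map_id_in // => r rK /=; rewrite val_insubd.
by rewrite (HK _ rK) eqxx.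
Qed.

Lemma finite_squares k : exists L : seq matrix, forall j K, j <= k -> square j K -> K \in L.
Proof.
elim: k => [|k [L HL]].
  have [L HL] := finite_square 0; exists L => j K; rewrite leqn0 => /eqP->; exact: HL.
have [L' HL'] := finite_square k.+1; exists (L ++ L') => j K.
rewrite leq_eqVlt mem_cat => /predU1P[->/HL' ->|]; first by rewrite orbT.
by rewrite ltnS => le /HL -> .
Qed.

Lemma pivots_only (T : finType) (G G' : graph T) s : apply_ops G s = Some G' ->
  #|vset G| <= #|vset G'| -> exists p, s = [seq Piv x.1 x.2 | x <- p].
Proof.
elim: s G => [|[v|u v] s IHs] G /=; first by exists [::].
  case: ifP => // vG /card_apply_ops le1 le2; have := leq_trans le2 le1.
  rewrite leqNgt => /negP[]; apply: proper_card; apply/properP; split.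
    exact: subsetIl.
  by exists v; rewrite // !inE eqxx andbF.
by case: ifP => // uv sG' /(IHs _ sG')[p ->]; exists ((u, v) :: p).
Qed.

Lemma apply_ops_cat (T : finType) (G G1 : graph T) s1 s2 :
  apply_ops G s1 = Some G1 -> apply_ops G (s1 ++ s2) = apply_ops G1 s2.
Proof.
elim: s1 G => [|o s IHs] G /=; first by case=> ->.
by case: (apply_op G o) => // G2; apply: IHs.
Qed.

Section Certifying.
Variables (W : finType) (H : graph W) (D : matrix -> bool).
Hypothesis fpD : fp D.
Hypothesis D_ok : forall n M (G : graph 'I_n), represents M G ->
  D M <-> contains_pivot_minor G H.

Let k := #|vset H|.

Lemma next_matrix_spec n M (G : graph 'I_n) : represents M G -> contains_pivot_minor G H ->
  exists (s : seq (op 'I_n)) G', [/\ newops D M = map (map_op val) s,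
    apply_ops G s = Some G', represents (next_matrix D M) G',
    contains_pivot_minor G' H & #|vset G'| <= maxn k #|vset G|.-1].
Proof.
move=> rMG cG; rewrite /newops /next_matrix.
have card_del (K : graph 'I_n) (v : 'I_n) : v \in vset K -> #|vset (delete K v)| <= maxn k #|vset K|.-1.
  move=> vK; rewrite leq_max; apply/orP; right; rewrite [#|vset K|](cardsD1 v) vK /=.
  by apply/subset_leq_card/subsetP => x; rewrite !inE andbC.
case: ifPn => [/head_cand1|].
  set v' := head _ _; rewrite mem_filter => /andP[Dv /(act_ord rMG)[v ev vG]].
  rewrite ev in Dv *; exists [:: Del v], (delete G v); split=> //=.
  - by rewrite vG.
  - exact: represents_del.
  - by apply/(D_ok (represents_del rMG v)).
  - exact: card_del.
rewrite negbK => /nilP noc1; case: ifPn => [/head_cand2|].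
  case: (pick2 D M) => u' v'; rewrite mem_filter mem_pairs => /andP[/and3P[/= uv guv Duv]].
  case/andP=> /(act_ord rMG)[u eu uG] /(act_ord rMG)[v ev vG]; subst u' v'.
  have auv : adj G u v by case: rMG => _ _ <-.
  have rP := represents_del (represents_piv rMG auv) u.
  exists [:: Piv u v; Del u], (delete (pivot G u v) u); split=> //=.
  - by rewrite auv uG.
  - by apply/(D_ok rP).
  - exact: (card_del (pivot G u v)).
(* Without candidates, the self-reduction shows that the graph is already as small as [H]. *)
rewrite negbK => /nilP noc2; exists [::], G; split=> //.
rewrite leq_max; apply/orP; left; rewrite leqNgt; apply/negP => ltkG.
have [v vG [cv|[w vw cvw]]] := contains_self_reduction cG ltkG.
  have : (v : nat) \in cand1 D M.
    rewrite mem_filter (mem_act rMG) vG andbT.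
    by apply/(D_ok (represents_del rMG v)).
  by rewrite noc1.
have : (nat_of_ord v, nat_of_ord w) \in cand2 D M.
  rewrite mem_filter mem_pairs !(mem_act rMG) vG (adj_vsetr vw) !andbT /=.
  have vDw := adj_neq vw; apply/and3P; split=> //; first by case: rMG => _ _ ->.
  by apply/(D_ok (represents_del (represents_piv rMG vw) v)).
by rewrite noc2.
Qed.

Lemma reduce_spec n (G : graph 'I_n) : vset G = setT -> contains_pivot_minor G H ->
  exists (s : seq (op 'I_n)) G', [/\ (reduce D (adj_matrix G)).2 = map (map_op val) s,
    apply_ops G s = Some G', represents (reduce D (adj_matrix G)).1 G',
    contains_pivot_minor G' H & #|vset G'| = k].
Proof.
move=> vG cG; rewrite /reduce.
have [s [G' [es sG' rG' cG' leG']]] : exists (s : seq (op 'I_n)) G',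
  let st := foldl (fun st (_ : seq bool) => step D st) (init (adj_matrix G), [::]) (adj_matrix G) in
    [/\ st.2 = map (map_op val) s, apply_ops G s = Some G', represents st.1 G',
    contains_pivot_minor G' H & #|vset G'| <= maxn k (n - size (adj_matrix G))].
  move: {2 3}(adj_matrix G) => l; elim/last_ind: l => [|l a [s [G' /= [es sG' rG' cG' leG']]]].
    exists [::], G; split=> //=; first exact: represents_init.
    by rewrite subn0 vG cardsT card_ord leq_maxr.
  rewrite foldl_rcons; move: es rG'; set st := foldl _ _ _ => es rG'.
  have [s2 [G2 [es2 sG2 rG2 cG2 leG2]]] := next_matrix_spec rG' cG'.
  exists (s ++ s2), G2; split=> //=.
  - by rewrite es es2 map_cat.
  - by rewrite (apply_ops_cat _ sG').
  - apply: leq_trans leG2 _; rewrite size_rcons geq_max leq_maxl /=.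
    by move: leG'; clear; lia.
exists s, G'; split=> //; apply/eqP; rewrite eqn_leq; apply/andP; split; last exact: contains_card cG'.
by apply: leq_trans leG' _; rewrite size_adj_matrix subnn maxn0.
Qed.

Definition relabel (V : seq nat) (p : seq (nat * nat)) : seq (op nat) :=
  [seq Piv (nth 0 V x.1) (nth 0 V x.2) | x <- p].

(** Once [k] vertices remain, only pivots can follow. They are looked up in a table indexed by the
    [k] by [k] matrices and then translated to the names of the remaining vertices. *)
Theorem certifying_of_decision : polytime_certifying_pivot_minor H.
Proof.
have [L HL] := finite_square k.
pose spec (K : matrix) (q : seq (nat * nat)) :=
  size K = k -> contains_pivot_minor (key_graph K) H ->
  exists2 p : seq ('I_(size K) * 'I_(size K)), q = [seq (val x.1, val x.2) | x <- p]
    & certifies (key_graph K) H [seq Piv x.1 x.2 | x <- p].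
have spec_ex K : exists q, spec K q.
  have [[szK [s cs]]|no] := classic (size K = k /\ contains_pivot_minor (key_graph K) H); last first.
    by exists [::] => szK cK; case: no.
  have [p ep] : exists p, s = [seq Piv x.1 x.2 | x <- p].
    have [G' sG' /iso_card e] := cs; apply: pivots_only sG' _.
    by rewrite e cardsT card_ord szK.
  by exists [seq (val x.1, val x.2) | x <- p] => _ _; exists p; rewrite -?ep.
have [f fpf fP] := fp_finite [::] L spec_ex.
pose tail M := relabel (act M) (f (submx M (act M))).
pose F (M : matrix) := if D (init M) then
  Some ((reduce D M).2 ++ tail (reduce D M).1) else None.
have fptail : fp tail.
  apply: fp_map; first by apply: fp_piv; apply: fp_nth; fpt; apply: fp_act; fpt.
  by apply: (fp_comp _ fpf); apply: fp_submx; fpt; apply: fp_act; fpt.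
have fpF : fp F.
  apply: fp_if; [by apply: fp_comp fpD; apply: fp_init | | exact: fp_const].
  have pr := fp_reduce fpD; apply: fp_some; apply: fp_cat; first by apply: fp_snd.
  by apply: (fp_comp _ fptail); apply: fp_fst.
(* Tree sizes are positive, so the successor in the bound at most doubles them; this gives the
   factor [2 ^ e]. *)
case: fpF => p [m [c [e [_ run]]]]; exists p, (c * 2 ^ e), e => n G vG.
have encG : enc_graph G = enc (adj_matrix G).
  rewrite /enc_graph /= /adj_matrix -map_comp; congr enc_seq; apply: eq_map => i /=.
  by rewrite -map_comp.
have [s' [t [ex le [s'0 _]]]] := run (update (fun=> Nil) 0 (enc_graph G)) (adj_matrix G) I encG.
suff [a [Fa aP]] : exists a : option (seq (op 'I_n)),
    F (adj_matrix G) = omap (map (map_op val)) a /\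
    (if a is Some s then certifies G H s else ~ contains_pivot_minor G H).
  exists a, t; split=> //.
  - exists s' => //; rewrite s'0 Fa; case: (a) => [s|] //=.
    congr Cons; rewrite -map_comp; congr enc_seq; apply: eq_map => o.
    by case: o.
  - apply: leq_trans le _; rewrite encG -/(tsz _) -mulnA; apply: leq_trans (leq_addr _ _).
    rewrite leq_mul2l -expnMn; apply/orP; right; case: (e) => // e'.
    by rewrite leq_exp2r // mul2n -addnn -addn1 leq_add2l; apply: tsize_gt0.
have Dok := D_ok (represents_init vG); rewrite /F.
case: ifP => [/Dok cG|nD]; last by exists None; split=> // /Dok; rewrite nD.
have [s [G' [es sG' rG' cG' cardG']]] := reduce_spec vG cG.
move: es rG'; set M' := (reduce _ _).1 => es rG'.
have szV : size (act M') = k by rewrite (size_act rG').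
have uV : uniq (act M') by rewrite filter_uniq // iota_uniq.
have [g eg gE] := embeds_submx rG' uV (fun x xV => xV).
have vE : [set x : 'I_n | val x \in act M'] = vset G'.
  by apply/setP=> x; rewrite inE (mem_act rG').
set K := submx M' (act M') in g eg gE.
have eg' : embeds g (key_graph K) G'.
  have eI : embeds id (induced G' (vset G')) G'.
    apply: embeds_idP => [|x y] /=; first exact: setIid.
    rewrite /induced_adj; case xy: (adj G' x y); rewrite ?andbF //.
    by rewrite (adj_vset xy) (adj_vsetr xy).
  case: eg eI => g1 g2 g3 [_ i2 i3]; rewrite vE in g2 g3; split=> //.
    by rewrite -g2 /= setIid.
  by move=> x y xK yK; rewrite -g3 //; apply: i3; rewrite g2; apply: imset_f.
have szK : size K = k by rewrite size_map.
have cK : contains_pivot_minor (key_graph K) H.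
  by apply: contains_iso cG'; apply/iso_sym/(embeds_iso eg').
have sqK : square k K.
  by split=> // r /mapP[i _ ->]; rewrite size_map.
have [p' ep' cp'] := fP _ (HL _ sqK) szK cK.
have [G2 sG2 isoG2] := certifies_embeds eg' cp'.
exists (Some (s ++ [seq map_op g o | o <- [seq Piv x.1 x.2 | x <- p']])); split.
  rewrite /= es map_cat; congr (Some (_ ++ _)); rewrite /tail -/K ep' /relabel.
  by rewrite -!map_comp; apply: eq_map => x /=; rewrite !gE.
by exists G2; rewrite // (apply_ops_cat _ sG').
Qed.

End Certifying.

(** * The three decision procedures *)

(** The recursion is on the constant [c], so the program is a fixed nesting of loops and its output
    has polynomial size. *)
Fixpoint small_tuples c (V : seq nat) : seq (seq nat) :=
  if c is c'.+1 then [::] :: flatten [seq [seq x :: t | t <-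
     [seq t <- small_tuples c' V | ~~ has (fun y => y == x) t]] | x <- V]
  else [:: [::]].

Lemma mem_small_tuples c V t :
  (t \in small_tuples c V) = [&& size t <= c, uniq t & all (mem V) t].
Proof.
elim: c t => [|c IHc] [|x t] //=; rewrite inE /=.
have hasE s : has (fun y => y == x) s = (x \in s).
  by apply/hasP/idP => [[y ys /eqP <-] //|xs]; exists x.
apply/flattenP/idP => [[_ /mapP[y yV ->] /mapP[s + [ex ->]]]|/and3P[le /andP[xt ut] /andP[xV tV]]].
  subst y; rewrite mem_filter IHc hasE => /and4P[-> le -> ->].
  by rewrite ltnS le /= andbT.
exists [seq x :: s | s <- [seq s <- small_tuples c V | ~~ has (fun y => y == x) s]].
  by apply/mapP; exists x.
by apply/mapP; exists t => //; rewrite mem_filter hasE xt IHc -ltnS le ut.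
Qed.

Lemma fp_small_tuples c {E} {eE : enc_type E} (V : E -> seq nat) : fp V ->
  fp (fun e => small_tuples c (V e)).
Proof.
(* The input type varies in the induction: inside a loop, the input also contains the current vertex
   [x]. *)
elim: c E eE V => [|c IHc] E eE V pV /=; first exact: fp_const.
apply: fp_cons; first exact: fp_const.
apply: fp_flatten; apply: fp_map => //; apply: fp_map; first by fpm.
apply: fp_filter; first by apply: fp_not; apply: fp_has; fpm.
by apply: IHc; fpm.
Qed.

(** A copy of [H] is already contained in the subgraph induced by some [c] or fewer vertices, so it
    suffices to look up every submatrix of that size in a finite table. *)
Theorem polytime_of_half_graph (W : finType) (H : graph W) m :
  contains_pivot_minor (half_graph m) H -> polytime_certifying_pivot_minor H.
Proof.
move=> hH; set c := obstruction_bound H m; have [L HL] := finite_squares c.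
have [f fpf fP] := fp_finite false L
  (spec := fun K b => is_true b <-> contains_pivot_minor (key_graph K) H)
  (fun K => ltac:(by have [y|n] := classic (contains_pivot_minor (key_graph K) H);
     [exists true | exists false; split=> // /n])).
apply: (@certifying_of_decision _ _
   (fun M => has (fun t => f (submx M t)) (small_tuples c (act M)))).
  apply: fp_has; first by fpm.
  by apply: fp_small_tuples; fpm.
move=> n M G rMG.
have inL t : size t <= c -> submx M t \in L.
  move=> le; apply: HL le _; split; first by rewrite size_map.
  by move=> r /mapP[i _ ->]; rewrite size_map.
split=> [/hasP[t]|cG].
  rewrite mem_small_tuples => /and3P[le ut /allP tV] /(fP _ (inL _ le)) cK.
  have [g eg _] := embeds_submx rMG ut tV.
  exact: contains_induced (contains_embeds eg cK).
have [S [SG leS] cS] := bounded_obstruction hH cG.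
pose t := map val (enum S).
have ut : uniq t by rewrite map_inj_uniq ?enum_uniq //; apply: val_inj.
have szt : size t <= c by rewrite size_map -cardE.
have tV : {subset t <= act M}.
  by move=> _ /mapP[x + ->]; rewrite mem_enum (mem_act rMG); apply: (subsetP SG).
apply/hasP; exists t; first by rewrite mem_small_tuples szt ut; apply/allP.
apply/(fP _ (inL _ szt)); have [g eg _] := embeds_submx rMG ut tV.
apply: contains_iso cS; apply/iso_sym; have := embeds_iso eg.
have -> // : [set x : 'I_n | val x \in t] = S.
by apply/setP=> x; rewrite inE mem_map ?mem_enum //; apply: val_inj.
Qed.

(** * Deciding odd closed walks *)

Definition nbrs (M : matrix) (X : seq nat) :=
  [seq w <- names M | has (fun u => (u != w) && get M u w) X].
(** The state consists of the vertices at the end of a walk from [v] whose length is the number of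
    rounds, of the parity of this number, and of a flag for a return to [v] in an odd round. The
    flag is tested with the old parity, which is even when the new length is odd. *)
Definition walk_step (M : matrix) (v : nat) (st : seq nat * (bool * bool)) :=
  (nbrs M st.1, (~~ st.2.1,
     st.2.2 || ~~ st.2.1 && has (fun w => w == v) (nbrs M st.1))).
Definition on_odd_walk (M : matrix) (v : nat) :=
  (foldl (fun st (_ : nat) => walk_step M v st) ([:: v], (false, false))
     (names M ++ names M)).2.2.

Lemma tsz_filter {A} {eA : enc_type A} (P : pred A) s : tsz (filter P s) <= tsz s.
Proof.
elim: s => //= a s IH; case: ifP => _; rewrite !tsz_cons; first by rewrite ltnS leq_add2l.
by apply: leq_trans IH _; clear; lia.
Qed.

Lemma fp_nbrs {E} {eE : enc_type E} (M : E -> matrix) X : fp M -> fp X ->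
  fp (fun e => nbrs (M e) (X e)).
Proof. by move=> pM pX; apply: fp_filter; [apply: fp_has; fpm | fpm]. Qed.

Lemma fp_on_odd_walk : fp (fun x : matrix * nat => on_odd_walk x.1 x.2).
Proof.
have [q pq leq] := fp_size_bound (fp_names (fp_fst (fp_id (A := (matrix * nat)%type)))).
apply: fp_snd; apply: fp_snd; apply: (fp_foldl (q := fun n => q n + n + 20)).
- by fpm.
- by fpm.
- rewrite /walk_step; fpm; do ?[apply: fp_nbrs; fpm]; apply: fp_has; first by fpm.
  by apply: fp_nbrs; fpm.
- by poly.
move=> [M v] l1 _ _; set st := foldl _ _ _.
have -> : tsz st = (tsz st.1 + (tsz st.2.1 + tsz st.2.2).+1).+1.
  by case: (st) => x [y z].
have le1 : tsz st.1 <= q (tsz (M, v)) + tsz (M, v) + 2.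
  rewrite /st; case/lastP: (l1) => [|l a].
    rewrite /= tsz_cons tsz_nil (tsz_pair M v); clear; lia.
  rewrite foldl_rcons /=; apply: leq_trans (tsz_filter _ _) _.
  by have /= := leq (M, v); clear; lia.
by have := tsz_bool st.2.1; have := tsz_bool st.2.2; move: le1; clear; lia.
Qed.

Section OddWalkDecision.
Variables (n : nat) (M : matrix) (G : graph 'I_n).
Hypothesis rMG : represents M G.

Lemma walk_iter (v : 'I_n) (l : seq nat) :
  let st := foldl (fun st (_ : nat) => walk_step M v st) ([:: val v], (false, false)) l in
  [/\ forall w : 'I_n, (val w \in st.1) = walk G (size l) w v,
      forall i, i \in st.1 -> i < n, st.2.1 = odd (size l)
    & st.2.2 <-> exists2 j, j <= size l & odd j && walk G j v v].
Proof.
have szM : size M = n by case: rMG.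
elim/last_ind: l => [|l a] /=.
  split=> // [w|i|]; first by rewrite inE.
    by rewrite inE => /eqP ->.
  by split=> // -[j]; rewrite leqn0 => /eqP->.
rewrite foldl_rcons size_rcons; set st := foldl _ _ _ => -[st1 stn par found].
have nb (w : 'I_n) : (val w \in nbrs M st.1) = walk G (size l).+1 w v.
  rewrite mem_filter mem_iota szM ltn_ord !andbT; apply/hasP/existsP => [[u ust]|[u /andP[wu uv]]].
    case/andP=> uw guw; exists (Ordinal (stn _ ust)).
    apply/andP; split; last exact: etrans (esym (st1 (Ordinal (stn _ ust)))) ust.
    by rewrite adj_sym; case: rMG => _ _ <-.
  exists (val u); first by rewrite st1.
  have uDw : u != w by rewrite eq_sym (adj_neq wu).
  by rewrite uDw /=; case: rMG => _ _ -> //; rewrite adj_sym.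
split=> /= [//|i||].
- by rewrite mem_filter mem_iota szM => /andP[_].
- by rewrite par.
have -> : has (fun w => w == val v) (nbrs M st.1) = walk G (size l).+1 v v.
  rewrite -nb; apply/hasP/idP => [[w wn /eqP <-] //|vn]; by exists (val v).
rewrite par; split=> [/orP[/found[j le jP]|jP]|[j]].
- by exists j => //; apply: leqW.
- by exists (size l).+1.
rewrite leq_eqVlt => /predU1P[-> /= ->|le jP]; first by rewrite orbT.
by apply/orP; left; apply/found; exists j.
Qed.

(** In the bipartite double cover on ['I_n * bool], an odd closed walk at [v] connects the two
    copies of [v]; a simple path between them has fewer than [2 * n] edges. This is why
    [on_odd_walk] runs through the names twice. *)
Lemma short_odd_closed (v : 'I_n) : odd_closed G v ->
  exists2 j, j <= n + n & odd j && walk G j v v.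
Proof.
pose e (x y : 'I_n * bool) := adj G x.1 y.1 && (y.2 == ~~ x.2).
have to_path j x y b : walk G j x y -> connect e (x, b) (y, b (+) odd j).
  elim: j x b => [|j IHj] x b; first by move/eqP->; rewrite addbF connect0.
  case/walkSP=> z xz /IHj - /(_ (~~ b)) zy.
  have ez : e (x, b) (z, ~~ b) by rewrite /e /= xz eqxx.
  by apply: connect_trans (connect1 ez) _; rewrite /= addbN -addNb.
case=> j oj /to_path - /(_ false) /connectP[p0 p0P]; rewrite oj /=.
case/shortenP: p0P => p pP up _ ep.
exists (size p).
  have := max_card (mem ((v, false) :: p)); rewrite (card_uniqP up) card_prod card_ord card_bool /=.
  by rewrite muln2 -addnn => /ltnW.
have of_path x q : path e x q -> walk G (size q) x.1 (last x q).1 /\ (last x q).2 = x.2 (+) odd (size q).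
  elim: q x => [|y q IHq] x /=; first by rewrite addbF eqxx.
  case/andP=> /andP[xy /eqP y2] /IHq[w ->]; split; last by rewrite y2 addbN addNb.
  by apply/existsP; exists y.1; rewrite xy.
by have [] := of_path _ _ pP; rewrite -ep /= => w <-.
Qed.

Lemma on_odd_walkP (v : 'I_n) : on_odd_walk M v <-> odd_closed G v.
Proof.
have szM : size M = n by case: rMG.
have [_ _ _ found] := walk_iter v (names M ++ names M).
rewrite size_cat size_iota szM in found; rewrite /on_odd_walk found.
split=> [[j _ /andP[oj w]]|/short_odd_closed //]; by exists j.
Qed.

End OddWalkDecision.

Theorem polytime_triangle (W : finType) (H : graph W) :
  iso H (cycle_graph 3) -> polytime_certifying_pivot_minor H.
Proof.
move=> isoH; apply: (@certifying_of_decision _ _ (fun M => has (on_odd_walk M) (act M))).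
  by have := fp_on_odd_walk => p; apply: fp_has; fpm.
move=> n M G rMG; split=> [/hasP[_ /(act_ord rMG)[v -> vG] /(on_odd_walkP rMG) ov]|cG].
  apply: (contains_target_iso (iso_sym isoH)); apply: odd_closed_triangle.
  by exists v.
have [] := odd_closed_contains (contains_target_iso isoH cG).
  by exists ord0, 3 => //; apply/existsP; exists (@Ordinal 3 1 isT) => /=; apply/existsP;
    exists (@Ordinal 3 2 isT) => /=; apply/existsP; exists (@Ordinal 3 0 isT).
move=> v ov; apply/hasP; exists (val v); last by apply/(on_odd_walkP rMG).
by rewrite (mem_act rMG); case: ov => j oj; apply: odd_vset oj.
Qed.

Definition paw_decision M :=
  has (fun y => on_odd_walk M y && has (fun x => [&& x != y, get M y x &
    has (fun z => [&& z != y, get M y z, x != z & ~~ get M x z]) (act M)]) (act M)) (act M).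

Lemma fp_paw_decision : fp paw_decision.
Proof.
have p := fp_on_odd_walk; apply: fp_has; last by fpm.
apply: fp_and; first by fpm.
apply: fp_has; last by fpm.
apply: fp_and; first by fpm.
apply: fp_and; first by fpm.
by apply: fp_has; fpm.
Qed.

Lemma paw_decisionP n M (G : graph 'I_n) : represents M G ->
  paw_decision M <-> pawlike G.
Proof.
move=> rMG; have off (i j : 'I_n) : i != j -> get M i j = adj G i j by case: rMG => _ _; apply.
split=> [/hasP[_ /(act_ord rMG)[y -> yG]] /andP[/(on_odd_walkP rMG) oy]|].
  case/hasP=> _ /(act_ord rMG)[x -> xG] /and3P[xy yx].
  case/hasP=> _ /(act_ord rMG)[z -> zG] /and4P[zy yz xz nxz].
  by exists x, y, z; rewrite -!off // 1?eq_sym.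
case=> x [y [z [yx yz xz nxz oy]]].
apply/hasP; exists (val y); first by rewrite (mem_act rMG) (adj_vset yx).
apply/andP; split; first by apply/(on_odd_walkP rMG).
have xy := adj_neq yx; have zy := adj_neq yz.
apply/hasP; exists (val x); first by rewrite (mem_act rMG) (adj_vsetr yx).
rewrite off // yx [val x == val y]eq_sym xy /=.
apply/hasP; exists (val z); first by rewrite (mem_act rMG) (adj_vsetr yz).
by rewrite !off // yz nxz [val z == val y]eq_sym zy xz.
Qed.

Theorem polytime_pawlike (W : finType) (H : graph W) :
  pawlike H -> contains_pivot_minor paw_graph H -> polytime_certifying_pivot_minor H.
Proof.
move=> pH cH; apply: (certifying_of_decision fp_paw_decision) => n M G rMG.
rewrite (paw_decisionP rMG); split=> [/pawlike_paw cG|cG].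
  exact: contains_trans cG cH.
exact: pawlike_contains cG pH.
Qed.

(** * The graphs H of the theorem *)

(** The vertex 1 of the first side is adjacent to exactly 0 and 1 on the other side, whose further
    vertices serve as the [t] isolated ones. *)
Lemma half_graph_P3_tP1 t : contains_pivot_minor (half_graph t.+2)
  (dunion (path_graph 3) (edgeless_graph t)).
Proof.
pose o i : 'I_t.+2 := inord i.
pose f (x : 'I_3 + 'I_t) : 'I_t.+2 + 'I_t.+2 := match x with
  | inl i => if i == 1 :> nat then inl (o 1) else inr (o (i == 2 :> nat))
  | inr i => inr (o i.+2) end.
have oE i : i < t.+2 -> o i = i :> nat by move=> lti; rewrite inordK.
have oI i j : i < t.+2 -> j < t.+2 -> o i = o j -> i = j.
  by move=> /oE {2}<- /oE {2}<- ->.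
have oI' i j : o i = o j -> i < t.+2 -> j < t.+2 -> i = j by move=> e lti ltj; apply: oI.
have lt2 (i : 'I_t) : i.+2 < t.+2 by rewrite !ltnS.
have lt1 (b : bool) : b < t.+2 by case: b.
apply: (contains_sub (f := f)) (contains_of_iso (iso_refl _)).
- move=> [i|i] [j|j] _ _ /=; last first.
  + case=> /(oI _ _ (lt2 i) (lt2 j)) [ij]; congr inr; exact: val_inj.
  + case: ifP => // _ [/(oI _ _ (lt2 i) (lt1 _))]; by case: (_ == _).
  + case: ifP => // _ [/(oI _ _ (lt1 _) (lt2 j))]; by case: (_ == _).
  case: i j => [[|[|[|i]]] Hi] [[|[|[|j]]] Hj] //= e; congr inl; apply: val_inj => //=;
    by case: e => e; have := oI' _ _ e isT isT.
- by move=> x _; rewrite inE.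
- move=> [i|i] [j|j] _ _ /=; rewrite /rel_adj /=.
 + by case: i j => [[|[|[|i]]] Hi] [[|[|[|j]]] Hj] //=; rewrite /half_rel /= ?oE // ?eqxx ?andbF ?orbF.
  + case: (eqVneq (i : nat) 1) => i1; rewrite /half_rel /= ?andbF //.
    by rewrite oE // oE // orbF ltnNge.
  + case: (eqVneq (j : nat) 1) => j1; rewrite /half_rel /= ?andbF //.
    by rewrite oE // oE // ltnNge.
  + by rewrite !andbF.
Qed.

(** The last vertex of the first side is adjacent to the whole other side. *)
Lemma half_graph_star t : contains_pivot_minor (half_graph t.+1) (star_graph t).
Proof.
pose f (i : 'I_t.+1) : 'I_t.+1 + 'I_t.+1 :=
  if i == ord0 then inl ord_max else inr (inord i.-1).
have lti (i : 'I_t.+1) : i.-1 < t.+1 by apply: leq_ltn_trans (leq_pred _) _.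
apply: (contains_sub (f := f)) (contains_of_iso (iso_refl _)).
- move=> i j _ _; rewrite /f; case: eqP => [->|/eqP i0]; case: eqP => [->|/eqP j0] //.
  case=> /(congr1 (@nat_of_ord _)); rewrite !inordK // => ij; apply: val_inj => /=.
  by move: i0 j0; rewrite -!val_eqE /= -!lt0n => /prednK <- /prednK <-; rewrite ij.
- by move=> x _; rewrite inE.
- move=> i j _ _ /=; rewrite /f /rel_adj.
  case: (eqVneq i ord0) => [i0|i0]; case: (eqVneq j ord0) => [j0|j0];
    rewrite /half_rel /= ?andbF ?orbF ?inordK //.
  + by rewrite i0 j0.
  + by rewrite i0 eq_sym j0; have := ltn_ord j; case: (nat_of_ord j) => //= m /ltnW.
  + by rewrite j0 i0; have := ltn_ord i; case: (nat_of_ord i) => //= m /ltnW.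
Qed.

(* The position of the edge [ij], [i < j], in [bits]. *)
Definition pair_index i j := (j * j.-1)./2 + i.
Definition adjb (b : seq bool) i j :=
  (i < j) && nth false b (pair_index i j) || (j < i) && nth false b (pair_index j i).
Definition bits (a : nat -> nat -> bool) :=
  [:: a 0 1; a 0 2; a 1 2; a 0 3; a 1 3; a 2 3].
Definition bit_graph k (b : seq bool) : graph 'I_k :=
  graph_of_rel (fun i j : 'I_k => adjb b i j).

Lemma adjb_bits a i j : (forall i j, a i j = a j i) -> (forall i, a i i = false) ->
  i < 4 -> j < 4 -> adjb (bits a) i j = a i j.
Proof.
move=> sa ia; case: i => [|[|[|[|i]]]] //; case: j => [|[|[|[|j]]]] // _ _;
  by rewrite /adjb /= ?orbF ?ia // sa.
Qed.

Lemma adj_bit_graph k b (i j : 'I_k) : adj (bit_graph k b) i j = adjb b i j.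
Proof.
rewrite /= /rel_adj /adjb -val_eqE /=; case: ltngtP => //= _; by rewrite !orbF ?orbb.
Qed.

Lemma bit_graph_iso (U : finType) (H : graph U) : #|vset H| <= 4 ->
  exists2 b, size b = 6 & iso (bit_graph #|vset H| b) H.
Proof.
move=> le4; pose k := #|vset H|.
pose a i j := if (insub i : option 'I_k) is Some i' then
  if (insub j : option 'I_k) is Some j' then adj H (enum_val i') (enum_val j') else false else false.
exists (bits a) => //; apply: (embeds_iso (f := @enum_val U (mem (vset H)))); split.
- by move=> i j _ _; apply: enum_val_inj.
- apply/setP=> x; apply/idP/imsetP => [xH|[i _ ->]]; last exact: enum_valP.
  by exists (enum_rank_in xH x); rewrite ?enum_rankK_in.
- move=> i j _ _; rewrite adj_bit_graph adjb_bits /a.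
  + by rewrite !valK.
  + by move=> x y; case: insub => [x'|]; case: insub => [y'|] //; rewrite adj_sym.
  + by move=> x; case: insub => [x'|] //; rewrite adj_irrefl.
  + exact: leq_trans le4.
  + exact: leq_trans le4.
Qed.

(** * Exhaustive classification of the graphs with at most four vertices *)

Fixpoint seqs (T : Type) k (s : seq T) : seq (seq T) :=
  if k is k'.+1 then flatten [seq [seq x :: t | t <- seqs k' s] | x <- s] else [:: [::]].

Lemma mem_seqs (T : eqType) (s t : seq T) : {subset t <= s} -> t \in seqs (size t) s.
Proof.
elim: t => // x t IHt ts; apply/flattenP.
exists [seq x :: t' | t' <- seqs (size t) s].
  by apply/mapP; exists x => //; apply: ts; rewrite mem_head.
by apply/mapP; exists t => //; apply: IHt => y yt; apply: ts; rewrite inE yt orbT.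
Qed.

Fixpoint arrangements (T : eqType) k (s : seq T) : seq (seq T) :=
  if k is k'.+1 then
    flatten [seq [seq x :: t | t <- arrangements k' (rem x s)] | x <- s]
  else [:: [::]].

(** The head of [p] is the default of [nth]. For [k = 0] there is no head, but the lists of indices
    are empty as well. *)
Definition embeds_list (T : finType) (G : graph T) k b (p : seq T) :=
  [&& size p == k, uniq p &
    all (fun i => all (fun j => if p is x0 :: _ then
       adj G (nth x0 p i) (nth x0 p j) == adjb b i j else false) (iota 0 k)) (iota 0 k)].

Lemma embeds_listP (T : finType) (G : graph T) k b p : vset G = setT ->
  embeds_list G k b p -> exists2 f : 'I_k -> T, injective f
    & forall i j, adj G (f i) (f j) = adj (bit_graph k b) i j.
Proof.
move=> vG /and3P[/eqP szp up /allP pP].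
case: p szp up pP => [|x0 p] szp up pP.
  subst k; have f (i : 'I_0) : T by case: i.
  by exists f => -[].
exists (fun i => nth x0 (x0 :: p) i) => [i j /eqP|i j].
  by rewrite nth_uniq ?szp // => /eqP; apply: val_inj.
have ik (i' : 'I_k) : (i' : nat) \in iota 0 k by rewrite mem_iota add0n ltn_ord.
by have /allP/(_ _ (ik j))/eqP -> := pP _ (ik i); rewrite adj_bit_graph.
Qed.

Definition has_induced (T : finType) (G : graph T) (s : seq T) k b :=
  has (embeds_list G k b) (arrangements k s).

Lemma has_induced_contains (T : finType) (G : graph T) s k b : vset G = setT ->
  has_induced G s k b -> contains_pivot_minor G (bit_graph k b).
Proof.
move=> vG /hasP[p _ /(embeds_listP vG)[f f_inj f_adj]].
apply: (contains_sub (f := f)) (contains_of_iso (iso_refl _)) => //.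
- by move=> i j _ _; apply: f_inj.
- by move=> i _; rewrite vG inE.
Qed.

Lemma has_induced_iso (T : finType) (G : graph T) s k b : vset G = setT -> #|T| = k ->
  has_induced G s k b -> iso (bit_graph k b) G.
Proof.
move=> vG cT /hasP[p _ /(embeds_listP vG)[f f_inj f_adj]].
apply: (embeds_iso (f := f)); split=> [i j _ _|| i j _ _]; [exact: f_inj | | exact: f_adj].
rewrite vG; apply/esym/eqP; rewrite eqEcard subsetT cardsT cT.
by rewrite card_imset //= cardsT card_ord.
Qed.

Definition half4 := half_graph 4.
Definition u0 : 'I_4 + 'I_4 := inl (@Ordinal 4 0 isT).
Definition u1 : 'I_4 + 'I_4 := inl (@Ordinal 4 1 isT).
Definition u2 : 'I_4 + 'I_4 := inl (@Ordinal 4 2 isT).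
Definition w0 : 'I_4 + 'I_4 := inr (@Ordinal 4 0 isT).
Definition w1 : 'I_4 + 'I_4 := inr (@Ordinal 4 1 isT).
Definition w2 : 'I_4 + 'I_4 := inr (@Ordinal 4 2 isT).
Definition w3 : 'I_4 + 'I_4 := inr (@Ordinal 4 3 isT).
Definition ord3s := [:: @Ordinal 3 0 isT; @Ordinal 3 1 isT; @Ordinal 3 2 isT].
Definition ord4s := [:: @Ordinal 4 0 isT; @Ordinal 4 1 isT; @Ordinal 4 2 isT; @Ordinal 4 3 isT].

(** The lists induce 4P_1, P_2 + 2P_1, P_3 + P_1, K_{1,3} and P_4. Arrangements of fewer of their
    vertices give all smaller graphs except C_3. *)
Definition in_half4 k b := has (fun s => has_induced half4 s k b)
  [:: [:: w0; w1; w2; w3]; [:: u0; w0; w1; w2]; [:: u1; w0; w1; w2];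
      [:: u2; w0; w1; w2]; [:: u0; w0; u1; w1]].
(** After the pivot, the lists induce 2P_2 and C_4. A half graph itself has no induced 2P_2, as the
    neighbourhoods on each side form a chain. *)
Definition in_pivoted_half4 k b := has (fun s => has_induced (pivot half4 u1 w0) s k b)
  [:: [:: w0; w1; u2; w2]; [:: u0; w1; u1; w0]].

Definition classified k b :=
  [|| in_half4 k b,
      (k == 3) && has_induced (cycle_graph 3) ord3s k b,
      (k == 4) && [|| has_induced paw_graph ord4s k b,
        has_induced diamond_graph ord4s k b,
        has_induced (complete_graph 4) ord4s k b |
        has_induced (dunion (cycle_graph 3) (path_graph 1))
          (inr (@Ordinal 1 0 isT) :: map inl ord3s) k b]
    | in_pivoted_half4 k b].

(** All 64 vectors are checked for every [k]; for [k < 4], the bits of pairs that contain an index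
    from [k] on are not read. *)
Lemma small_classified k b : k <= 4 -> size b = 6 -> classified k b.
Proof.
have H : all (fun k => all (classified k) (seqs 6 [:: true; false])) (iota 0 5).
  by vm_compute.
move=> lek szb; have /allP/(_ b) := allP H k ltac:(by rewrite mem_iota).
by rewrite -szb; apply; apply: mem_seqs => -[].
Qed.

Lemma contains_half4 k b : in_half4 k b || in_pivoted_half4 k b ->
  contains_pivot_minor half4 (bit_graph k b).
Proof.
case/orP=> /hasP[s _]; first exact: has_induced_contains.
by move/has_induced_contains => c; apply: (@contains_pivot _ _ _ _ u1 w0); last exact: c.
Qed.

Lemma pawlike_paw_graph : pawlike paw_graph.
Proof.
exists (@Ordinal 4 0 isT), (@Ordinal 4 2 isT), (@Ordinal 4 3 isT); split=> //.
exists 3 => //; apply/existsP; exists (@Ordinal 4 0 isT) => /=; apply/existsP.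
by exists (@Ordinal 4 1 isT) => /=; apply/existsP; exists (@Ordinal 4 2 isT).
Qed.

Lemma pawlike_diamond_graph : pawlike diamond_graph.
Proof.
exists (@Ordinal 4 2 isT), (@Ordinal 4 0 isT), (@Ordinal 4 3 isT); split=> //.
exists 3 => //; apply/existsP; exists (@Ordinal 4 1 isT) => /=; apply/existsP.
by exists (@Ordinal 4 2 isT) => /=; apply/existsP; exists (@Ordinal 4 0 isT).
Qed.

Theorem theorem1p1 (U : finType) (H : graph U)
  (H_neq_K4 : ~ iso H (complete_graph 4))
  (H_neq_C3_P1 : ~ iso H (dunion (cycle_graph 3) (path_graph 1)))
  (H_cases :
    (exists t : nat,
       induced_subgraph H (dunion (path_graph 3) (edgeless_graph t))) \/
    (exists2 t : nat, 1 <= t & iso H (star_graph t)) \/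
    #|vset H| <= 4) :
  polytime_certifying_pivot_minor H.
Proof.
case: H_cases => [[t [S _ isoH]]|[[t _ isoH]|le4]].
- apply: (@polytime_of_half_graph _ _ t.+2).
  apply: contains_trans (half_graph_P3_tP1 t) _; apply: (@contains_induced _ _ _ _ S).
  exact/contains_of_iso/iso_sym.
- apply: (@polytime_of_half_graph _ _ t.+1).
  exact: contains_target_iso (iso_sym isoH) (half_graph_star t).
have [b szb isoH] := bit_graph_iso le4; move: isoH; set k := #|vset H| => isoH.
have isoT (T : finType) (G : graph T) s : vset G = setT -> #|T| = k ->
    has_induced G s k b -> iso H G.
  by move=> vG cT /(has_induced_iso vG cT); apply: iso_trans; apply: iso_sym.
have half : in_half4 k b || in_pivoted_half4 k b -> polytime_certifying_pivot_minor H.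
  move/contains_half4/(contains_target_iso isoH); exact: polytime_of_half_graph.
have vT (T : finType) (e : rel T) : vset (graph_of_rel e) = setT by [].
case/or4P: (small_classified le4 szb) => [h|/andP[/eqP k3 h]|/andP[/eqP k4 h]|h].
- by apply: half; rewrite h.
- by apply: polytime_triangle; apply: isoT h => //; rewrite card_ord.
- case/or4P: h => h.
  + have isoP : iso paw_graph H by apply: iso_sym; apply: isoT h => //; rewrite card_ord.
    apply: polytime_pawlike (pawlike_iso isoP pawlike_paw_graph) _.
    exact: contains_of_iso.
  + have isoD : iso diamond_graph H by apply: iso_sym; apply: isoT h => //; rewrite card_ord.
    apply: polytime_pawlike (pawlike_iso isoD pawlike_diamond_graph) _.
    exact: contains_target_iso isoD paw_contains_diamond.
  + by case: H_neq_K4; apply: isoT h => //; rewrite card_ord.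
  + case: H_neq_C3_P1; apply: isoT h; last by rewrite card_sum !card_ord.
    by apply/setP=> -[x|x]; rewrite !inE.
- by apply: half; rewrite h orbT.
Qed.
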